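(* Assume Hypothesis (H). Then for every $\mu>0$: (1) if $\sum_{x\in\mathbb Z^d}\hat v(x)\ge0$, then $\sigma_{disc}(\hat{\bf h}_\mu)\cap(\mathfrak e_{\max},+\infty)\neq\emptyset$; (2) if $\sum_{x\in\mathbb Z^d}\hat v(x)\le0$, then $\sigma_{disc}(\hat{\bf h}_\mu)\cap(-\infty,\mathfrak e_{\min})\neq\emptyset$. Moreover, there exists $\mu_o=\mu_o(\mathfrak e,\hat v)>0$ such that for every $\mu\in(0,\mu_o)$: (a) if $\sum_x\hat v(x)>0$, then $\sigma_{disc}(\hat{\bf h}_\mu)\cap(\mathfrak e_{\max},+\infty)$ is a singleton $\{E(\mu)\}$ and $\sigma_{disc}(\hat{\bf h}_\mu)\cap(-\infty,\mathfrak e_{\min})=\emptyset$; (b) if $\sum_x\hat v(x)<0$, then $\sigma_{disc}(\hat{\bf h}_\mu)\cap(-\infty,\mathfrak e_{\min})$ is a singleton $\{e(\mu)\}$ and $\sigma_{disc}(\hat{\bf h}_\mu)\cap(\mathfrak e_{\max},+\infty)=\emptyset$; (c) if $\sum_x\hat v(x)=0$, then $\sigma_{disc}(\hat{\bf h}_\mu)\cap(\mathfrak e_{\max},+\infty)$ and $\sigma_{disc}(\hat{\bf h}_\mu)\cap(-\infty,\mathfrak e_{\min})$ are singletons $\{E(\mu)\}$ and $\{e(\mu)\}$ respectively.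
   Context: Let $d\in\{1,2\}$ and $\mathbb T^d=(-\pi,\pi]^d$ with normalized Haar measure $dp$. Let $\hat{\mathfrak e}\in\ell^1(\mathbb Z^d)$ with $\overline{\hat{\mathfrak e}(-x)}=\hat{\mathfrak e}(x)$, and $\hat v:\mathbb Z^d\to\mathbb R$. On $\ell^2(\mathbb Z^d)$ define $(\hat{\bf h}_0\hat f)(x)=\sum_{y}\hat{\mathfrak e}(y)\hat f(x+y)$, $(\hat{\bf v}\hat f)(x)=\hat v(x)\hat f(x)$, $\hat{\bf h}_\mu=\hat{\bf h}_0+\mu\hat{\bf v}$. Let $\mathfrak e(p)=\sum_x\hat{\mathfrak e}(x)e^{ix\cdot p}$ (continuous, real), $\mathfrak e_{\min}=\min\mathfrak e$, $\mathfrak e_{\max}=\max\mathfrak e$. Hypothesis (H): (a) $\mathfrak e$ has a unique minimum point $p_0$ and a unique maximum point $p^0$, is $C^2$ near both, and both are non-degenerate; (b) there exists $\gamma\in(0,1)$ with $0<\sum_{x}|x|^{2-d+\gamma}|\hat v(x)|<\infty$. Then $\sigma_{ess}(\hat{\bf h}_\mu)=[\mathfrak e_{\min},\mathfrak e_{\max}]$; $\sigma_{disc}$ denotes the discrete spectrum. *)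

(* Defs.v *)
From HB Require Import structures.
From mathcomp Require Import all_boot all_order all_algebra.
From mathcomp Require Import all_classical all_reals all_analysis.
From mathcomp Require Import complex.
Import numFieldNormedType.Exports.
Import Order.TTheory GRing.Theory Num.Theory.

Set Implicit Arguments.
Unset Strict Implicit.
Unset Printing Implicit Defensive.

Local Open Scope classical_set_scope.
Local Open Scope ring_scope.

Section Defs.
Variables (R : realType) (d : nat).

Definition Zd := 'rV[int]_d.

Definition cabs2 (z : R[i]) : R := complex.Re z ^+ 2 + complex.Im z ^+ 2.
Definition cabs (z : R[i]) : R := Num.sqrt (cabs2 z).
Definition cconj (z : R[i]) : R[i] := Complex (complex.Re z) (- complex.Im z).
Definition creal (r : R) : R[i] := Complex r 0.
Definition expi (t : R) : R[i] := Complex (cos t) (sin t).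

(** Sum over Z^d of a real function (meaningful for absolutely summable
    functions): positive part minus negative part, each an \esum. *)
Definition rsum (f : Zd -> R) : R :=
  fine (\esum_(x in [set: Zd]) (Num.max (f x) 0)%:E)%E
  - fine (\esum_(x in [set: Zd]) (Num.max (- f x) 0)%:E)%E.

Definition csum (f : Zd -> R[i]) : R[i] :=
  Complex (rsum (fun x => complex.Re (f x))) (rsum (fun x => complex.Im (f x))).

Definition in_l1 (f : Zd -> R[i]) : Prop :=
  (\esum_(x in [set: Zd]) (cabs (f x))%:E < +oo)%E.
Definition in_l2 (f : Zd -> R[i]) : Prop :=
  (\esum_(x in [set: Zd]) (cabs2 (f x))%:E < +oo)%E.
Definition l2norm2 (f : Zd -> R[i]) : R :=
  fine (\esum_(x in [set: Zd]) (cabs2 (f x))%:E)%E.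

Definition h0 (eh : Zd -> R[i]) (f : Zd -> R[i]) : Zd -> R[i] :=
  fun x => csum (fun y => eh y * f (x + y)).
Definition hmu (eh : Zd -> R[i]) (v : Zd -> R) (mu : R) (f : Zd -> R[i])
  : Zd -> R[i] := fun x => h0 eh f x + creal (mu * v x) * f x.

Definition spectrum (H : (Zd -> R[i]) -> (Zd -> R[i])) : set R[i] :=
  [set lam | ~ exists S : (Zd -> R[i]) -> (Zd -> R[i]),
      (forall g, in_l2 g -> in_l2 (S g)) /\
      (exists K : R, forall g, in_l2 g -> l2norm2 (S g) <= K * l2norm2 g) /\
      (forall f, in_l2 f -> S (fun x => H f x - lam * f x) = f) /\
      (forall g, in_l2 g -> (fun x => H (S g) x - lam * S g x) = g)].

Definition eigenspace (H : (Zd -> R[i]) -> (Zd -> R[i])) (lam : R[i])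
  : set (Zd -> R[i]) :=
  [set f | in_l2 f /\ H f = (fun x => lam * f x)].

Definition disc_spectrum (H : (Zd -> R[i]) -> (Zd -> R[i])) : set R[i] :=
  [set lam | spectrum H lam /\
     (exists eps : R, 0 < eps /\
        forall z, spectrum H z -> z <> lam -> eps <= cabs (z - lam)) /\
     (exists f, eigenspace H lam f /\ f <> (fun=> 0)) /\
     (exists (n : nat) (b : 'I_n -> Zd -> R[i]),
        forall f, eigenspace H lam f ->
          exists c : 'I_n -> R[i], f = (fun x => \sum_(k < n) c k * b k x))].

Definition rdisc (H : (Zd -> R[i]) -> (Zd -> R[i])) (E : R) : Prop :=
  disc_spectrum H (creal E).

(** The dispersion relation e(p) = sum_x eh(x) e^{i x.p} (real-valued under
    the symmetry assumption; we take its real part). *)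
Definition dotZ (x : Zd) (p : 'rV[R]_d) : R := \sum_(k < d) (x 0 k)%:~R * p 0 k.
Definition disp (eh : Zd -> R[i]) (p : 'rV[R]_d) : R :=
  complex.Re (csum (fun x => eh x * expi (dotZ x p))).

Definition torus (p : 'rV[R]_d) : Prop := forall k : 'I_d, - pi < p 0 k <= pi.

Definition unique_min_pt (f : 'rV[R]_d -> R) (p : 'rV[R]_d) : Prop :=
  torus p /\ forall q, torus q -> q <> p -> f p < f q.
Definition unique_max_pt (f : 'rV[R]_d -> R) (p : 'rV[R]_d) : Prop :=
  torus p /\ forall q, torus q -> q <> p -> f q < f p.

Definition ebase (k : 'I_d) : 'rV[R]_d := delta_mx 0 k.

Definition C2_near (f : 'rV[R]_d -> R) (p : 'rV[R]_d) : Prop :=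
  \forall q \near p,
    {for q, continuous f} /\
    forall k : 'I_d,
      derivable f q (ebase k) /\ {for q, continuous ('D_(ebase k) f)} /\
      forall l : 'I_d,
        derivable ('D_(ebase k) f) q (ebase l) /\
        {for q, continuous ('D_(ebase l) ('D_(ebase k) f))}.

Definition hessian (f : 'rV[R]_d -> R) (p : 'rV[R]_d) : 'M[R]_d :=
  \matrix_(k, l) 'D_(ebase l) ('D_(ebase k) f) p.

Definition nondegenerate_at (f : 'rV[R]_d -> R) (p : 'rV[R]_d) : Prop :=
  \det (hessian f p) != 0.

Definition znorm (x : Zd) : R := Num.sqrt (\sum_(k < d) ((x 0 k)%:~R) ^+ 2).
Definition weighted_sum (v : Zd -> R) (a : R) : \bar R :=
  (\esum_(x in [set: Zd]) (powR (znorm x) a * `|v x|)%:E)%E.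

End Defs.

(* Main.v *)
(** The spectrum above [emax] is governed by the form kin f = em |f|^2 - <h0 f, f>, which by the
    non-degeneracy of the maximum is comparable with the momentum average of |t|^2 |FT f(p + t)|^2.

    Uniqueness for small mu: after multiplication by e^{-ix.p}, a function vanishing at 0 satisfies the
    Hardy-type inequality |f(x)|^2 <= D |x|^a kin f with a = 2 - d + gamma, by Cauchy-Schwarz in momentum
    space. The moment condition on v then gives mu <v f, f> <= kin f for small mu, so the form is at
    most em on a space of codimension one and there is at most one eigenvalue above em. When the sum
    of v is negative, the same bound applied to f - f(0) shows that the form is at most em everywhere.

    Existence for every mu: a cut-off phi, equal to 1 on a large ball and of small Dirichlet energy (this
    needs d <= 2), corrected at one site where v does not vanish, makes the form exceed em. As v is the
    sum of a finitely supported and of a small potential, the spectrum above em consists of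
    eigenvalues: the resolvent is built by a Neumann series together with a finite
    Birman-Schwinger matrix.

    The bottom of the spectrum is the top for (- e, - v). Integrals over the torus are replaced by averages
    over fine finite grids. *)
Require Import Defs.
From HB Require Import structures.
From mathcomp Require Import all_boot all_order all_algebra.
From mathcomp Require Import finmap.
From mathcomp Require Import all_classical all_reals all_analysis.
From mathcomp Require Import complex.
From mathcomp Require Import ring lra zify.
Import numFieldNormedType.Exports.
Import Order.TTheory GRing.Theory Num.Theory.
Set Implicit Arguments.
Unset Strict Implicit.
Unset Printing Implicit Defensive.
Local Open Scope classical_set_scope.
Local Open Scope ring_scope.

(** * Summation over the lattice *)

(** The finite grids are exact rather than approximate: once the grid size exceeds the extent of a
    finite support, discrete Fourier inversion and Parseval hold as identities, so only the tail of
    the hopping amplitude and the passage to l2 produce errors.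

    The exponent a = 2 - d + gamma comes from the singular sum behind the Hardy-type bound:
    |e^(ix.t) - 1|^2 / |t|^2 is at most a constant times |x|^a |t|^(a - 2), and a - 2 = gamma - d >
    - d makes this integrable at t = 0.

    When the sum of v is 0, a cut-off alone has no potential energy at leading order. The one-site
    correction wins because its gain is linear in its size while its kinetic cost is quadratic,
    whatever the size of mu.

    A discrete eigenvalue must be spectral, isolated and of finite multiplicity. The supremum of the
    form is spectral since a maximizing sequence defeats every bounded inverse; isolation follows
    from counting, because eigenvalues above the band cannot outnumber the sites of the finite
    perturbation.

    The Hessian contains both mixed derivatives; they are identified by comparing two second-order
    expansions of the same function, taken in opposite orders. *)

Section Sums.
Variables (R : realType) (d : nat).
Local Notation T := (Zd d).
Implicit Types (f g : T -> R) (F G : {fset T}).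

Definition psum f F : R := \sum_(x <- F) f x.
Definition summ f := exists M, forall F, psum (fun x => `|f x|) F <= M.

Lemma psumD f g F : psum (fun x => f x + g x) F = psum f F + psum g F.
Proof. exact: big_split. Qed.
Lemma psumZ a f F : psum (fun x => a * f x) F = a * psum f F.
Proof. by rewrite /psum -big_distrr. Qed.
Lemma ler_psum f g F : (forall x, f x <= g x) -> psum f F <= psum g F.
Proof. by move=> h; apply: ler_sum. Qed.
Lemma psum_ge0 f F : (forall x, 0 <= f x) -> 0 <= psum f F.
Proof. by move=> h; apply: sumr_ge0. Qed.

Lemma psum_incl f F G : (F `<=` G)%fset -> (forall x, x \notin F -> f x = 0) ->
  psum f G = psum f F.
Proof.
by move=> FG h; apply/esym; apply: big_fset_incl => // x _; exact: h.
Qed.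

Lemma psum_split f F G : (F `<=` G)%fset ->
  psum f G = psum f F + psum (fun x => if x \in F then 0 else f x) G.
Proof.
move=> FG.
have -> : psum f F = psum (fun x => if x \in F then f x else 0) G.
  rewrite (psum_incl FG); last by move=> x /negbTE ->.
  by apply: eq_big_seq => x ->.
rewrite -psumD; apply: eq_bigr => x _; case: ifP; rewrite ?addr0 ?add0r//.
Qed.

Lemma psum_subset f F G : (forall x, 0 <= f x) -> (F `<=` G)%fset ->
  psum f F <= psum f G.
Proof. by move=> f0 h; rewrite (psum_split f h) lerDl psum_ge0// => x; case: ifP. Qed.

Let es f := (\esum_(x in [set: T]) (f x)%:E)%E.

Lemma psum_fsbig f (A : set T) : finite_set A ->
  \sum_(x \in A) (f x)%:E = (psum f (fset_set A))%:E.
Proof. by move=> fA; rewrite fsbig_finite// sumEFin. Qed.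

Lemma psum_le_esum f F : (forall x, 0 <= f x) -> ((psum f F)%:E <= es f)%E.
Proof.
move=> f0; apply: esum_ge; exists [set` F]; first by split.
by rewrite (psum_fsbig f (finite_fset F)) set_fsetK.
Qed.

Lemma esum_le f M : (forall F, psum f F <= M) -> (es f <= M%:E)%E.
Proof.
move=> h; apply: ge_ereal_sup => _ [A [fA _] <-].
by rewrite psum_fsbig// lee_fin.
Qed.

Lemma summP f : summ f <-> (\esum_(x in [set: T]) `|f x|%:E < +oo)%E.
Proof.
split=> [[M /esum_le h]|h]; first exact: le_lt_trans h (ltry _).
have e0 : (0 <= es (fun x => `|f x|%R))%E by apply: esum_ge0 => x _; rewrite lee_fin.
exists (fine (es (fun x => `|f x|%R))) => F.
rewrite -lee_fin fineK; last by rewrite ge0_fin_numE.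
exact: psum_le_esum.
Qed.

(** Convergence along the net of finite subsets. [rsum] separates positive and negative parts, which
    is not a linear operation, so the algebra of sums is done here and carried to [rsum] by
    uniqueness of the limit. *)
Definition has_sum f (s : R) := forall e, 0 < e -> exists F0 : {fset T},
  forall F, (F0 `<=` F)%fset -> `|psum f F - s| < e.

Lemma has_sum_uniq f s t : has_sum f s -> has_sum f t -> s = t.
Proof.
move=> hs ht; apply/eqP; rewrite -subr_eq0 -normr_le0; apply/ler_addgt0Pl => e e0.
rewrite addr0.
have [F hF] := hs _ (divr_gt0 e0 (ltr0Sn _ 1)).
have [G hG] := ht _ (divr_gt0 e0 (ltr0Sn _ 1)).
have h1 := hF (F `|` G)%fset (fsubsetUl _ _).
have h2 := hG (F `|` G)%fset (fsubsetUr _ _).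
rewrite distrC in h1.
have -> : s - t = (s - psum f (F `|` G)%fset) + (psum f (F `|` G)%fset - t) by ring.
by apply: (le_trans (ler_normD _ _)); rewrite [e]splitr ltW// ltrD.
Qed.

Lemma has_sum_lin a f g s t : has_sum f s -> has_sum g t ->
  has_sum (fun x => a * f x + g x) (a * s + t).
Proof.
move=> hs ht e e0.
have e1 : 0 < e / 2 / (`|a| + 1) by rewrite !divr_gt0// ltr_wpDl.
have [F hF] := hs _ e1.
have [G hG] := ht _ (divr_gt0 e0 (ltr0Sn _ 1)).
exists (F `|` G)%fset => K; rewrite fsubUset => /andP[/hF h1 /hG h2].
rewrite psumD psumZ.
have -> : a * psum f K + psum g K - (a * s + t) = a * (psum f K - s) + (psum g K - t)
  by ring.
apply: (le_lt_trans (ler_normD _ _)); rewrite [e]splitr ler_ltD// normrM.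
apply: (@le_trans _ _ ((`|a| + 1) * (e / 2 / (`|a| + 1)))); last first.
  by rewrite mulrC divfK// gt_eqF// ltr_wpDl.
by apply: ler_pM => //; [rewrite lerDl|exact: ltW].
Qed.

Lemma has_sum_ge0 f s : (forall x, 0 <= f x) -> has_sum f s -> 0 <= s.
Proof.
move=> f0 hs; apply/ler_addgt0Pl => e e0; have [F /(_ F (fsubset_refl _))] := hs _ e0.
move=> /ltr_normlP[_ h]; have := psum_ge0 F f0; lra.
Qed.

Lemma has_sum_esum f : (forall x, 0 <= f x) -> summ f -> has_sum f (fine (es f)).
Proof.
move=> f0 [M hM] e e0.
have ee : forall F, psum (fun x => `|f x|) F = psum f F.
  by move=> F; apply: eq_bigr => x _; rewrite ger0_norm.
have fin : es f \is a fin_num.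
  rewrite ge0_fin_numE; last by apply: esum_ge0 => x _; rewrite lee_fin.
  by apply: (le_lt_trans (@esum_le f M _)); [move=> F; rewrite -ee|exact: ltry].
have [F0 hF0] : exists F0, fine (es f) - e < psum f F0.
  apply: contrapT => /forallNP h.
  have : (es f <= (fine (es f) - e)%:E)%E.
    by apply: esum_le => F; have /negP := h F; rewrite -leNgt.
  rewrite -{1}(fineK fin) lee_fin; lra.
exists F0 => F /(psum_subset f0) h; rewrite ltr_norml.
have : psum f F <= fine (es f) by rewrite -lee_fin fineK//; exact: psum_le_esum.
by move=> h2; apply/andP; split; lra.
Qed.

Lemma summ_le f g : (forall x, `|f x| <= g x) -> summ g -> summ f.
Proof.
move=> h [M hM]; exists M => F; apply: le_trans (hM F).
by apply: ler_psum => x; apply: le_trans (h x) (ler_norm _).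
Qed.

Lemma rsum_has f : summ f -> has_sum f (rsum f).
Proof.
move=> sf; rewrite /rsum -/(es (fun x => Num.max (f x) 0)) -/(es (fun x => Num.max (- f x) 0)).
have sp : summ (fun x => Num.max (f x) 0).
  have [M hM] := sf; exists M => F; apply: le_trans (hM F); apply: ler_psum => x.
  by rewrite /Num.max; case: ifP => [_|_]; rewrite ?normr0.
have sn : summ (fun x => Num.max (- f x) 0).
  have [M hM] := sf; exists M => F; apply: le_trans (hM F); apply: ler_psum => x.
  by rewrite /Num.max; case: ifP => [_|_]; rewrite ?normr0 ?normrN.
have hp := has_sum_esum _ sp.
have hn := has_sum_esum _ sn.
have ef : f = (fun x => -1 * Num.max (- f x) 0 + Num.max (f x) 0).
  apply/funext => x; have [h|h] := leP 0 (f x).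
    by rewrite max_r ?oppr_le0// mulr0 add0r.
  by rewrite max_l ?oppr_ge0 1?ltW// addr0 mulN1r opprK.
rewrite addrC -mulN1r [X in has_sum X _]ef; apply: has_sum_lin.
  by apply: hn => x; rewrite le_max lexx orbT.
by apply: hp => x; rewrite le_max lexx orbT.
Qed.

Lemma rsumE f s : summ f -> has_sum f s -> rsum f = s.
Proof. by move=> /rsum_has h1 h2; exact: has_sum_uniq h1 h2. Qed.

Lemma summ_lin a f g : summ f -> summ g -> summ (fun x => a * f x + g x).
Proof.
move=> [M hM] [N hN]; exists (`|a| * M + N) => F.
apply: (@le_trans _ _ (psum (fun x => `|a| * `|f x| + `|g x|) F)).
  by apply: ler_psum => x; rewrite -normrM ler_normD.
by rewrite psumD psumZ; apply: lerD => //; apply: ler_wpM2l.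
Qed.

Lemma rsum_lin a f g : summ f -> summ g ->
  rsum (fun x => a * f x + g x) = a * rsum f + rsum g.
Proof.
move=> sf sg; apply: rsumE; first exact: summ_lin.
by apply: has_sum_lin; exact: rsum_has.
Qed.

Lemma summ_fin F f : (forall x, x \notin F -> f x = 0) -> summ f.
Proof.
move=> h; exists (psum (fun x => `|f x|) F) => G.
apply: (@le_trans _ _ (psum (fun x => `|f x|) (F `|` G)%fset)).
  by apply: psum_subset => //; exact: fsubsetUr.
by rewrite (psum_incl (fsubsetUl F G)) // => x /h ->; rewrite normr0.
Qed.

Lemma rsum_fin F f : (forall x, x \notin F -> f x = 0) -> rsum f = psum f F.
Proof.
move=> h; apply: rsumE; first exact: summ_fin h.
move=> e e0; exists F => G FG; rewrite (psum_incl FG h) subrr normr0//.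
Qed.

Lemma summ0 : summ (fun _ => 0).
Proof. exact: (@summ_fin fset0). Qed.
Lemma rsum0 : rsum (fun _ : T => 0 : R) = 0.
Proof. by rewrite (@rsum_fin fset0)// /psum big_seq_fset0. Qed.

Lemma summZ a f : summ f -> summ (fun x => a * f x).
Proof.
move=> sf; have := summ_lin a sf summ0.
by under [in X in X -> _]eq_fun do rewrite addr0.
Qed.
Lemma rsumZ a f : summ f -> rsum (fun x => a * f x) = a * rsum f.
Proof.
move=> sf; have := rsum_lin a sf summ0; rewrite rsum0 addr0 => <-.
by congr rsum; apply/funext => x; rewrite addr0.
Qed.
Lemma summD f g : summ f -> summ g -> summ (fun x => f x + g x).
Proof.
move=> sf sg; have := summ_lin 1 sf sg.
by under [in X in X -> _]eq_fun do rewrite mul1r.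
Qed.
Lemma rsumD f g : summ f -> summ g -> rsum (fun x => f x + g x) = rsum f + rsum g.
Proof.
move=> sf sg; have := rsum_lin 1 sf sg; rewrite mul1r => <-.
by congr rsum; apply/funext => x; rewrite mul1r.
Qed.
Lemma summN f : summ f -> summ (fun x => - f x).
Proof. by move=> [M hM]; exists M => F; under eq_fun do rewrite normrN. Qed.
Lemma rsumN f : summ f -> rsum (fun x => - f x) = - rsum f.
Proof.
move=> sf; rewrite -mulN1r -rsumZ//.
by congr rsum; apply/funext => x; rewrite mulN1r.
Qed.
Lemma summ_abs f : summ f -> summ (fun x => `|f x|).
Proof. by move=> [M hM]; exists M => F; under eq_fun do rewrite normr_id. Qed.

Lemma rsum_ge0 f : (forall x, 0 <= f x) -> summ f -> 0 <= rsum f.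
Proof. by move=> f0 /rsum_has; exact: has_sum_ge0. Qed.

Lemma ler_rsum f g : (forall x, f x <= g x) -> summ f -> summ g -> rsum f <= rsum g.
Proof.
move=> h sf sg; rewrite -subr_ge0 -rsumN// -rsumD//; last exact: summN.
by apply: rsum_ge0; [move=> x; rewrite subr_ge0|apply: summD => //; exact: summN].
Qed.

Lemma norm_rsum_le f g : (forall x, `|f x| <= g x) -> summ g -> `|rsum f| <= rsum g.
Proof.
move=> h sg; have sf := summ_le h sg.
have h1 x : - g x <= f x <= g x by rewrite -ler_norml.
rewrite ler_norml -rsumN//; apply/andP; split; apply: ler_rsum => //;
 by [exact: summN|move=> x; case/andP: (h1 x)].
Qed.

Lemma psum_le_rsum f F : (forall x, 0 <= f x) -> summ f -> psum f F <= rsum f.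
Proof.
move=> f0 sf; rewrite -subr_ge0; apply/ler_addgt0Pl => e e0.
have [F0 /(_ (F `|` F0)%fset (fsubsetUr _ _))/ltr_normlP[_ h]] := rsum_has sf e0.
have := psum_subset f0 (fsubsetUl F F0); lra.
Qed.

Lemma rsum_le f M : (forall x, 0 <= f x) -> (forall F, psum f F <= M) ->
  summ f /\ rsum f <= M.
Proof.
move=> f0 h; have sf : summ f.
  by exists M => F; rewrite (_ : (fun _ => _) = f)//; apply/funext => x; rewrite ger0_norm.
split => //; apply/ler_addgt0Pl => e e0.
have [F /(_ F (fsubset_refl _))/ltr_normlP[h1 _]] := rsum_has sf e0.
have := h F; lra.
Qed.

(** Quantifying over all supersets [G] lets one union of finite sets meet several smallness
    requirements at once. *)
Lemma rsum_tail f e : summ f -> 0 < e -> exists F : {fset T}, forall G, (F `<=` G)%fset ->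
  rsum (fun x => if x \in G then 0 else `|f x|) < e.
Proof.
move=> /summ_abs sf e0; have [F hF] := rsum_has sf e0; exists F => G /hF.
rewrite distrC => /ltr_normlP[_]; apply: le_lt_trans.
have sg : summ (fun x => if x \in G then 0 else `|f x|).
  by apply: summ_le sf => x; case: ifP; rewrite ?normr0 ?normr_id.
have sh : summ (fun x => if x \in G then `|f x| else 0).
  by apply: summ_le sf => x; case: ifP; rewrite ?normr0 ?normr_id.
have -> : psum (fun x => `|f x|) G = rsum (fun x => if x \in G then `|f x| else 0).
  rewrite (@rsum_fin G); last by move=> x /negbTE ->.
  by apply: eq_big_seq => x ->.
rewrite -[X in X - _]/(rsum (fun x => `|f x|)) lerBrDl -rsumD//.
by apply: ler_rsum => //; [move=> x; case: ifP; rewrite ?addr0 ?add0r|exact: summD].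
Qed.

Lemma psum_reindex (h k : T -> T) f F : cancel h k -> cancel k h ->
  psum (fun x => f (h x)) F = psum f [fset h x | x in F]%fset.
Proof.
move=> hk kh; rewrite /psum big_imfset//= => x y _ _; exact: (can_inj hk).
Qed.

Lemma summ_reindex (h k : T -> T) f : cancel h k -> cancel k h ->
  summ f -> summ (fun x => f (h x)).
Proof.
move=> hk kh [M hM]; exists M => F.
by rewrite (@psum_reindex h k (fun x => `|f x|)).
Qed.

Lemma rsum_reindex (h k : T -> T) f : cancel h k -> cancel k h ->
  summ f -> rsum (fun x => f (h x)) = rsum f.
Proof.
move=> hk kh sf; apply: rsumE; first exact: summ_reindex hk kh sf.
move=> e e0; have [F hF] := rsum_has sf e0; exists [fset k x | x in F]%fset => G /fsubsetP FG.
rewrite (psum_reindex f G hk kh); apply: hF; apply/fsubsetP => x xF.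
apply/imfsetP; exists (k x); last by rewrite kh.
by apply: FG; apply/imfsetP; exists x.
Qed.

Lemma summ_psum (I : Type) (r : seq I) (f : I -> T -> R) : (forall i, summ (f i)) ->
  summ (fun x => \sum_(i <- r) f i x).
Proof.
move=> h; elim: r => [|i r IH].
  by rewrite (_ : (fun _ => _) = fun=> 0); [exact: summ0|apply/funext => x; rewrite big_nil].
rewrite (_ : (fun _ => _) = fun x => f i x + \sum_(j <- r) f j x); first exact: summD.
by apply/funext => x; rewrite big_cons.
Qed.

Lemma rsum_psum (I : Type) (r : seq I) (f : I -> T -> R) : (forall i, summ (f i)) ->
  rsum (fun x => \sum_(i <- r) f i x) = \sum_(i <- r) rsum (f i).
Proof.
move=> h; elim: r => [|i r IH].
  by rewrite big_nil -[RHS]rsum0; congr rsum; apply/funext => x; rewrite big_nil.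
rewrite big_cons -IH -rsumD//; last exact: summ_psum.
by congr rsum; apply/funext => x; rewrite big_cons.
Qed.
End Sums.

(** * The Hilbert space *)

Section L2.
Variables (R : realType) (d : nat).
Local Notation T := (Zd d).
Local Notation C := R[i].
Implicit Types (f g h : T -> C) (F G : {fset T}).

(** The real part of the Hermitian product. Quadratic forms of symmetric operators are real, so the
    real Hilbert structure carries the variational arguments; an imaginary part is recovered by
    pairing with i f. *)
Definition ipr (z w : C) : R :=
  complex.Re z * complex.Re w + complex.Im z * complex.Im w.

Lemma iprzz z : ipr z z = cabs2 z. Proof. by rewrite /cabs2 !expr2. Qed.
Lemma iprC z w : ipr z w = ipr w z. Proof. by rewrite /ipr; ring. Qed.
Lemma iprDl z w u : ipr (z + w) u = ipr z u + ipr w u.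
Proof. by case: z w u => [a b] [a' b'] [a'' b''] /=; rewrite /ipr /=; ring. Qed.
Lemma iprMl z w u : ipr (z * w) u = ipr w (cconj z * u).
Proof. by case: z w u => [a b] [a' b'] [a'' b''] /=; rewrite /ipr /cconj /=; ring. Qed.
Lemma iprZl (r : R) z w : ipr (creal r * z) w = r * ipr z w.
Proof. by case: z w => [a b] [a' b']; rewrite /ipr /creal /=; ring. Qed.
Lemma cabs2_ge0 (z : C) : 0 <= cabs2 z.
Proof. by rewrite /cabs2 addr_ge0 ?sqr_ge0. Qed.
Lemma cabs2M (z w : C) : cabs2 (z * w) = cabs2 z * cabs2 w.
Proof. by case: z w => [a b] [a' b'] /=; rewrite /cabs2 /=; ring. Qed.
Lemma cabs2N (z : C) : cabs2 (- z) = cabs2 z.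
Proof. by case: z => [a b]; rewrite /cabs2 /= !sqrrN. Qed.
Lemma cabs2_creal (r : R) : cabs2 (creal r) = r ^+ 2.
Proof. by rewrite /cabs2 /= expr0n addr0. Qed.
Lemma cabs2_0 : cabs2 (0 : C) = 0.
Proof. by rewrite /cabs2 /= expr0n addr0. Qed.
Lemma cabs2_eq0 (z : C) : cabs2 z = 0 -> z = 0.
Proof.
case: z => a b; rewrite /cabs2 /= => /eqP; rewrite paddr_eq0 ?sqr_ge0// !sqrf_eq0.
by case/andP => /eqP -> /eqP ->.
Qed.
Lemma cabs2D (z w : C) : cabs2 (z + w) = cabs2 z + 2 * ipr z w + cabs2 w.
Proof. by case: z w => [a b] [a' b'] /=; rewrite /cabs2 /ipr /=; ring. Qed.
Lemma ipr_le (z w : C) : `|ipr z w| <= cabs2 z + cabs2 w.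
Proof.
have h1 := cabs2_ge0 (z + w); have h2 := cabs2_ge0 (z - w).
rewrite cabs2D in h1; rewrite cabs2D cabs2N in h2.
have e : ipr z (- w) = - ipr z w by rewrite /ipr; case: w {h1 h2} => a b /=; ring.
have := cabs2_ge0 z; have := cabs2_ge0 w.
by rewrite e in h2; rewrite ler_norml; move=> ? ?; apply/andP; split; lra.
Qed.
Lemma cabs2D_le (z w : C) : cabs2 (z + w) <= 2 * cabs2 z + 2 * cabs2 w.
Proof.
have h2 := cabs2_ge0 (z - w); rewrite cabs2D cabs2N in h2.
have e : ipr z (- w) = - ipr z w by rewrite /ipr; case: w {h2} => a b /=; ring.
by rewrite e in h2; rewrite cabs2D; lra.
Qed.
Lemma cabs_sqr (z : C) : cabs z ^+ 2 = cabs2 z.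
Proof. by rewrite /cabs sqr_sqrtr// cabs2_ge0. Qed.

Lemma in_l2P f : in_l2 f <-> summ (fun x => cabs2 (f x)).
Proof.
rewrite summP /in_l2; under [X in _ <-> (X < _)%E]eq_esum => x _ do
  rewrite (ger0_norm (cabs2_ge0 _)); by [].
Qed.

Definition ip f g := rsum (fun x => ipr (f x) (g x)).
Definition n2 f := ip f f.

Lemma n2E f : n2 f = rsum (fun x => cabs2 (f x)).
Proof. by rewrite /n2 /ip; congr rsum; apply/funext => x; rewrite iprzz. Qed.

Lemma l2norm2E f : in_l2 f -> l2norm2 f = n2 f.
Proof.
move=> /in_l2P sf; rewrite n2E /l2norm2; apply/esym/rsumE => //.
by apply: has_sum_esum => // x; exact: cabs2_ge0.
Qed.

Lemma l2_lin a f g : in_l2 f -> in_l2 g -> in_l2 (fun x => a * f x + g x).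
Proof.
move=> /in_l2P sf /in_l2P sg; apply/in_l2P.
apply: (@summ_le _ _ _ (fun x => 2 * cabs2 a * cabs2 (f x) + 2 * cabs2 (g x))).
  move=> x; rewrite ger0_norm ?cabs2_ge0//; apply: le_trans (cabs2D_le _ _) _.
  by rewrite cabs2M mulrA.
by apply: summ_lin => //; exact: summZ.
Qed.
Lemma l2_fin F f : (forall x, x \notin F -> f x = 0) -> in_l2 f.
Proof.
move=> h; apply/in_l2P; apply: (@summ_fin _ _ F) => x /h ->.
exact: cabs2_0.
Qed.
Lemma l2_0 : in_l2 (fun _ : T => 0 : C).
Proof. exact: (@l2_fin fset0). Qed.
Lemma l2Z a f : in_l2 f -> in_l2 (fun x => a * f x).
Proof.
move=> sf; have := l2_lin a sf l2_0.
by under [in X in X -> _]eq_fun do rewrite addr0.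
Qed.
Lemma l2D f g : in_l2 f -> in_l2 g -> in_l2 (fun x => f x + g x).
Proof.
move=> sf sg; have := l2_lin 1 sf sg.
by under [in X in X -> _]eq_fun do rewrite mul1r.
Qed.
Lemma l2N f : in_l2 f -> in_l2 (fun x => - f x).
Proof.
move=> sf; have := l2Z (-1) sf.
by under [in X in X -> _]eq_fun do rewrite mulN1r.
Qed.
Lemma l2B f g : in_l2 f -> in_l2 g -> in_l2 (fun x => f x - g x).
Proof. by move=> sf sg; apply: l2D => //; exact: l2N. Qed.

Lemma summ_ip f g : in_l2 f -> in_l2 g -> summ (fun x => ipr (f x) (g x)).
Proof.
move=> /in_l2P sf /in_l2P sg; apply: summ_le (summD sf sg) => x; exact: ipr_le.
Qed.

Lemma ipC f g : ip f g = ip g f.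
Proof. by congr rsum; apply/funext => x; exact: iprC. Qed.
Lemma ipDl f g h : in_l2 f -> in_l2 g -> in_l2 h ->
  ip (fun x => f x + g x) h = ip f h + ip g h.
Proof.
move=> sf sg sh; rewrite /ip -rsumD; try exact: summ_ip.
by congr rsum; apply/funext => x; exact: iprDl.
Qed.
Lemma ipDr f g h : in_l2 f -> in_l2 g -> in_l2 h ->
  ip h (fun x => f x + g x) = ip h f + ip h g.
Proof. by move=> sf sg sh; rewrite ipC ipDl// !(ipC h). Qed.
Lemma ipMl a f g : ip (fun x => a * f x) g = ip f (fun x => cconj a * g x).
Proof. by congr rsum; apply/funext => x; exact: iprMl. Qed.
Lemma ipZl r f g : in_l2 f -> in_l2 g -> ip (fun x => creal r * f x) g = r * ip f g.
Proof.
move=> sf sg; rewrite /ip -rsumZ; last exact: summ_ip.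
by congr rsum; apply/funext => x; exact: iprZl.
Qed.
Lemma ipZr r f g : in_l2 f -> in_l2 g -> ip f (fun x => creal r * g x) = r * ip f g.
Proof. by move=> sf sg; rewrite ipC ipZl// ipC. Qed.
Lemma ipNl f g : in_l2 f -> in_l2 g -> ip (fun x => - f x) g = - ip f g.
Proof.
move=> sf sg; rewrite /ip -rsumN; last exact: summ_ip.
by congr rsum; apply/funext => x; rewrite /ipr; case: (f x) => a b /=; ring.
Qed.
Lemma ipNr f g : in_l2 f -> in_l2 g -> ip f (fun x => - g x) = - ip f g.
Proof. by move=> sf sg; rewrite ipC ipNl// ipC. Qed.
Lemma ipBl f g h : in_l2 f -> in_l2 g -> in_l2 h ->
  ip (fun x => f x - g x) h = ip f h - ip g h.
Proof. by move=> sf sg sh; rewrite ipDl ?ipNl//; exact: l2N. Qed.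
Lemma ipBr f g h : in_l2 f -> in_l2 g -> in_l2 h ->
  ip h (fun x => f x - g x) = ip h f - ip h g.
Proof. by move=> sf sg sh; rewrite ipDr ?ipNr//; exact: l2N. Qed.
Lemma ip0l f : ip (fun=> 0) f = 0.
Proof.
by rewrite /ip -[RHS](@rsum0 R d); congr rsum; apply/funext => x; rewrite /ipr /= !mul0r addr0.
Qed.

Lemma n2_0 : n2 (fun=> 0) = 0. Proof. exact: ip0l. Qed.
Lemma n2_ge0 f : in_l2 f -> 0 <= n2 f.
Proof.
by move=> /in_l2P sf; rewrite n2E; apply: rsum_ge0 => // x; exact: cabs2_ge0.
Qed.
Lemma cabs2_le_n2 f x : in_l2 f -> cabs2 (f x) <= n2 f.
Proof.
move=> /in_l2P sf; rewrite n2E.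
have := @psum_le_rsum _ _ _ [fset x]%fset (fun x => cabs2_ge0 (f x)) sf.
by rewrite /psum big_seq_fset1.
Qed.
Lemma n2_eq0 f : in_l2 f -> n2 f <= 0 -> f = fun=> 0.
Proof.
move=> sf h; apply/funext => x; apply: cabs2_eq0; apply/eqP.
by rewrite eq_le cabs2_ge0 andbT (le_trans (cabs2_le_n2 x sf)).
Qed.
Lemma n2M a f : in_l2 f -> n2 (fun x => a * f x) = cabs2 a * n2 f.
Proof.
move=> /in_l2P sf; rewrite !n2E -rsumZ//.
by congr rsum; apply/funext => x; rewrite cabs2M.
Qed.
Lemma n2D f g : in_l2 f -> in_l2 g ->
  n2 (fun x => f x + g x) = n2 f + 2 * ip f g + n2 g.
Proof.
move=> sf sg; rewrite {1}/n2 ipDl ?ipDr//; try exact: l2D.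
by rewrite (ipC g f) /n2; ring.
Qed.
Lemma n2N f : n2 (fun x => - f x) = n2 f.
Proof. by rewrite !n2E; congr rsum; apply/funext => x; rewrite cabs2N. Qed.
Lemma n2B f g : in_l2 f -> in_l2 g ->
  n2 (fun x => f x - g x) = n2 f - 2 * ip f g + n2 g.
Proof.
by move=> sf sg; rewrite n2D//; [rewrite ipNr// n2N; ring|exact: l2N].
Qed.
Lemma n2D_le f g : in_l2 f -> in_l2 g ->
  n2 (fun x => f x + g x) <= 2 * n2 f + 2 * n2 g.
Proof.
move=> sf sg; have := n2_ge0 (l2B sf sg); rewrite n2B// n2D//; lra.
Qed.
Lemma n2_sub f g h : in_l2 f -> in_l2 g -> in_l2 h ->
  n2 (fun x => f x - h x) <= 2 * n2 (fun x => f x - g x) + 2 * n2 (fun x => g x - h x).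
Proof.
move=> sf sg sh; apply: le_trans (n2D_le (l2B sf sg) (l2B sg sh)).
by rewrite (_ : (fun _ => _) = fun x => f x - h x)//; apply/funext => x; rewrite subrKA.
Qed.

Lemma CS f g : in_l2 f -> in_l2 g -> ip f g ^+ 2 <= n2 f * n2 g.
Proof.
move=> sf sg; have [g0|g0] := leP (n2 g) 0.
  by rewrite (n2_eq0 sg g0) ipC ip0l n2_0 mulr0 expr0n.
(* The square norm of |g|^2 f - <f, g> g is |g|^2 times the difference of the two sides. *)
have h := n2_ge0 (l2B (l2Z (creal (n2 g)) sf) (l2Z (creal (ip f g)) sg)).
rewrite n2B ?n2M ?ipZl ?ipZr ?cabs2_creal in h; try by [|exact: l2Z].
rewrite -subr_ge0 -(pmulr_rge0 _ g0); move: h; congr (_ <= _); ring.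
Qed.

Definition nrm f := Num.sqrt (n2 f).
Lemma nrm_ge0 f : 0 <= nrm f. Proof. exact: sqrtr_ge0. Qed.
Lemma nrm_sqr f : in_l2 f -> nrm f ^+ 2 = n2 f.
Proof. by move=> sf; rewrite sqr_sqrtr// n2_ge0. Qed.
Lemma ip_le f g : in_l2 f -> in_l2 g -> `|ip f g| <= nrm f * nrm g.
Proof.
move=> sf sg; rewrite -(@ler_pXn2r _ 2)// ?nnegrE// ?mulr_ge0 ?nrm_ge0//.
by rewrite -normrX ger0_norm ?sqr_ge0// exprMn !nrm_sqr// CS.
Qed.
Lemma nrmD f g : in_l2 f -> in_l2 g -> nrm (fun x => f x + g x) <= nrm f + nrm g.
Proof.
move=> sf sg; rewrite -(@ler_pXn2r _ 2)// ?nnegrE// ?addr_ge0 ?nrm_ge0//.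
rewrite nrm_sqr ?n2D//; last exact: l2D.
rewrite sqrrD !nrm_sqr// lerD2r lerD2l mulr_natl lerMn2r /=.
exact: le_trans (ler_norm _) (ip_le sf sg).
Qed.
Lemma nrm_le f r : 0 <= r -> n2 f <= r ^+ 2 -> nrm f <= r.
Proof. by move=> r0 h; rewrite -(ger0_norm r0) -sqrtr_sqr; exact: ler_wsqrtr. Qed.

Lemma l2_bmul (k : T -> C) M f : (forall x, cabs2 (k x) <= M) -> in_l2 f ->
  in_l2 (fun x => k x * f x) /\ n2 (fun x => k x * f x) <= M * n2 f.
Proof.
move=> hk /in_l2P sf.
have h : in_l2 (fun x => k x * f x).
  apply/in_l2P; apply: (@summ_le _ _ _ (fun x => M * cabs2 (f x))); last exact: summZ.
  by move=> x; rewrite ger0_norm ?cabs2_ge0// cabs2M ler_wpM2r ?cabs2_ge0.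
split => //; rewrite !n2E -rsumZ//; apply: ler_rsum; [|exact/in_l2P|exact: summZ].
by move=> x; rewrite cabs2M ler_wpM2r ?cabs2_ge0.
Qed.

Lemma in_l2_le f g : (forall x, cabs2 (f x) <= cabs2 (g x)) -> in_l2 g -> in_l2 f.
Proof.
move=> h /in_l2P sg; apply/in_l2P; apply: summ_le sg => x.
by rewrite ger0_norm ?cabs2_ge0.
Qed.

Lemma cvg_of_cauchy (u e : nat -> R) : e @ \oo --> 0 ->
  (forall n m, (n <= m)%N -> `|u m - u n| <= e n) -> cvgn u.
Proof.
move=> e0 h; apply/cauchy_cvgP; apply/cauchy_exP => eps eps0.
have /cvgrPdist_lt /(_ _ eps0) [n _ /(_ n (leqnn n))] := e0.
rewrite /= sub0r normrN => hn.
exists (u n); exists n => // m /= nm; rewrite /ball /= distrC.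
by apply: le_lt_trans (h _ _ nm) (le_lt_trans (ler_norm _) hn).
Qed.

Lemma cvg_psum (u : nat -> T -> R) (v : T -> R) F :
  (forall x, u ^~ x @ \oo --> v x) -> (fun n => psum (u n) F) @ \oo --> psum v F.
Proof.
move=> h; rewrite /psum; elim: (enum_fset F) => [|x r IH].
  rewrite big_nil; under eq_fun do rewrite big_nil; exact: cvg_cst.
rewrite big_cons; under eq_fun do rewrite big_cons.
by apply: cvgD.
Qed.

(** Each coordinate is Cauchy, being dominated by the norm. The bound [e n] survives the pointwise
    limit on every finite set, hence on the whole lattice. *)
Lemma l2_complete (g : nat -> T -> C) (e : nat -> R) :
  (forall n, in_l2 (g n)) -> e @ \oo --> 0 ->
  (forall n m, (n <= m)%N -> n2 (fun x => g m x - g n x) <= e n ^+ 2) ->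
  (forall n, 0 <= e n) ->
  exists h, in_l2 h /\ forall n, n2 (fun x => h x - g n x) <= e n ^+ 2.
Proof.
move=> gl2 e0 h ege0.
have hx x n m : (n <= m)%N -> cabs2 (g m x - g n x) <= e n ^+ 2.
  by move=> /h; apply: le_trans; exact: (cabs2_le_n2 x (l2B (gl2 m) (gl2 n))).
have sq (a b : R) : 0 <= b -> a ^+ 2 <= b ^+ 2 -> `|a| <= b.
  by move=> b0; rewrite -(real_normK (num_real a)) ler_pXn2r ?nnegrE.
have cre x : cvgn (fun n => complex.Re (g n x)).
  apply: (cvg_of_cauchy e0) => n m nm; apply: sq => //; apply: le_trans (hx x _ _ nm).
  by case: (g m x) => a b; case: (g n x) => a' b'; rewrite /cabs2 /= lerDl sqr_ge0.
have cim x : cvgn (fun n => complex.Im (g n x)).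
  apply: (cvg_of_cauchy e0) => n m nm; apply: sq => //; apply: le_trans (hx x _ _ nm).
  by case: (g m x) => a b; case: (g n x) => a' b'; rewrite /cabs2 /= lerDr sqr_ge0.
pose k x := Complex (lim ((fun n => complex.Re (g n x)) @ \oo))
                    (lim ((fun n => complex.Im (g n x)) @ \oo)).
have ck n x : (fun m => cabs2 (g m x - g n x)) @ \oo --> cabs2 (k x - g n x).
  have -> : (fun m => cabs2 (g m x - g n x)) =
     (fun m => (complex.Re (g m x) - complex.Re (g n x)) * (complex.Re (g m x) - complex.Re (g n x))
      + (complex.Im (g m x) - complex.Im (g n x)) * (complex.Im (g m x) - complex.Im (g n x))).
    by apply/funext => m; case: (g m x) => a b; case: (g n x) => a' b'; rewrite /cabs2 /= !expr2.
  have -> : cabs2 (k x - g n x) = (complex.Re (k x) - complex.Re (g n x)) * (complex.Re (k x) - complex.Re (g n x))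
      + (complex.Im (k x) - complex.Im (g n x)) * (complex.Im (k x) - complex.Im (g n x)).
    by rewrite /k; case: (g n x) => a' b'; rewrite /cabs2 /= !expr2.
  by apply: cvgD; apply: cvgM; apply: cvgB => //; exact: cvg_cst.
have hF n F : psum (fun x => cabs2 (k x - g n x)) F <= e n ^+ 2.
  have c := @cvg_psum (fun m x => cabs2 (g m x - g n x)) _ F (ck n).
  rewrite -(cvg_lim _ c)//; apply: limr_le; first by apply/cvg_ex; eexists; exact: c.
  exists n => // m /= nm; apply: le_trans (h _ _ nm); rewrite n2E.
  apply: psum_le_rsum; first by move=> x; exact: cabs2_ge0.
  by apply/in_l2P; exact: l2B.
have sk n : in_l2 (fun x => k x - g n x) /\ n2 (fun x => k x - g n x) <= e n ^+ 2.
  by have [h1 h2] := rsum_le (fun x => cabs2_ge0 _) (hF n); rewrite n2E; split => //; exact/in_l2P.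
exists k; split => [|n]; last by case: (sk n).
have [h1 _] := sk 0%N; have := l2D h1 (gl2 0%N).
by under [in X in X -> _]eq_fun do rewrite subrK.
Qed.

(** Linearity is confined to l2 because [csum] of a non-summable family is a default value without
    algebraic meaning. *)
Definition l2lin (L : (T -> C) -> (T -> C)) := (forall f, in_l2 f -> in_l2 (L f)) /\
  (forall a f g, in_l2 f -> in_l2 g ->
    L (fun x => a * f x + g x) = fun x => a * L f x + L g x).

Lemma l2lin0 L : l2lin L -> L (fun=> 0) = fun=> 0.
Proof.
case=> _ h; have := h (-1) _ _ l2_0 l2_0.
rewrite (_ : (fun=> -1 * 0 + 0) = fun=> 0); last by apply/funext => x; rewrite mulr0 addr0.
move=> e; rewrite e; apply/funext => x /=; rewrite -[RHS](subrr (L (fun=> 0) x)); ring.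
Qed.
Lemma l2linZ L a f : l2lin L -> in_l2 f -> L (fun x => a * f x) = fun x => a * L f x.
Proof.
move=> hL sf; have := hL.2 a _ _ sf l2_0; rewrite (l2lin0 hL).
by under eq_fun do rewrite addr0; move=> ->; apply/funext => x; rewrite addr0.
Qed.
Lemma l2linD L f g : l2lin L -> in_l2 f -> in_l2 g ->
  L (fun x => f x + g x) = fun x => L f x + L g x.
Proof.
move=> hL sf sg; have := hL.2 1 _ _ sf sg.
by under eq_fun do rewrite mul1r; move=> ->; apply/funext => x; rewrite mul1r.
Qed.
Lemma l2linN L f : l2lin L -> in_l2 f -> L (fun x => - f x) = fun x => - L f x.
Proof.
move=> hL sf; have := l2linZ (-1) hL sf.
by under eq_fun do rewrite mulN1r; move=> ->; apply/funext => x; rewrite mulN1r.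
Qed.
Lemma l2linB L f g : l2lin L -> in_l2 f -> in_l2 g ->
  L (fun x => f x - g x) = fun x => L f x - L g x.
Proof. by move=> hL sf sg; rewrite l2linD// ?l2linN//; exact: l2N. Qed.

Lemma neumann L q : l2lin L -> 0 <= q < 1 ->
  (forall f, in_l2 f -> n2 (L f) <= q ^+ 2 * n2 f) ->
  forall f, in_l2 f -> exists g, in_l2 g /\ g = (fun x => f x + L g x).
Proof.
move=> hL /andP[q0 q1] hq f sf.
(* Partial sums of the Neumann series, starting from 0 so that the first one is f. *)
pose g n := iter n (fun g x => f x + L g x) (fun=> 0).
have gl n : in_l2 (g n).
  by elim: n => [|n IH]; [exact: l2_0|apply: l2D => //; apply: hL.1].
have q1' : 0 < 1 - q by lra.
have nL h : in_l2 h -> nrm (L h) <= q * nrm h.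
  move=> sh; apply: nrm_le; first by rewrite mulr_ge0 ?nrm_ge0.
  by rewrite exprMn nrm_sqr// hq.
have step n : nrm (fun x => g n.+1 x - g n x) <= q ^+ n * nrm f.
  elim: n => [|n IH].
    rewrite expr0 mul1r /= (l2lin0 hL).
    by under [X in nrm X]eq_fun do rewrite addr0 subr0.
  rewrite (_ : (fun x => _) = L (fun x => g n.+1 x - g n x)).
    by apply: le_trans (nL _ (l2B (gl _) (gl _))) _; rewrite exprS -mulrA ler_wpM2l.
  by rewrite l2linB//; apply/funext => x /=; ring.
have tele n m : (n <= m)%N ->
  nrm (fun x => g m x - g n x) <= (q ^+ n - q ^+ m) / (1 - q) * nrm f.
  move=> /subnKC <-; elim: (m - n)%N => [|k IH].
    rewrite addn0 subrr mul0r mul0r /nrm (_ : (fun _ => _) = fun=> 0) ?n2_0 ?sqrtr0//.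
    by apply/funext => x; rewrite subrr.
  rewrite (_ : (fun _ => _) = fun x => (g (n + k.+1)%N x - g (n + k)%N x) + (g (n + k)%N x - g n x)).
    apply: le_trans (nrmD (l2B (gl _) (gl _)) (l2B (gl _) (gl _))) _.
    have -> : (q ^+ n - q ^+ (n + k.+1)) / (1 - q) * nrm f =
       q ^+ (n + k) * nrm f + (q ^+ n - q ^+ (n + k)) / (1 - q) * nrm f.
      by rewrite addnS exprS; field; rewrite gt_eqF.
    by apply: lerD => //; rewrite addnS; exact: step.
  by apply/funext => x; rewrite subrKA.
pose e n := q ^+ n / (1 - q) * nrm f.
have e0 n : 0 <= e n by rewrite !mulr_ge0 ?exprn_ge0 ?invr_ge0 ?nrm_ge0// ltW.
have ce : e @ \oo --> 0.
  have -> : e = geometric (nrm f / (1 - q)) q.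
    by apply/funext => n; rewrite /e /geometric /=; ring.
  by apply: cvg_geometric; rewrite ger0_norm.
have [|h [hl hh]] := l2_complete gl ce _ e0.
  move=> n m nm; rewrite -nrm_sqr; last exact: l2B.
  rewrite ler_pXn2r ?nnegrE ?nrm_ge0//; apply: le_trans (tele _ _ nm) _.
  rewrite /e ler_wpM2r ?nrm_ge0// ler_wpM2r ?invr_ge0 1?(ltW q1')//.
  by rewrite lerBlDr lerDl exprn_ge0.
exists h; split => //.
have sL := l2D sf (hL.1 _ hl).
suff : (fun x => h x - (f x + L h x)) = fun=> 0.
  by move=> /funeqP E; apply/funext => x; apply/eqP; rewrite -subr_eq0; apply/eqP; exact: E.
apply: n2_eq0; first exact: l2B.
(* The residual of h is split at g (n + 1) = f + L (g n): one part is the error of g (n + 1), the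
   other is L applied to the error of g n. *)
have bound n : n2 (fun x => h x - (f x + L h x)) <= 2 * e n.+1 ^+ 2 + 2 * e n ^+ 2.
  apply: le_trans (n2_sub hl (gl n.+1) sL) _; apply: lerD; rewrite ler_pM2l//.
  rewrite (_ : (fun _ => _) = L (fun x => g n x - h x)).
    apply: le_trans (hq _ (l2B (gl _) hl)) _.
    rewrite -n2N; under [X in n2 X]eq_fun do rewrite opprB.
    apply: le_trans _ (hh n); apply: ler_piMl; first by apply: n2_ge0; exact: l2B.
    by rewrite expr_le1// ltW.
  by rewrite l2linB//; apply/funext => x /=; ring.
have cb : (fun n => 2 * e n.+1 ^+ 2 + 2 * e n ^+ 2) @ \oo --> 0.
  rewrite [X in _ --> X](_ : 0 = 2 * (0 * 0) + 2 * (0 * 0)); last by ring.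
  have ce1 : (fun n => e n.+1) @ \oo --> 0 by rewrite (cvg_shiftS e).
  by apply: cvgD; apply: cvgM; try (exact: cvg_cst); apply: cvgM.
rewrite -(cvg_lim _ cb)//; apply: limr_ge; first by apply/cvg_ex; eexists; exact: cb.
by apply: nearW => n; exact: bound.
Qed.
End L2.

(** * The hopping operator *)

Section Hop.
Variables (R : realType) (d : nat).
Local Notation T := (Zd d).
Local Notation C := R[i].
Implicit Types (f g h : T -> C) (F G : {fset T}) (eh : T -> C).

Lemma cabs_ge0 (z : C) : 0 <= cabs z. Proof. exact: sqrtr_ge0. Qed.
Lemma cabsM (z w : C) : cabs (z * w) = cabs z * cabs w.
Proof. by rewrite /cabs cabs2M sqrtrM// cabs2_ge0. Qed.
Lemma ipr_cabs (z w : C) : `|ipr z w| <= cabs z * cabs w.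
Proof.
rewrite -(@ler_pXn2r _ 2)// ?nnegrE ?mulr_ge0 ?cabs_ge0//.
rewrite real_normK ?num_real// exprMn !cabs_sqr -subr_ge0.
have -> : cabs2 z * cabs2 w - ipr z w ^+ 2 =
   (complex.Re z * complex.Im w - complex.Im z * complex.Re w) ^+ 2.
  by rewrite /cabs2 /ipr; ring.
exact: sqr_ge0.
Qed.
Lemma Re_cabs (z : C) : `|complex.Re z| <= cabs z.
Proof.
rewrite -(@ler_pXn2r _ 2)// ?nnegrE ?cabs_ge0//.
by rewrite real_normK ?num_real// cabs_sqr /cabs2 lerDl sqr_ge0.
Qed.
Lemma Im_cabs (z : C) : `|complex.Im z| <= cabs z.
Proof.
rewrite -(@ler_pXn2r _ 2)// ?nnegrE ?cabs_ge0//.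
by rewrite real_normK ?num_real// cabs_sqr /cabs2 lerDr sqr_ge0.
Qed.
Lemma cabsD (z w : C) : cabs (z + w) <= cabs z + cabs w.
Proof.
rewrite -(@ler_pXn2r _ 2)// ?nnegrE ?addr_ge0 ?cabs_ge0//.
rewrite sqrrD !cabs_sqr cabs2D lerD2r lerD2l mulr_natl lerMn2r /=.
exact: le_trans (ler_norm _) (ipr_cabs _ _).
Qed.

Definition csumm f := summ (fun x => cabs (f x)).

Lemma in_l1P f : in_l1 f <-> csumm f.
Proof.
rewrite /csumm summP /in_l1; under [X in _ <-> (X < _)%E]eq_esum => x _ do
  rewrite (ger0_norm (cabs_ge0 _)); by [].
Qed.

Lemma csumm_Re f : csumm f -> summ (fun x => complex.Re (f x)).
Proof. by apply: summ_le => x; exact: Re_cabs. Qed.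
Lemma csumm_Im f : csumm f -> summ (fun x => complex.Im (f x)).
Proof. by apply: summ_le => x; exact: Im_cabs. Qed.

Lemma csum_lin a f g : csumm f -> csumm g ->
  csum (fun x => a * f x + g x) = a * csum f + csum g.
Proof.
move=> sf sg; have fR := csumm_Re sf; have fI := csumm_Im sf.
have gR := csumm_Re sg; have gI := csumm_Im sg.
case: a => u w; rewrite /csum.
rewrite [LHS](_ : _ = Complex
  (u * rsum (fun x => complex.Re (f x)) +
    (- w * rsum (fun x => complex.Im (f x)) + rsum (fun x => complex.Re (g x))))
  (u * rsum (fun x => complex.Im (f x)) +
    (w * rsum (fun x => complex.Re (f x)) + rsum (fun x => complex.Im (g x))))).
  by congr Complex => /=; ring.
rewrite -!rsum_lin //; try exact: summ_lin.
by congr Complex; congr rsum; apply/funext => x; case: (f x) => ? ?; case: (g x) => ? ? /=; ring.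
Qed.

Lemma ipr_csum f w : csumm f -> ipr (csum f) w = rsum (fun x => ipr (f x) w).
Proof.
move=> sf; have fR := csumm_Re sf; have fI := csumm_Im sf.
rewrite /ipr /csum /= mulrC [in X in _ + X]mulrC -!rsumZ// -rsumD; try exact: summZ.
by congr rsum; apply/funext => x; ring.
Qed.

(** [csum] is defined by components, so the triangle inequality is obtained by duality: the sum is
    paired with itself and one factor is cancelled. *)
Lemma cabs_csum f : csumm f -> cabs (csum f) <= rsum (fun x => cabs (f x)).
Proof.
move=> sf; have [->|n0] := eqVneq (cabs (csum f)) 0.
  by apply: rsum_ge0 => // x; exact: cabs_ge0.
rewrite -(@ler_pM2r _ (cabs (csum f))); last by rewrite lt_def n0 cabs_ge0.
rewrite -expr2 cabs_sqr -iprzz ipr_csum// mulrC -rsumZ//.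
apply: le_trans (ler_norm _) _; apply: norm_rsum_le; last exact: summZ.
by move=> x; rewrite mulrC ipr_cabs.
Qed.

Lemma csum_fin F f : (forall x, x \notin F -> f x = 0) -> csum f = \sum_(x <- F) f x.
Proof.
move=> h; rewrite /csum !(@rsum_fin _ _ F); try by move=> x /h ->.
by rewrite /psum; elim: (enum_fset F) => [|x r IH];
  rewrite ?big_nil// !big_cons -IH; case: (f x).
Qed.

Lemma addKx (y : T) : cancel (fun x : T => x + y) (fun x => x - y).
Proof. by move=> x; rewrite addrK. Qed.
Lemma subKx (y : T) : cancel (fun x : T => x - y) (fun x => x + y).
Proof. by move=> x; rewrite subrK. Qed.

Lemma l2_shift f y : in_l2 f -> in_l2 (fun x => f (x + y)).
Proof. by move=> /in_l2P h; apply/in_l2P; exact: (summ_reindex (@addKx y) (@subKx y) h). Qed.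

Lemma ip_shift f g y : in_l2 f -> in_l2 g ->
  ip (fun x => f (x + y)) g = ip f (fun x => g (x - y)).
Proof.
move=> sf sg; rewrite /ip -(rsum_reindex (@subKx y) (@addKx y)).
  by congr rsum; apply/funext => x; rewrite subrK.
by apply: summ_ip => //; exact: l2_shift.
Qed.

Lemma n2_shift f y : in_l2 f -> n2 (fun x => f (x + y)) = n2 f.
Proof.
move=> sf; rewrite /n2 ip_shift//; last exact: l2_shift.
by congr rsum; apply/funext => x; rewrite subrK.
Qed.

Definition l1n eh := rsum (fun x => cabs (eh x)).

Lemma l1n_ge0 eh : csumm eh -> 0 <= l1n eh.
Proof. by move=> se; apply: rsum_ge0 => // x; exact: cabs_ge0. Qed.

Lemma csumm_bmul eh f M : csumm eh -> (forall x, cabs (f x) <= M) ->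
  csumm (fun y => eh y * f y).
Proof.
move=> se h; apply: summ_le (summZ M se) => x.
by rewrite ger0_norm ?cabs_ge0// cabsM mulrC ler_wpM2r ?cabs_ge0.
Qed.

Lemma csumm_h0 eh f x : csumm eh -> in_l2 f -> csumm (fun y => eh y * f (x + y)).
Proof.
move=> se sf; apply: (@csumm_bmul _ _ (nrm f)) => // y.
by apply: ler_wsqrtr; exact: cabs2_le_n2.
Qed.

(** Schur test: |eh| is written as the product of two square roots, and Cauchy-Schwarz sums one of
    them to [l1n eh]. *)
Lemma h0_pt eh f x : csumm eh -> in_l2 f ->
  cabs2 (h0 eh f x) <= l1n eh * rsum (fun y => cabs (eh y) * cabs2 (f (x + y))).
Proof.
move=> se sf.
have s1 := csumm_h0 x se sf.
rewrite -cabs_sqr.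
have := cabs_csum s1; rewrite -/(h0 eh f x) => hA.
pose p (y : T) := creal (Num.sqrt (cabs (eh y))).
pose q (y : T) := creal (Num.sqrt (cabs (eh y)) * cabs (f (x + y))).
have c0 y := cabs_ge0 (eh y).
have ep y : cabs2 (p y) = cabs (eh y) by rewrite cabs2_creal sqr_sqrtr.
have eq y : cabs2 (q y) = cabs (eh y) * cabs2 (f (x + y)).
  by rewrite cabs2_creal exprMn sqr_sqrtr// cabs_sqr.
have lp : in_l2 p by apply/in_l2P; under eq_fun do rewrite ep.
have s2 : summ (fun y => cabs (eh y) * cabs2 (f (x + y))).
  apply: summ_le (summZ (n2 f) se) => y.
  rewrite ger0_norm ?mulr_ge0 ?cabs2_ge0// mulrC ler_wpM2r//; exact: cabs2_le_n2.
have lq : in_l2 q by apply/in_l2P; under eq_fun do rewrite eq.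
have := CS lp lq; rewrite !n2E; under eq_fun do rewrite ep.
under [in X in _ * X]eq_fun do rewrite eq.
apply: le_trans; rewrite ler_pXn2r ?nnegrE ?cabs_ge0//.
  apply: le_trans hA _; rewrite le_eqVlt; apply/orP; left; apply/eqP.
  congr rsum; apply/funext => y; rewrite cabsM /ipr /= mul0r addr0 mulrA -expr2.
  by rewrite sqr_sqrtr.
apply: rsum_ge0; last exact: summ_ip.
by move=> y; rewrite /ipr /= mul0r addr0 !mulr_ge0 ?sqrtr_ge0 ?cabs_ge0.
Qed.

Lemma h0_bounded eh f : csumm eh -> in_l2 f ->
  in_l2 (h0 eh f) /\ n2 (h0 eh f) <= l1n eh ^+ 2 * n2 f.
Proof.
move=> se sf.
have A0 := l1n_ge0 se.
have s2 x : summ (fun y => cabs (eh y) * cabs2 (f (x + y))).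
  apply: summ_le (summZ (n2 f) se) => y.
  rewrite ger0_norm ?mulr_ge0 ?cabs2_ge0 ?cabs_ge0// mulrC ler_wpM2r ?cabs_ge0//.
  exact: cabs2_le_n2.
have key F : psum (fun x => cabs2 (h0 eh f x)) F <= l1n eh ^+ 2 * n2 f.
  apply: (@le_trans _ _ (psum (fun x => l1n eh *
     rsum (fun y => cabs (eh y) * cabs2 (f (x + y)))) F)).
    by apply: ler_psum => x; exact: h0_pt.
  (* The finite sum over [F] moves inside [rsum]; for fixed y it is a partial sum over a translate
     of f, hence at most [n2 f]. *)
  rewrite psumZ expr2 -mulrA ler_wpM2l// /psum -rsum_psum//.
  rewrite mulrC /l1n -rsumZ//; apply: ler_rsum; [|exact: summ_psum|exact: summZ].
  move=> y; rewrite -big_distrr /= mulrC ler_wpM2r ?cabs_ge0//.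
  rewrite -(n2_shift y sf) n2E; apply: psum_le_rsum; first by move=> ?; exact: cabs2_ge0.
  by apply/in_l2P; exact: l2_shift.
have [h1 h2] := rsum_le (fun x => cabs2_ge0 _) key.
by rewrite n2E; split => //; exact/in_l2P.
Qed.

Lemma h0_lin eh : csumm eh -> l2lin (h0 eh).
Proof.
move=> se; split=> [f /(h0_bounded se)[]//|a f g sf sg].
apply/funext => x; rewrite /h0 -csum_lin; try exact: csumm_h0.
by congr csum; apply/funext => y; ring.
Qed.

Definition h0T (S : {fset T}) eh f x := \sum_(y <- S) eh y * f (x + y).
Definition trunc (S : {fset T}) eh y := if y \in S then eh y else 0.
Definition offs (S : {fset T}) eh y := if y \in S then 0 else eh y.

Lemma h0T_trunc S eh f : h0 (trunc S eh) f = h0T S eh f.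
Proof.
apply/funext => x; rewrite /h0 (@csum_fin S); last first.
  by move=> y /negbTE h; rewrite /trunc h mul0r.
by apply: eq_big_seq => y yS; rewrite /trunc yS.
Qed.

Lemma csumm_offs S eh : csumm eh -> csumm (offs S eh).
Proof.
apply: summ_le => y; rewrite ger0_norm ?cabs_ge0// /offs; case: ifP => // _.
by rewrite /cabs cabs2_0 sqrtr0 cabs_ge0.
Qed.
Lemma csumm_trunc S eh : csumm eh -> csumm (trunc S eh).
Proof.
apply: summ_le => y; rewrite ger0_norm ?cabs_ge0// /trunc; case: ifP => // _.
by rewrite /cabs cabs2_0 sqrtr0 cabs_ge0.
Qed.

Lemma h0T_l2 S eh f : csumm eh -> in_l2 f -> in_l2 (h0T S eh f).
Proof. by move=> se sf; rewrite -h0T_trunc; case: (h0_bounded (csumm_trunc S se) sf). Qed.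

Lemma h0_offs S eh f : csumm eh -> in_l2 f ->
  (fun x => h0 eh f x - h0T S eh f x) = h0 (offs S eh) f.
Proof.
move=> se sf; rewrite -h0T_trunc; apply/funext => x; rewrite /h0.
have -> : (fun y => eh y * f (x + y)) =
   fun y => 1 * (trunc S eh y * f (x + y)) + offs S eh y * f (x + y).
  by apply/funext => y; rewrite /trunc /offs; case: ifP => _; ring.
rewrite csum_lin; [ring|apply: csumm_h0 => //; exact: csumm_trunc|].
apply: csumm_h0 => //; exact: csumm_offs.
Qed.

Lemma l1n_offs eh e : csumm eh -> 0 < e -> exists S : {fset T},
  forall S', (S `<=` S')%fset -> l1n (offs S' eh) < e.
Proof.
move=> se e0; have [S hS] := rsum_tail se e0; exists S => S' /hS.
rewrite /l1n; congr (rsum _ < _); apply/funext => x; rewrite /offs.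
by case: ifP; rewrite ?(ger0_norm (cabs_ge0 _))// /cabs cabs2_0 sqrtr0.
Qed.

Lemma h0T_approx eh e : csumm eh -> 0 < e -> exists S : {fset T},
  forall S', (S `<=` S')%fset -> forall f g, in_l2 f -> in_l2 g ->
   `|ip (h0 eh f) g - ip (h0T S' eh f) g| <= e * (nrm f * nrm g).
Proof.
move=> se e0; have [S hS] := l1n_offs se e0; exists S => S' /hS h f g sf sg.
have so := csumm_offs S' se.
have [bo1 bo2] := h0_bounded so sf.
rewrite -ipBl//; [|by case: (h0_bounded se sf)|exact: h0T_l2].
rewrite h0_offs//; apply: le_trans (ip_le bo1 sg) _.
rewrite mulrA ler_wpM2r ?nrm_ge0//; apply: nrm_le.
  by rewrite mulr_ge0 ?nrm_ge0// ltW.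
apply: (le_trans bo2); rewrite exprMn nrm_sqr// ler_wpM2r ?n2_ge0//.
by rewrite ler_pXn2r ?nnegrE ?l1n_ge0// ltW.
Qed.

Lemma l2_sum (I : Type) (r : seq I) (f : I -> T -> C) : (forall i, in_l2 (f i)) ->
  in_l2 (fun x => \sum_(i <- r) f i x).
Proof.
move=> h; elim: r => [|i r IH].
  rewrite (_ : (fun _ => _) = fun=> 0); first exact: l2_0.
  by apply/funext => x; rewrite big_nil.
rewrite (_ : (fun _ => _) = fun x => f i x + \sum_(j <- r) f j x); first exact: l2D.
by apply/funext => x; rewrite big_cons.
Qed.

Lemma ip_suml (I : Type) (r : seq I) (f : I -> T -> C) g : (forall i, in_l2 (f i)) ->
  in_l2 g -> ip (fun x => \sum_(i <- r) f i x) g = \sum_(i <- r) ip (f i) g.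
Proof.
move=> h sg; elim: r => [|i r IH].
  rewrite big_nil (_ : (fun x => _) = fun=> 0) ?ip0l//.
  by apply/funext => x; rewrite big_nil.
rewrite big_cons -IH (_ : (fun x => _) = fun x => f i x + \sum_(j <- r) f j x).
  by rewrite (ipDl (h i) (l2_sum r h) sg).
by apply/funext => x; rewrite big_cons.
Qed.

Lemma ip_sumr (I : Type) (r : seq I) (f : I -> T -> C) g : (forall i, in_l2 (f i)) ->
  in_l2 g -> ip g (fun x => \sum_(i <- r) f i x) = \sum_(i <- r) ip g (f i).
Proof. by move=> h sg; rewrite ipC ip_suml//; apply: eq_bigr => i _; exact: ipC. Qed.

Lemma h0T_sym S eh f g : (forall x, cconj (eh (- x)) = eh x) ->
  in_l2 f -> in_l2 g ->
  ip (h0T S eh f) g = ip f (h0T [fset - y | y in S]%fset eh g).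
Proof.
move=> sym sf sg.
have s1 y : in_l2 (fun x => eh y * f (x + y)) by apply: l2Z; exact: l2_shift.
have s2 y : in_l2 (fun x => eh y * g (x + y)) by apply: l2Z; exact: l2_shift.
rewrite /h0T ip_suml// ip_sumr// big_imfset /=; last by move=> x y _ _; exact: oppr_inj.
apply: eq_bigr => y _; rewrite ipMl ip_shift//; last exact: l2Z.
by congr ip; apply/funext => x; rewrite -(sym y) /cconj /=; case: (eh _) => a b /=; rewrite opprK.
Qed.

(** Symmetry is an identity for finite hopping range and passes to the limit in operator norm, so
    two infinite sums never have to be exchanged. *)
Lemma h0_sym eh f g : (forall x, cconj (eh (- x)) = eh x) -> csumm eh ->
  in_l2 f -> in_l2 g -> ip (h0 eh f) g = ip f (h0 eh g).
Proof.
move=> sym se sf sg; apply/eqP; rewrite -subr_eq0 -normr_le0.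
apply/ler_addgt0Pl => e e0; rewrite addr0.
have N0 : 0 <= nrm f * nrm g by rewrite mulr_ge0 ?nrm_ge0.
have e1 : 0 < e / (2 * (nrm f * nrm g + 1)) by rewrite divr_gt0// mulr_gt0// ltr_wpDl.
have [S hS] := h0T_approx se e1.
(* Adding the reflected set makes the truncation invariant under y -> -y, so the truncated operator
   is itself symmetric. *)
pose S' := (S `|` [fset - y | y in S])%fset.
have SS' : (S `<=` S')%fset by exact: fsubsetUl.
have h1 := hS S' SS' f g sf sg; have h2 := hS S' SS' g f sg sf.
have eS : [fset - y | y in S']%fset = S'.
  apply/fsetP => x; apply/imfsetP/idP.
    move=> [y /= ]; rewrite in_fsetU => /orP[yS ->|/imfsetP[z /= zS ->] ->].
      by rewrite in_fsetU; apply/orP; right; apply/imfsetP; exists y.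
    by rewrite opprK in_fsetU zS.
  rewrite in_fsetU => /orP[xS|/imfsetP[z /= zS ->]].
    exists (- x); rewrite ?opprK//= in_fsetU; apply/orP; right.
    by apply/imfsetP; exists x.
  by exists z => //=; rewrite in_fsetU zS.
have h3 := @h0T_sym S' eh f g sym sf sg; rewrite eS in h3.
rewrite (ipC _ f) (ipC _ f) -h3 in h2; rewrite distrC in h2.
rewrite [ip (h0 eh f) g - _](_ : _ = (ip (h0 eh f) g - ip (h0T S' eh f) g) +
   (ip (h0T S' eh f) g - ip f (h0 eh g))); last by ring.
apply: le_trans (ler_normD _ _) _; rewrite (mulrC (nrm g)) in h2.
apply: le_trans (lerD h1 h2) _.
set N := nrm f * nrm g in N0 *.
have -> : e / (2 * (N + 1)) * N + e / (2 * (N + 1)) * N = e * (N / (N + 1)).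
  by field; lra.
by rewrite ler_piMr ?(ltW e0)// ler_pdivrMr; lra.
Qed.

Section Hmu.
Variables (eh : T -> C) (v : T -> R).
Hypotheses (se : csumm eh) (sv : summ v) (sym : forall x, cconj (eh (- x)) = eh x).

Lemma vbound : exists2 M, 0 <= M & forall x, `|v x| <= M.
Proof.
have sa := summ_abs sv; have h x := @psum_le_rsum _ _ _ [fset x]%fset (fun x => normr_ge0 (v x)) sa.
exists (rsum (fun x => `|v x|)); first by apply: rsum_ge0.
by move=> x; apply: le_trans (h x); rewrite /psum big_seq_fset1.
Qed.

Lemma vmul_l2 mu f : in_l2 f -> in_l2 (fun x => creal (mu * v x) * f x).
Proof.
have [M M0 hM] := vbound.
move=> sf; apply: (l2_bmul (M := (mu * M) ^+ 2) _ sf).1 => x.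
rewrite cabs2_creal !exprMn ler_wpM2l ?sqr_ge0//.
by rewrite -[v x ^+ 2]real_normK ?num_real// ler_pXn2r ?nnegrE.
Qed.

Lemma hmu_lin mu : l2lin (hmu eh v mu).
Proof.
split=> [f sf|a f g sf sg].
  by apply: l2D; [exact: (h0_lin se).1|exact: vmul_l2].
apply/funext => x; rewrite /hmu ((h0_lin se).2 a _ _ sf sg); ring.
Qed.

Lemma hmu_bounded mu : exists2 K, 0 <= K & forall f, in_l2 f -> n2 (hmu eh v mu f) <= K * n2 f.
Proof.
have [M M0 hM] := vbound.
exists (2 * l1n eh ^+ 2 + 2 * (mu * M) ^+ 2).
  by rewrite addr_ge0// mulr_ge0// sqr_ge0.
move=> f sf; have [h1 h2] := h0_bounded se sf.
have hv : n2 (fun x => creal (mu * v x) * f x) <= (mu * M) ^+ 2 * n2 f.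
  apply: (l2_bmul _ sf).2 => x.
  rewrite cabs2_creal !exprMn ler_wpM2l ?sqr_ge0//.
  by rewrite -[v x ^+ 2]real_normK ?num_real// ler_pXn2r ?nnegrE.
have := n2D_le h1 (vmul_l2 mu sf); rewrite -/(hmu eh v mu f); lra.
Qed.

Lemma vmul_sym mu f g : ip (fun x => creal (mu * v x) * f x) g =
  ip f (fun x => creal (mu * v x) * g x).
Proof. by congr rsum; apply/funext => x; rewrite iprMl iprC /ipr /cconj /creal; case: (f x) (g x) => ? ? [? ?] /=; ring. Qed.

Lemma hmu_sym mu f g : in_l2 f -> in_l2 g ->
  ip (hmu eh v mu f) g = ip f (hmu eh v mu g).
Proof.
move=> sf sg; have [h1 _] := h0_bounded se sf; have [h2 _] := h0_bounded se sg.
rewrite /hmu ipDl//; last exact: vmul_l2.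
by rewrite ipDr//; [rewrite h0_sym// vmul_sym|exact: vmul_l2].
Qed.

Lemma summ_vf mu f : in_l2 f -> summ (fun x => mu * (v x * cabs2 (f x))).
Proof.
move=> sf; have [M M0 hM] := vbound; apply: summZ.
apply: summ_le (summZ M ((in_l2P f).1 sf)) => x.
by rewrite normrM (ger0_norm (cabs2_ge0 _)) ler_wpM2r ?cabs2_ge0.
Qed.

Lemma hmu_form mu f : in_l2 f ->
  ip (hmu eh v mu f) f = ip (h0 eh f) f + mu * rsum (fun x => v x * cabs2 (f x)).
Proof.
move=> sf; have [h1 _] := h0_bounded se sf.
rewrite /hmu ipDl//; last exact: vmul_l2.
have := summ_vf 1 sf; under eq_fun do rewrite mul1r; move=> s.
rewrite -rsumZ//; congr (_ + rsum _); apply/funext => x; rewrite iprZl iprzz; ring.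
Qed.
End Hmu.
End Hop.

(** * Finite-rank perturbations of semibounded operators *)

Section Spectral.
Variables (R : realType) (d : nat).
Local Notation T := (Zd d).
Local Notation C := R[i].
Implicit Types (f g h : T -> C) (F G : {fset T}) (H B : (T -> C) -> (T -> C)).

Lemma ip_creal (r : R) f : in_l2 f -> ip (fun x => creal r * f x) f = r * n2 f.
Proof. by move=> sf; rewrite ipZl. Qed.

Lemma ip_cscal (z : C) f : in_l2 f -> ip (fun x => z * f x) f = complex.Re z * n2 f.
Proof.
move=> sf; rewrite n2E /ip -rsumZ; last exact/in_l2P.
by congr rsum; apply/funext => x; rewrite /ipr /cabs2; case: z (f x) => ? ? [? ?] /=; ring.
Qed.

Lemma nrm_sum (I : Type) (r : seq I) (f : I -> T -> C) : (forall i, in_l2 (f i)) ->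
  nrm (fun x => \sum_(i <- r) f i x) <= \sum_(i <- r) nrm (f i).
Proof.
move=> h; elim: r => [|i r IH].
  rewrite big_nil /nrm (_ : (fun x => _) = fun=> 0) ?n2_0 ?sqrtr0//.
  by apply/funext => x; rewrite big_nil.
rewrite big_cons (_ : (fun x => _) = fun x => f i x + \sum_(j <- r) f j x).
  by apply: le_trans (nrmD (h i) (l2_sum r h)) _; rewrite lerD2l.
by apply/funext => x; rewrite big_cons.
Qed.

Lemma nrmM a f : in_l2 f -> nrm (fun x => a * f x) = cabs a * nrm f.
Proof. by move=> sf; rewrite /nrm n2M// sqrtrM ?cabs2_ge0. Qed.

Lemma cabs_sum (I : Type) (r : seq I) (z : I -> C) :
  cabs (\sum_(i <- r) z i) <= \sum_(i <- r) cabs (z i).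
Proof.
elim: r => [|i r IH]; first by rewrite !big_nil /cabs cabs2_0 sqrtr0.
by rewrite !big_cons; apply: le_trans (cabsD _ _) _; rewrite lerD2l.
Qed.

Definition formle H b := forall f, in_l2 f -> ip (H f) f <= b * n2 f.
Definition bnd H := exists2 K, 0 <= K & forall f, in_l2 f -> n2 (H f) <= K * n2 f.

(** The real part of <(B - z) f, f> is at most -(Re z - b) |f|^2; Cauchy-Schwarz turns this into a
    lower bound for |(B - z) f|. *)
Lemma coercive_le B b (z : C) f : l2lin B -> formle B b -> b < complex.Re z -> in_l2 f ->
  (complex.Re z - b) ^+ 2 * n2 f <= n2 (fun x => B f x - z * f x).
Proof.
move=> hB hb bz sf; set k := _ - b; have k0 : 0 < k by rewrite subr_gt0.
have sB := hB.1 _ sf; have sz := l2Z z sf; have sP := l2B sB sz.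
have h : k * n2 f <= nrm (fun x => B f x - z * f x) * nrm f.
  apply: le_trans (ip_le sP sf); rewrite ipBl// ip_cscal// ler0_norm; last first.
    have := hb _ sf; have : 0 <= (complex.Re z - b) * n2 f by rewrite mulr_ge0 ?n2_ge0 ?ltW.
    lra.
  by have := hb _ sf; rewrite /k; lra.
have h2 : k * nrm f <= nrm (fun x => B f x - z * f x).
  have := nrm_ge0 f; rewrite le_eqVlt => /orP[/eqP <-|n0]; first by rewrite mulr0 nrm_ge0.
  by rewrite -(ler_pM2r n0) -mulrA -expr2 nrm_sqr.
rewrite -(nrm_sqr sf) -(nrm_sqr sP) -exprMn ler_pXn2r ?nnegrE ?nrm_ge0//.
by rewrite mulr_ge0 ?nrm_ge0// ltW.
Qed.

(** A damped fixed-point iteration in the style of Lax-Milgram: g -> g + t ((B - z) g - f) contracts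
    for small t > 0, since the form of B - z is strictly negative. *)
Lemma coercive_solve B b (z : C) f : l2lin B -> bnd B -> formle B b ->
  b < complex.Re z -> in_l2 f ->
  exists g, in_l2 g /\ (fun x => B g x - z * g x) = f.
Proof.
move=> hB [K K0 hK] hb bz sf; pose k := complex.Re z - b.
have k0 : 0 < k by rewrite subr_gt0.
(* The first two terms bound the square of the norm of B - z; the others make K' positive and at
   least k^2. *)
pose K' := 2 * K + 2 * cabs2 z + k ^+ 2 + 1.
have c0 := cabs2_ge0 z; have k20 := sqr_ge0 k.
have K'0 : 0 < K' by rewrite /K'; lra.
have kK : k ^+ 2 / K' <= 1 by rewrite ler_pdivrMr// mul1r /K'; lra.
have kK0 : 0 < k ^+ 2 / K' by rewrite divr_gt0// exprn_gt0.
(* The minimizer of 1 - 2 t k + t^2 K', the bound for the squared contraction factor; the minimum is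
   1 - k^2 / K'. *)
pose t := k / K'; have t0 : 0 < t by rewrite divr_gt0.
pose P g x := B g x - z * g x.
have sP g : in_l2 g -> in_l2 (P g) by move=> sg; apply: l2B; [exact: hB.1|exact: l2Z].
pose L g x := g x + creal t * P g x.
have lL : l2lin L.
  split=> [g sg|a g h sg sh]; first by apply: l2D => //; apply: l2Z; exact: sP.
  by apply/funext => x; rewrite /L /P hB.2//; ring.
have qq : (Num.sqrt (1 - k ^+ 2 / K')) ^+ 2 = 1 - k ^+ 2 / K' by rewrite sqr_sqrtr// subr_ge0.
have q01 : 0 <= Num.sqrt (1 - k ^+ 2 / K') < 1.
  rewrite sqrtr_ge0 /= -(@ltr_pXn2r _ 2)// ?nnegrE ?sqrtr_ge0// qq expr1n; lra.
have Lb g : in_l2 g -> n2 (L g) <= (Num.sqrt (1 - k ^+ 2 / K')) ^+ 2 * n2 g.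
  move=> sg; rewrite qq /L n2D//; last by apply: l2Z; exact: sP.
  rewrite ipZr//; last exact: sP.
  rewrite n2M ?cabs2_creal; last exact: sP.
  have i1 : ip g (P g) <= - k * n2 g.
    rewrite ipC /P ipBl//; [|exact: hB.1|exact: l2Z].
    by rewrite ip_cscal//; have := hb _ sg; rewrite /k; lra.
  have i2 : n2 (P g) <= K' * n2 g.
    rewrite /P; have := n2D_le (hB.1 _ sg) (l2N (l2Z z sg)).
    rewrite n2N n2M//; have := hK _ sg.
    have : 0 <= (k ^+ 2 + 1) * n2 g by rewrite mulr_ge0 ?n2_ge0//; lra.
    rewrite /K'; lra.
  have i3 : t * ip g (P g) <= t * (- k * n2 g) by rewrite ler_pM2l.
  have i4 : t ^+ 2 * n2 (P g) <= t ^+ 2 * (K' * n2 g) by rewrite ler_wpM2l// sqr_ge0.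
  have e3 : t * (- k * n2 g) = - (k ^+ 2 / K') * n2 g by rewrite /t; ring.
  have e4 : t ^+ 2 * (K' * n2 g) = k ^+ 2 / K' * n2 g.
    by rewrite /t; field; rewrite gt_eqF.
  rewrite e3 in i3; rewrite e4 in i4; lra.
have [g [sg eg]] := neumann lL q01 Lb (l2Z (- creal t) sf).
exists g; split => //; apply/funext => x.
move/(congr1 (fun u => u x)): eg; rewrite /L -/(P g x) => eg.
have : creal t * (P g x - f x) = 0.
  by apply: (@addrI _ (g x)); rewrite addr0 [RHS]eg; ring.
move/eqP; rewrite mulf_eq0 => /orP[/eqP[] t1|]; first by move: t0; rewrite t1 ltxx.
by rewrite subr_eq0 => /eqP.
Qed.

Definition delta (a : T) : T -> C := fun x => (x == a)%:R.
Lemma delta_l2 a : in_l2 (delta a).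
Proof. by apply: (@l2_fin _ _ [fset a]%fset) => x; rewrite inE /delta => /negbTE ->. Qed.

(** * Birman-Schwinger reduction for a finitely supported multiplication operator *)

Section Fredholm.
Variables (H : (T -> C) -> (T -> C)) (k : T -> C) (F : {fset T}) (b : R) (z : C).
Hypotheses (hH : l2lin H) (Hb : bnd H) (kF : forall x, x \notin F -> k x = 0).
Hypothesis hB : formle (fun f x => H f x - k x * f x) b.
Hypothesis bz : b < complex.Re z.

Let B f x := H f x - k x * f x.

Lemma kmul_l2 f : in_l2 (fun x => k x * f x).
Proof. by apply: (@l2_fin _ _ F) => x /kF ->; rewrite mul0r. Qed.

Lemma kbound : exists2 M, 0 <= M & forall x, cabs2 (k x) <= M.
Proof.
exists (psum (fun x => cabs2 (k x)) F); first by apply: psum_ge0 => x; exact: cabs2_ge0.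
move=> x; have [xF|/kF ->] := boolP (x \in F); last first.
  by rewrite cabs2_0 psum_ge0// => ?; exact: cabs2_ge0.
rewrite /psum (big_fsetD1 x)//= lerDl; apply: sumr_ge0 => ? _; exact: cabs2_ge0.
Qed.

Lemma B_lin : l2lin B.
Proof.
split=> [f sf|a f g sf sg].
  by apply: l2B; [exact: hH.1|exact: kmul_l2].
by apply/funext => x; rewrite /B hH.2//; ring.
Qed.

Lemma B_bnd : bnd B.
Proof.
have [K K0 hK] := Hb; have [M M0 hM] := kbound.
exists (2 * K + 2 * M); first lra.
move=> f sf; have := n2D_le (hH.1 _ sf) (l2N (kmul_l2 f)); rewrite n2N.
have := (l2_bmul hM sf).2; have := hK _ sf; rewrite /B; lra.
Qed.

Lemma resolvent_exists : exists G : (T -> C) -> (T -> C), forall f, in_l2 f ->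
  in_l2 (G f) /\ (fun x => B (G f) x - z * G f x) = f.
Proof.
suff /choice [G hG] : forall f, exists g, in_l2 f -> in_l2 g /\ (fun x => B g x - z * g x) = f.
  by exists G.
move=> f; have [sf|] := pselect (in_l2 f); last by exists f.
by have [g hg] := coercive_solve B_lin B_bnd hB bz sf; exists g.
Qed.

Section Resolvent.
Variable G : (T -> C) -> (T -> C).
Hypothesis hG : forall f, in_l2 f ->
  in_l2 (G f) /\ (fun x => B (G f) x - z * G f x) = f.

Let n := size (enum_fset F).
Let pt (i : 'I_n) : T := nth 0 (enum_fset F) i.
(** The Green functions of [B] at energy z with sources at the sites of [F]. *)
Let gam (i : 'I_n) := G (delta (pt i)).

Lemma ptF i : pt i \in F. Proof. exact: mem_nth. Qed.
Lemma ptP x : x \in F -> exists i, x = pt i.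
Proof.
move=> xF; have xi : (index x (enum_fset F) < n)%N by rewrite index_mem.
by exists (Ordinal xi); rewrite /pt nth_index.
Qed.
Lemma pt_eq i j : (pt i == pt j) = (i == j).
Proof. by rewrite /pt nth_uniq// ?fset_uniq. Qed.

Lemma gam_l2 i : in_l2 (gam i). Proof. by case: (hG (delta_l2 (pt i))). Qed.

Lemma sol_uniq f g : in_l2 f -> in_l2 g ->
  (fun x => B f x - z * f x) = (fun x => B g x - z * g x) -> f = g.
Proof.
move=> sf sg e; have sd := l2B sf sg.
suff E : (fun x => f x - g x) = fun=> 0.
  apply/funext => x; apply/eqP; rewrite -subr_eq0; apply/eqP.
  exact: (congr1 (fun u => u x) E).
apply: n2_eq0 => //.
have := coercive_le B_lin hB bz sd.
rewrite [X in _ <= n2 X](_ : _ = fun=> 0).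
  by rewrite n2_0 pmulr_rle0// exprn_gt0// subr_gt0.
apply/funext => x; rewrite l2linB//; last exact: B_lin.
have := congr1 (fun u => u x) e => /= /eqP; rewrite -subr_eq0 => /eqP <-; ring.
Qed.

(** [G] comes from a choice of preimages and is not known to be linear; combinations of Green
    functions are therefore handled through [B - z], which is. *)
Lemma B_comb (c : 'I_n -> C) :
  (fun x => B (fun y => \sum_i c i * gam i y) x - z * (\sum_i c i * gam i x)) =
  (fun x => \sum_i c i * delta (pt i) x).
Proof.
have hl := B_lin.
suff h (r : seq 'I_n) : (fun x => B (fun y => \sum_(i <- r) c i * gam i y) x
   - z * (\sum_(i <- r) c i * gam i x)) =
  (fun x => \sum_(i <- r) c i * delta (pt i) x) by exact: h.
elim: r => [|i r IH].
  under eq_fun do under [X in B X]eq_fun do rewrite big_nil.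
  rewrite (l2lin0 hl); apply/funext => x; rewrite !big_nil; ring.
apply/funext => x.
under [X in B X]eq_fun do rewrite big_cons.
rewrite hl.2; [|exact: gam_l2|by apply: l2_sum => j; apply: l2Z; exact: gam_l2].
have [_ E] := hG (delta_l2 (pt i)).
have e1 : delta (pt i) x = B (gam i) x - z * gam i x by rewrite -(congr1 (fun u => u x) E).
have e2 := congr1 (fun u => u x) IH; rewrite /= in e2.
rewrite !big_cons -e2 e1; ring.
Qed.

Lemma kdelta f x : \sum_i (f (pt i) * k (pt i)) * delta (pt i) x = k x * f x.
Proof.
have [xF|xF] := boolP (x \in F); last first.
  rewrite kF// mul0r big1// => i _; rewrite /delta.
  by case: eqP => [e|_]; [rewrite e ptF in xF|rewrite mulr0].
have [j ->] := ptP xF; rewrite (bigD1 j)//= big1 ?addr0.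
  by rewrite /delta eqxx mulr1 mulrC.
by move=> i ij; rewrite /delta pt_eq eq_sym (negbTE ij) mulr0.
Qed.

(** The eigenvalue equation reads (B - z) h = - k h, whose right-hand side is a combination of
    deltas on [F]. In particular h is determined by its values on [F], which bounds the
    multiplicity. *)
Lemma eigen_repr h : in_l2 h -> H h = (fun x => z * h x) ->
  h = fun x => \sum_i (- (h (pt i) * k (pt i))) * gam i x.
Proof.
move=> sh Hh; apply: sol_uniq => //.
  by apply: l2_sum => i; apply: l2Z; exact: gam_l2.
rewrite B_comb; apply/funext => x; rewrite /B Hh.
under eq_bigr do rewrite mulNr; rewrite sumrN kdelta; ring.
Qed.

(* The Birman-Schwinger matrix of [k]: [z] is an eigenvalue of [H] iff it is singular. *)
Let Mx : 'M[C]_n := \matrix_(i, j) ((i == j)%:R + k (pt i) * gam i (pt j)).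

Lemma row_Mx (c : 'rV[C]_n) j :
  (c *m Mx) 0 j = c 0 j + \sum_i c 0 i * k (pt i) * gam i (pt j).
Proof.
rewrite !mxE; under eq_bigr do rewrite mxE mulrDr mulrA.
rewrite big_split /= (bigD1 j)//= eqxx mulr1 big1 ?addr0// => i ij.
by rewrite (negbTE ij) mulr0.
Qed.

Lemma eigen_of_singular : Mx \notin unitmx ->
  exists f, [/\ in_l2 f, H f = (fun x => z * f x) & f <> fun=> 0].
Proof.
rewrite unitmxE unitfE negbK => /eqP /eqP /det0P [c c0 cM].
pose f x := \sum_i (- (c 0 i * k (pt i))) * gam i x.
have sf : in_l2 f by apply: l2_sum => i; apply: l2Z; exact: gam_l2.
(* The kernel equation says that f takes the values c on [F], so the source in the definition of f
   is - k f itself. *)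
have fp j : f (pt j) = c 0 j.
  have := congr1 (fun u : 'rV_n => u 0 j) cM; rewrite row_Mx mxE => /eqP.
  rewrite addr_eq0 => /eqP ->; rewrite /f -sumrN.
  by apply: eq_bigr => i _; rewrite mulNr.
exists f; split => //.
  have := B_comb (fun i => - (c 0 i * k (pt i))); rewrite -/f => E.
  apply/funext => x; have := congr1 (fun u => u x) E; rewrite /B /= -/(f x).
  under eq_bigr do rewrite -fp mulNr; rewrite sumrN kdelta => /eqP.
  rewrite -addr_eq0 => /eqP e; apply/eqP; rewrite -subr_eq0 -e; apply/eqP; ring.
move=> f0; case/negP: c0; apply/eqP/rowP => j; rewrite mxE -fp.
exact: (congr1 (fun u => u (pt j)) f0).
Qed.

(** Krein-type formula: the resolvent of [H] is [G] corrected by finitely many Green functions. It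
    is built as a right inverse, and injectivity of H - z makes it a left inverse as well. *)
Lemma nospec_of_unit : Mx \in unitmx -> ~ spectrum H z.
Proof.
move=> Mu; apply.
pose r f : 'rV[C]_n := \row_j G f (pt j).
(* [c f] has to be the vector of values of S f on [F]; evaluating S f there gives the linear system
   c Mx = r. *)
pose c f := r f *m invmx Mx.
pose S f x := G f x - \sum_i (c f 0 i * k (pt i)) * gam i x.
have sg := gam_l2.
have sS2 f : in_l2 (fun x => \sum_i (c f 0 i * k (pt i)) * gam i x).
  by apply: l2_sum => i; apply: l2Z.
have sS f : in_l2 f -> in_l2 (S f).
  by move=> sf; apply: l2B => //; case: (hG sf).
have Sp f j : S f (pt j) = c f 0 j.
  rewrite /S; have : (c f *m Mx) 0 j = r f 0 j by rewrite mulmxKV.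
  by rewrite row_Mx [in X in _ = X]mxE => <-; rewrite addrK.
have right f : in_l2 f -> (fun x => H (S f) x - z * S f x) = f.
  move=> sf; have [sG eG] := hG sf.
  have : (fun x => B (S f) x - z * S f x) = fun x => f x - k x * S f x.
    apply/funext => x; rewrite {1}/S (l2linB B_lin sG (sS2 f)).
    have := B_comb (fun i => c f 0 i * k (pt i)) => E.
    have e2 := congr1 (fun u => u x) E; have e1 := congr1 (fun u => u x) eG.
    rewrite /= in e1 e2; rewrite -kdelta; under [in RHS]eq_bigr do rewrite Sp.
    by rewrite -e2 -[in RHS]e1 /S; ring.
  move=> E; apply/funext => x; have := congr1 (fun u => u x) E; rewrite /B /= => e.
  by rewrite -[RHS](subrK (k x * S f x)) -e; ring.
have inj h : in_l2 h -> H h = (fun x => z * h x) -> h = fun=> 0.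
  move=> sh Hh; have E := eigen_repr sh Hh.
  pose u : 'rV[C]_n := \row_i h (pt i).
  have : u *m Mx = 0.
    apply/rowP => j; rewrite row_Mx !mxE; under eq_bigr do rewrite mxE.
    rewrite {1}(congr1 (fun w => w (pt j)) E) -big_split /= big1// => i _; ring.
  move=> /(congr1 (fun M => M *m invmx Mx)); rewrite mulmxK// mul0mx => u0.
  rewrite E; apply/funext => x; rewrite big1// => i _.
  have := congr1 (fun w : 'rV_n => w 0 i) u0; rewrite !mxE => ->; ring.
exists S; split=> //; split; last split => //.
  (* A bounds |S f| by |G f|: point values are at most the norm, and |G f| is controlled by
     coercivity. *)
  pose A := 1 + \sum_i (\sum_j cabs (invmx Mx j i)) * cabs (k (pt i)) * nrm (gam i).
  have k0 : 0 < complex.Re z - b by rewrite subr_gt0.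
  have A0 : 0 <= A.
    rewrite addr_ge0// sumr_ge0// => i _; rewrite !mulr_ge0 ?cabs_ge0 ?nrm_ge0//.
    by apply: sumr_ge0 => j _; exact: cabs_ge0.
  exists (A ^+ 2 / (complex.Re z - b) ^+ 2) => f sf.
  have [sG eG] := hG sf.
  rewrite !l2norm2E//; last exact: sS.
  have hn : nrm (S f) <= A * nrm (G f).
    apply: le_trans (nrmD sG (l2N (sS2 f))) _.
    rewrite {2}/nrm n2N -/(nrm _) /A mulrDl mul1r lerD2l.
    apply: le_trans (nrm_sum _ _) _; first by move=> i; apply: l2Z.
    rewrite mulr_suml; apply: ler_sum => i _; rewrite nrmM// cabsM.
    have hc : cabs (c f 0 i) <= (\sum_j cabs (invmx Mx j i)) * nrm (G f).
      rewrite /c mxE; apply: le_trans (cabs_sum _ _) _; rewrite mulr_suml.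
      apply: ler_sum => j _; rewrite cabsM mulrC ler_wpM2l ?cabs_ge0// mxE.
      by apply: ler_wsqrtr; exact: cabs2_le_n2.
    rewrite -mulrA [leRHS](_ : _ = (\sum_j cabs (invmx Mx j i)) * nrm (G f) *
      (cabs (k (pt i)) * nrm (gam i))); last by ring.
    by rewrite ler_wpM2r// mulr_ge0 ?cabs_ge0 ?nrm_ge0.
  have hG2 := coercive_le B_lin hB bz sG; rewrite eG in hG2.
  rewrite -(nrm_sqr (sS _ sf)) mulrAC ler_pdivlMr ?exprn_gt0//.
  apply: (@le_trans _ _ ((A * nrm (G f)) ^+ 2 * (complex.Re z - b) ^+ 2)).
    by rewrite ler_wpM2r ?sqr_ge0// ler_pXn2r ?nnegrE ?mulr_ge0 ?nrm_ge0.
  by rewrite exprMn nrm_sqr// -mulrA ler_wpM2l ?sqr_ge0// mulrC.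
move=> f sf.
(* Apply the right inverse to (H - z) f: the difference between S ((H - z) f) and f is annihilated
   by H - z. *)
have sHf : in_l2 (fun x => H f x - z * f x) by apply: l2B; [exact: hH.1|exact: l2Z].
have e := right _ sHf; set g := S _ in e *; have sg' : in_l2 g by exact: sS.
suff : (fun x => g x - f x) = fun=> 0.
  move=> E; apply/funext => x; apply/eqP; rewrite -subr_eq0; apply/eqP.
  exact: (congr1 (fun u => u x) E).
apply: inj; first exact: l2B.
rewrite l2linB//; apply/funext => x; have := congr1 (fun u => u x) e => /= /eqP.
rewrite -subr_eq0 => /eqP e'; apply/eqP; rewrite -subr_eq0 -e'; apply/eqP; ring.
Qed.
End Resolvent.

Lemma spectrum_eigen : spectrum H z ->
  exists f, [/\ in_l2 f, H f = (fun x => z * f x) & f <> fun=> 0].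
Proof.
move=> sp; have [G hG] := resolvent_exists.
apply: (eigen_of_singular hG); apply/negP => /(nospec_of_unit hG); exact.
Qed.

Lemma eigenspace_fin : exists (n : nat) (e : 'I_n -> T -> C),
  forall f, Defs.eigenspace H z f -> exists c : 'I_n -> C, f = (fun x => \sum_(i < n) c i * e i x).
Proof.
have [G hG] := resolvent_exists; exists (size (enum_fset F)).
eexists => f [sf Hf].
by eexists; exact: (eigen_repr hG sf Hf).
Qed.
End Fredholm.
End Spectral.

(** * Discrete spectrum of symmetric operators *)

Section Discrete.
Variables (R : realType) (d : nat).
Local Notation T := (Zd d).
Local Notation C := R[i].
Implicit Types (f g h : T -> C) (F G : {fset T}).

Definition symm (H : (T -> C) -> (T -> C)) :=
  forall f g, in_l2 f -> in_l2 g -> ip (H f) g = ip f (H g).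
Definition eigv (H : (T -> C) -> (T -> C)) (E : R) (f : T -> C) :=
  [/\ in_l2 f, H f = (fun x => creal E * f x) & f <> fun=> 0].

(* A certificate that the essential spectrum of [H] lies below [b]. *)
Definition finpert (H : (T -> C) -> (T -> C)) (b : R) := exists (F : {fset T}) (k : T -> C),
  (forall x, x \notin F -> k x = 0) /\ formle (fun f x => H f x - k x * f x) b.

Section Op.
Variable H : (T -> C) -> (T -> C).
Hypotheses (hH : l2lin H) (Hb : bnd H) (Hs : symm H).

Lemma eigenvalue_real (z : C) f : in_l2 f -> H f = (fun x => z * f x) ->
  f <> (fun=> 0) -> z = creal (complex.Re z).
Proof.
(* Pairing with i f exposes the imaginary part of z, which [ip f f] does not see. *)
move=> sf Hf f0; pose I : C := Complex 0 1.
have sI := l2Z I sf; have sz := l2Z z sf.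
have E := Hs sf sI; rewrite (l2linZ I hH sf) Hf in E.
have e1 : ip (fun x => z * f x) (fun x => I * f x) = complex.Im z * n2 f.
  rewrite n2E /ip -rsumZ; last exact/in_l2P.
  by congr rsum; apply/funext => x; rewrite /ipr /cabs2; case: z (f x) {E Hf sz} => ? ? [? ?] /=; ring.
have e2 : ip f (fun x => I * (z * f x)) = - complex.Im z * n2 f.
  rewrite n2E /ip -rsumZ; last exact/in_l2P.
  by congr rsum; apply/funext => x; rewrite /ipr /cabs2; case: z (f x) {E Hf sz e1} => ? ? [? ?] /=; ring.
rewrite e1 e2 in E; have : complex.Im z * n2 f = 0 by lra.
move/eqP; rewrite mulf_eq0 => /orP[/eqP i0|/eqP n0].
  by case: z i0 {E e1 e2 Hf sz} => a b /= ->.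
by case: f0; apply: n2_eq0; rewrite // n0.
Qed.

Lemma eigv_orth E E' f f' : E != E' -> in_l2 f -> in_l2 f' ->
  H f = (fun x => creal E * f x) -> H f' = (fun x => creal E' * f' x) -> ip f f' = 0.
Proof.
move=> EE' sf sf' Hf Hf'; have := Hs sf sf'; rewrite Hf Hf' ipZl// ipZr// => e.
have : (E - E') * ip f f' = 0 by lra.
by move/eqP; rewrite mulf_eq0 subr_eq0 (negbTE EE') => /eqP.
Qed.

(* The eigenfunctions of distinct eigenvalues above [b] are orthogonal, so the form exceeds
   [b] on their span, which therefore meets the space of functions vanishing on [F]
   trivially. *)
Lemma eigv_count F b (s : seq R) : uniq s ->
  (forall f, in_l2 f -> (forall x, x \in F -> f x = 0) -> ip (H f) f <= b * n2 f) ->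
  (forall E, E \in s -> b < E /\ exists f, eigv H E f) -> (size s <= size (enum_fset F))%N.
Proof.
move=> us hF hs; rewrite leqNgt; apply/negP => lt.
set n := size s in lt *; set m := size (enum_fset F) in lt *.
pose En (i : 'I_n) := nth 0 s i.
have hE (i : 'I_n) : b < En i /\ exists f, eigv H (En i) f by apply: hs; exact: mem_nth.
have /choice [phi hphi] : forall i : 'I_n, exists f, eigv H (En i) f.
  by move=> i; case: (hE i).
pose A : 'M[C]_(n, m) := \matrix_(i, j) phi i (nth 0 (enum_fset F) j).
have : kermx A != 0.
  by rewrite -mxrank_eq0 mxrank_ker -lt0n subn_gt0 (leq_ltn_trans (rank_leq_col A)).
case/rowV0Pn => c /sub_kermxP cA c0.
pose a i x := c 0 i * phi i x.
have sa i : in_l2 (a i) by apply: l2Z; case: (hphi i).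
have Ha i : H (a i) = fun x => creal (En i) * a i x.
  rewrite /a l2linZ//; last by case: (hphi i).
  by case: (hphi i) => _ -> _; apply/funext => x; ring.
have orth i j : i != j -> ip (a i) (a j) = 0.
  move=> ij; apply: (eigv_orth _ (sa i) (sa j) (Ha i) (Ha j)).
  by rewrite /En nth_uniq.
pose g x := \sum_i a i x.
have sg : in_l2 g by exact: l2_sum.
have gF x : x \in F -> g x = 0.
  move=> xF; have xi : (index x (enum_fset F) < m)%N by rewrite index_mem.
  have h := congr1 (fun u : 'rV_m => u 0 (Ordinal xi)) cA; rewrite !mxE in h; rewrite -[RHS]h.
  by apply: eq_bigr => i _; rewrite mxE nth_index.
have ipg (w : 'I_n -> T -> C) : (forall i, in_l2 (w i)) ->
   (forall i j, i != j -> ip (w i) (a j) = 0) ->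
   ip (fun x => \sum_i w i x) g = \sum_i ip (w i) (a i).
  move=> sw h; rewrite ip_suml//; apply: eq_bigr => i _; rewrite /g ip_sumr//.
  by rewrite (bigD1 i)//= big1 ?addr0// => j ji; apply: h; rewrite eq_sym.
have n2g : n2 g = \sum_i n2 (a i) by exact: ipg.
have Hg : H g = fun x => \sum_i creal (En i) * a i x.
  rewrite /g; have h (r : seq 'I_n) : H (fun x => \sum_(i <- r) a i x) =
      fun x => \sum_(i <- r) creal (En i) * a i x.
    elim: r => [|i r IH].
      by under [X in H X]eq_fun do rewrite big_nil; rewrite (l2lin0 hH);
         apply/funext => x; rewrite big_nil.
    under [X in H X]eq_fun do rewrite big_cons.
    rewrite (l2linD hH (sa i)) ?IH ?Ha; last exact: l2_sum.
    by apply/funext => x; rewrite big_cons.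
  exact: h.
have ipHg : ip (H g) g = \sum_i En i * n2 (a i).
  rewrite Hg ipg; first by apply: eq_bigr => i _; rewrite ipZl.
    by move=> i; exact: l2Z.
  by move=> i j ij; rewrite ipZl// orth// mulr0.
have := hF g sg gF; rewrite ipHg n2g mulr_sumr -subr_ge0 -sumrB => h.
have [i ci] : exists i, c 0 i != 0.
  apply: contrapT => /forallNP h0; case/negP: c0; apply/eqP/rowP => i.
  by rewrite mxE; have /negP := h0 i; rewrite negbK => /eqP.
have ai : 0 < n2 (a i).
  rewrite lt_def n2_ge0// andbT; apply/negP => /eqP n0.
  have a0 := n2_eq0 (sa i); rewrite n0 lexx in a0; have {a0} := a0 isT.
  case: (hphi i) => _ _ p0 e; case: p0; apply/funext => x.
  have := congr1 (fun u => u x) e => /eqP; rewrite /a mulf_eq0 (negbTE ci) => /eqP; exact.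
have : \sum_i (b * n2 (a i) - En i * n2 (a i)) < 0.
  rewrite (bigD1 i)//= -[ltRHS]addr0; apply: ltr_leD.
    by rewrite -mulrBl pmulr_llt0// subr_lt0; case: (hE i).
  apply: sumr_le0 => j _; rewrite -mulrBl mulr_le0_ge0 ?n2_ge0// subr_le0 ltW//.
  by case: (hE j).
by rewrite ltNge h.
Qed.

Lemma finite_sep (s : seq R) E : exists2 e, 0 < e &
  forall x, x \in s -> x != E -> e <= `|x - E|.
Proof.
elim: s => [|y s [e e0 he]]; first by exists 1.
have [->|yE] := eqVneq y E.
  by exists e => // x; rewrite inE => /orP[/eqP ->|/he//]; rewrite eqxx.
exists (Num.min e `|y - E|); first by rewrite lt_min e0 normr_gt0 subr_eq0.
move=> x; rewrite inE => /orP[/eqP -> _|xs xE]; first by rewrite ge_min lexx orbT.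
by rewrite ge_min he.
Qed.

Lemma spectrum_eigv b (z : C) : finpert H b -> b < complex.Re z -> spectrum H z ->
  z = creal (complex.Re z) /\ exists f, eigv H (complex.Re z) f.
Proof.
move=> [F [k [kF hB]]] bz sz.
have [f [sf Hf f0]] := spectrum_eigen hH Hb kF hB bz sz.
have e := eigenvalue_real sf Hf f0; split => //.
by exists f; split; rewrite // -e.
Qed.

Lemma eigv_rdisc b E f : finpert H b -> b < E -> eigv H E f -> rdisc H E.
Proof.
move=> fp bE [sf Hf f0]; have [F [k [kF hB]]] := fp.
split; last split; last split.
- move=> [S [_ [_ [S1 _]]]]; case: f0; rewrite -(S1 _ sf).
  have -> : (fun x => H f x - creal E * f x) = fun=> 0.
    by apply/funext => x; rewrite Hf subrr.
  have := S1 _ (@l2_0 R d); rewrite (l2lin0 hH).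
  by under eq_fun do rewrite mulr0 subr0.
(* Isolation: spectral points with real part above b are real eigenvalues, finitely many because the
   form is at most b on functions vanishing on [F]. All other spectral points are at distance at
   least E - b. *)
- pose A := [set E' | b < E' /\ exists f, eigv H E' f].
  have finA : finite_set A.
    apply: contrapT => infA.
    have [X XA sX] := infinite_set_fset (size (enum_fset F)).+1 infA.
    suff : (size (enum_fset X) <= size (enum_fset F))%N by rewrite leqNgt sX.
    apply: (eigv_count (b := b)); first exact: fset_uniq.
      move=> g sg gF; rewrite (_ : H g = fun x => H g x - k x * g x); first exact: hB.
      apply/funext => x; have [/gF ->|/kF ->] := boolP (x \in F);
        by rewrite ?mulr0 ?mul0r subr0.
    by move=> E' /XA.
  have [e e0 he] := finite_sep (enum_fset (fset_set A)) E.
  exists (Num.min e (E - b)); first rewrite lt_min e0 subr_gt0//; split => // z sz zE.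
  have [bz|zb] := ltP b (complex.Re z).
    have [zr [g hg]] := spectrum_eigv fp bz sz.
    have : complex.Re z != E by apply/eqP => e1; apply: zE; rewrite zr e1.
    move=> /(he (complex.Re z)); rewrite in_fset_set// => h.
    rewrite ge_min; apply/orP; left; apply: le_trans (h _) _.
      by rewrite inE; split => //; exists g.
    by apply: le_trans (Re_cabs _); rewrite zr.
  rewrite ge_min; apply/orP; right; apply: le_trans (Re_cabs _).
  rewrite [complex.Re _](_ : _ = complex.Re z - E); last by case: (z).
  by rewrite ler0_norm ?opprB; lra.
- by exists f.
- exact: (eigenspace_fin hH Hb kF hB).
Qed.

Lemma rdisc_eigv E : rdisc H E -> exists f, eigv H E f.
Proof. by move=> [_ [_ [[f [[sf Hf] f0]] _]]]; exists f. Qed.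

(** A maximizing sequence is a Weyl sequence: if the form nearly reaches M on a unit vector f, then
    (H - M) f is small, which contradicts the bound of an inverse. *)
Lemma sup_spectrum M : (forall f, in_l2 f -> ip (H f) f <= M * n2 f) ->
  (forall e, 0 < e -> exists f, [/\ in_l2 f, n2 f = 1 & M - e < ip (H f) f]) ->
  spectrum H (creal M).
Proof.
move=> hM hs [S [_ [[K hK] [S1 _]]]].
pose P f x := H f x - creal M * f x.
have sP f : in_l2 f -> in_l2 (P f) by move=> sf; apply: l2B; [exact: hH.1|exact: l2Z].
have [K1 K10 hK1] : exists2 K1, 0 <= K1 & forall f, in_l2 f -> n2 (P f) <= K1 * n2 f.
  have [K0 K00 hK0] := Hb; exists (2 * K0 + 2 * M ^+ 2); first by have := sqr_ge0 M; lra.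
  move=> f sf; have := n2D_le (hH.1 _ sf) (l2N (l2Z (creal M) sf)).
  rewrite n2N n2M// cabs2_creal; have := hK0 _ sf; rewrite /P; lra.
pose Q f := - ip (P f) f.
have QE f : in_l2 f -> Q f = M * n2 f - ip (H f) f.
  by move=> sf; rewrite /Q /P ipBl ?ipZl//; [rewrite /n2; ring|exact: hH.1|exact: l2Z].
have Q0 f : in_l2 f -> 0 <= Q f by move=> sf; rewrite QE// subr_ge0 hM.
have Qle f : in_l2 f -> Q f <= (K1 + 1) * n2 f.
  move=> sf; have := n2_ge0 (l2D (sP _ sf) sf); rewrite n2D//; last exact: sP.
  have := hK1 _ sf; rewrite /Q; have := n2_ge0 (sP _ sf); have := n2_ge0 sf; lra.
have Psym f g : in_l2 f -> in_l2 g -> ip (P f) g = ip f (P g).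
  move=> sf sg; rewrite /P ipBl//; [|exact: hH.1|exact: l2Z].
  by rewrite ipBr//; [rewrite Hs// ipZl// ipZr|exact: hH.1|exact: l2Z].
(* Cauchy-Schwarz for the nonnegative form [Q], in the form |P f|^2 <= |P| Q(f) *)
have key f : in_l2 f -> n2 (P f) <= (K1 + 1) * Q f.
  move=> sf; have sPf := sP _ sf; pose t : R := (K1 + 1)^-1.
  have t0 : 0 < t by rewrite invr_gt0; lra.
  have tK : t * (K1 + 1) = 1 by rewrite mulVf// gt_eqF//; lra.
  have st := l2Z (creal t) sPf.
  (* Since t is the inverse of the bound [K1 + 1] of [Q], the quadratic term is at most t |P f|^2,
     half of the linear one; nonnegativity at f + t P f leaves t |P f|^2 <= Q f. *)
  have := Q0 _ (l2D sf st).
  have -> : Q (fun x => f x + creal t * P f x) =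
      Q f - 2 * t * n2 (P f) + t ^+ 2 * Q (P f).
    rewrite /Q; have -> : P (fun x => f x + creal t * P f x) =
       fun x => P f x + creal t * P (P f) x.
      rewrite {1}/P (l2linD hH)// (l2linZ _ hH)//; apply/funext => x; rewrite /P; ring.
    have sPPf := sP _ sPf; have st2 := l2Z (creal t) sPPf.
    rewrite ipDl//; last exact: l2D.
    rewrite (ipDr sf st sPf) (ipDr sf st st2) (ipZr t sPf sPf) (ipZl t sPPf sf) (ipZl t sPPf st).
    rewrite (ipZr t sPPf sPf) (Psym (P f) f)// /n2; ring.
  have : t ^+ 2 * Q (P f) <= t * n2 (P f).
    by rewrite expr2 -mulrA ler_pM2l// -[leRHS]mul1r -tK -mulrA ler_pM2l// Qle.
  move=> h1 h2; rewrite -(ler_pM2l t0) mulrA tK mul1r; lra.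
(* With this tolerance, 1 = |f|^2 <= K |P f|^2 <= (|K| + 1) (K1 + 1) Q f < 1/2. The absolute value
   is there because the sign of K is unknown. *)
have [f [sf f1 hf]] := hs (2 * (`|K| + 1) * (K1 + 1))^-1 ltac:(rewrite invr_gt0 !mulr_gt0//; lra).
have h1 : n2 f <= K * n2 (P f).
  by have := hK _ (sP _ sf); rewrite -/(P f) S1// !l2norm2E//; exact: sP.
have h2 := key f sf; rewrite QE// f1 in h2; rewrite f1 in h1.
have h3 : K * n2 (P f) <= (`|K| + 1) * n2 (P f).
  by apply: ler_wpM2r; [exact: n2_ge0 (sP _ sf)|have := ler_norm K; lra].
have c0 : 0 < (`|K| + 1) * (K1 + 1) by rewrite mulr_gt0 ?ltr_wpDl.
have h4 : (`|K| + 1) * n2 (P f) <= (`|K| + 1) * ((K1 + 1) * (M * 1 - ip (H f) f)).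
  by rewrite ler_wpM2l// ltW// ltr_wpDl.
have h5 : M * 1 - ip (H f) f < (2 * (`|K| + 1) * (K1 + 1))^-1 by lra.
have h6 : (`|K| + 1) * (K1 + 1) * (M * 1 - ip (H f) f) <
   (`|K| + 1) * (K1 + 1) * (2 * (`|K| + 1) * (K1 + 1))^-1 by rewrite ltr_pM2l.
have e6 : (`|K| + 1) * (K1 + 1) * (2 * (`|K| + 1) * (K1 + 1))^-1 = 2^-1.
  by have := normr_ge0 K => K0; field; rewrite !gt_eqF//; lra.
rewrite e6 in h6; lra.
Qed.

(** The supremum M of the form over unit vectors lies in the spectrum and above b, where every
    spectral point is an eigenvalue. *)
Lemma top_exists b f : (forall e, 0 < e -> finpert H (b + e)) -> in_l2 f ->
  b * n2 f < ip (H f) f -> exists E, rdisc H E /\ b < E.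
Proof.
move=> fp sf hf; have [K K0 hK] := Hb.
have n0 : 0 < n2 f.
  rewrite lt_def n2_ge0// andbT; apply/negP => /eqP e.
  have f0 : f = fun=> 0 by apply: n2_eq0; rewrite // e.
  by move: hf; rewrite f0 (l2lin0 hH) ip0l n2_0 mulr0 ltxx.
pose X := [set r | exists g, [/\ in_l2 g, n2 g = 1 & r = ip (H g) g]].
have normalize g : in_l2 g -> 0 < n2 g -> exists2 g', in_l2 g' /\ n2 g' = 1 &
    ip (H g') g' = ip (H g) g / n2 g.
  move=> sg ng; pose c := creal (Num.sqrt (n2 g))^-1; have sc := l2Z c sg.
  have cc : (Num.sqrt (n2 g))^-1 * (Num.sqrt (n2 g))^-1 = (n2 g)^-1.
    by rewrite -invfM -expr2 sqr_sqrtr// ltW.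
  exists (fun x => c * g x); first split => //.
    by rewrite n2M// cabs2_creal expr2 cc mulVf// gt_eqF.
  have sH := hH.1 _ sg.
  by rewrite (l2linZ c hH sg) (ipZl _ sH sc) (ipZr _ sH sg) mulrA cc mulrC.
have [f1 [sf1 n1] Hf1] := normalize f sf n0.
have supX : has_sup X.
  split; first by exists (ip (H f1) f1); exists f1.
  exists (K + 1) => _ [g [sg g1 ->]].
  have := n2_ge0 (l2B (hH.1 _ sg) sg); rewrite n2B// ?g1; last exact: hH.1.
  have := hK _ sg; rewrite g1; lra.
pose M := sup X.
have bM : b < M.
  apply: (@lt_le_trans _ _ (ip (H f1) f1)); first by rewrite Hf1 ltr_pdivlMr.
  by apply: sup_upper_bound => //; exists f1.
have hM g : in_l2 g -> ip (H g) g <= M * n2 g.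
  move=> sg; have := n2_ge0 sg; rewrite le_eqVlt => /orP[/eqP e|ng].
    have -> : g = fun=> 0 by apply: n2_eq0; rewrite // -e.
    by rewrite (l2lin0 hH) ip0l n2_0 mulr0.
  have [g1 [sg1 ng1] Hg1] := normalize g sg ng.
  rewrite -ler_pdivrMr// -Hg1; apply: sup_upper_bound => //.
  by exists g1.
have sM : spectrum H (creal M).
  apply: sup_spectrum => // e e0.
  have [_ [g [sg g1 ->]] hg] := sup_adherent e0 supX.
  by exists g.
(* The certificate holds only at b + e with e > 0; half of the gap still leaves M strictly above. *)
have e0 : 0 < (M - b) / 2 by lra.
have bM' : b + (M - b) / 2 < M by lra.
have [_ [g hg]] := @spectrum_eigv _ (creal M) (fp _ e0) bM' sM.
exists M; split => //; exact: (eigv_rdisc (fp _ e0) bM' hg).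
Qed.
End Op.
End Discrete.

(** * Fourier analysis on finite grids *)

Section Trig.
Variable R : realType.
Local Notation C := R[i].
Implicit Types (s t : R) (z : int).

Lemma expi0 : expi 0 = 1 :> C.
Proof. by rewrite /expi cos0 sin0. Qed.
Lemma expiD s t : expi (s + t) = expi s * expi t :> C.
Proof. by rewrite /expi cosD sinD; congr Complex; ring. Qed.
Lemma expiN t : expi (- t) = cconj (expi t) :> C.
Proof. by rewrite /expi /cconj cosN sinN. Qed.
Lemma cabs2_expi t : cabs2 (expi t : C) = 1.
Proof. by rewrite /cabs2 /= cos2Dsin2. Qed.
Lemma expiVl t : expi (- t) * expi t = 1 :> C.
Proof. by rewrite -expiD addNr expi0. Qed.
Lemma expiX t n : expi (t *+ n) = expi t ^+ n :> C.
Proof. by elim: n => [|n IH]; rewrite ?mulr0n ?expi0 ?expr0// mulrS expiD IH exprS. Qed.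
Lemma expi_2piz z : expi (pi *+ 2 * z%:~R) = 1 :> C.
Proof.
have h n : expi (pi *+ 2 * n%:R) = 1 :> C.
  by rewrite mulr_natr expiX /expi cos2pi sin2pi expr1n.
case: z => n; first exact: h.
rewrite NegzE mulrNz mulrN expiN -[n.+1%:~R]/(n.+1%:R) h.
by rewrite /cconj /= oppr0.
Qed.
Lemma cabs2_expi1 t : cabs2 (expi t - 1 : C) = 4 * sin (t / 2) ^+ 2.
Proof.
have -> : cabs2 (expi t - 1 : C) = 2 - 2 * cos t.
  rewrite /cabs2 /= subr0 sqrrB expr1n mulr1.
  by have := cos2Dsin2 t; lra.
have -> : cos t = cos (t / 2 *+ 2) by rewrite mulr2n -splitr.
by rewrite cos_mulr2n sin2cos2; ring.
Qed.

Lemma sin_neq0_int z (N : nat) : z != 0 -> (`|z| < N)%N ->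
  sin (pi * z%:~R / N%:R) != 0 :> R.
Proof.
move=> z0 zN; have N0 : (0 < N)%N by lia.
have h n : (0 < n < N)%N -> 0 < sin (pi * n%:R / N%:R) :> R.
  case/andP=> n0 nN; apply: sin_gt0_pi; rewrite !divr_gt0 ?mulr_gt0 ?pi_gt0 ?ltr0n//=.
  by rewrite ltr_pdivrMr ?ltr0n// ltr_pM2l ?pi_gt0// ltr_nat.
case: z z0 zN => n z0 zN.
  by rewrite gt_eqF// h//; apply/andP; split; lia.
rewrite NegzE mulrNz mulrN mulNr sinN oppr_eq0 gt_eqF// h//; lia.
Qed.

(* The half-step shift keeps 0 off the grid when [N] is even. *)
Definition theta (N j : nat) : R := pi * (2 * j%:R + 1) / N%:R - pi.

(** A geometric sum whose ratio is an N-th root of unity, different from 1 because 0 < |z| < N. *)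
Lemma sum_theta z (N : nat) : (`|z| < N)%N ->
  \sum_(j < N) expi (z%:~R * theta N j) = if z == 0 then N%:R else 0 :> C.
Proof.
move=> zN; have N0 : N%:R != 0 :> R by rewrite pnatr_eq0; lia.
case: eqVneq => [->|z0].
  rewrite (eq_bigr (fun=> 1)); first by rewrite sumr_const card_ord.
  by move=> j _; rewrite mul0r expi0.
(* a is the phase at j = 0, and 2 b the phase increment from one grid point to the next. *)
pose a : R := z%:~R * (pi / N%:R - pi).
pose b : R := pi * z%:~R / N%:R.
have -> : \sum_(j < N) expi (z%:~R * theta N j) = expi a * \sum_(j < N) expi (b *+ 2) ^+ j :> C.
  rewrite mulr_sumr; apply: eq_bigr => j _; rewrite -expiX -expiD; congr expi.
  by rewrite -[_ *+ j]mulr_natr /theta /a /b; field.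
have w1 : expi (b *+ 2) - 1 != 0 :> C.
  apply/negP => /eqP e; have := cabs2_expi1 (b *+ 2); rewrite e cabs2_0 => /esym/eqP.
  rewrite (_ : b *+ 2 / 2 = b); last by rewrite mulr2n; field.
  rewrite mulf_eq0 pnatr_eq0 /= sqrf_eq0.
  by apply/negP; exact: sin_neq0_int.
apply/eqP; rewrite mulf_eq0; apply/orP; right.
rewrite -(inj_eq (mulfI w1)) mulr0 -subrX1 -expiX subr_eq0; apply/eqP.
rewrite -[RHS](expi_2piz z); congr expi; rewrite -[_ *+ N]mulr_natr /b.
by rewrite -[_ *+ 2]mulr_natr -[pi *+ 2]mulr_natr; field.
Qed.
End Trig.

(** * Discrete Fourier inversion and Parseval identity *)

Section Fourier.
Variables (R : realType) (d : nat).
Local Notation T := (Zd d).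
Local Notation C := R[i].
Implicit Types (f g u : T -> C) (F G : {fset T}) (t : 'rV[R]_d).

Lemma dotZD (x y : T) t : dotZ (x + y) t = dotZ x t + dotZ y t.
Proof.
by rewrite /dotZ -big_split /=; apply: eq_bigr => k _; rewrite mxE intrD mulrDl.
Qed.
Lemma dotZN (x : T) t : dotZ (- x) t = - dotZ x t.
Proof. by rewrite /dotZ -sumrN; apply: eq_bigr => k _; rewrite mxE mulrNz mulNr. Qed.
Lemma dotZDr (x : T) s t : dotZ x (s + t) = dotZ x s + dotZ x t.
Proof. by rewrite /dotZ -big_split /=; apply: eq_bigr => k _; rewrite mxE mulrDr. Qed.
Lemma dotZ0 t : dotZ (0 : T) t = 0.
Proof. by rewrite /dotZ big1// => k _; rewrite mxE mul0r. Qed.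

Lemma cconj_sum (I : Type) (r : seq I) (z : I -> C) :
  cconj (\sum_(i <- r) z i) = \sum_(i <- r) cconj (z i).
Proof.
elim: r => [|i r IH]; first by rewrite !big_nil /cconj /= oppr0.
by rewrite !big_cons -IH /cconj; case: (z i) => a b; case: (\sum_(j <- r) _) => ? ? /=; rewrite opprD.
Qed.
Lemma Re_sum (I : Type) (r : seq I) (z : I -> C) :
  complex.Re (\sum_(i <- r) z i) = \sum_(i <- r) complex.Re (z i).
Proof.
elim: r => [|i r IH]; first by rewrite !big_nil.
by rewrite !big_cons -IH; case: (z i) => a b; case: (\sum_(j <- r) _).
Qed.
Lemma cconjM (z w : C) : cconj (z * w) = cconj z * cconj w.
Proof. by case: z w => a b [a' b'] /=; rewrite /cconj /=; congr Complex; ring. Qed.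
Lemma ReMconj (z w : C) : complex.Re (z * cconj w) = ipr z w.
Proof. by case: z w => a b [a' b'] /=; rewrite /ipr /cconj /=; ring. Qed.
Lemma Re_natM n (z : C) : complex.Re (n%:R * z) = n%:R * complex.Re z.
Proof.
rewrite !mulr_natl; elim: n => [|n IH]; first by rewrite !mulr0n.
by rewrite !mulrS -IH; case: (z) => a b; case: (_ *+ n).
Qed.

Definition TH N (J : {ffun 'I_d -> 'I_N}) : 'rV[R]_d := \row_k theta R N (J k).

Lemma grid_orth N (x : T) : (forall k, (`|x 0%R k| < N)%N) ->
  \sum_(J : {ffun 'I_d -> 'I_N}) expi (dotZ x (TH J)) =
    if x == 0 then (N ^ d)%:R else 0 :> C.
Proof.
move=> xN.
have -> : \sum_(J : {ffun 'I_d -> 'I_N}) expi (dotZ x (TH J)) =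
   \prod_(k < d) \sum_(j < N) expi ((x 0 k)%:~R * theta R N j) :> C.
  rewrite bigA_distr_bigA; apply: eq_bigr => J _; rewrite /dotZ.
  rewrite (big_morph _ (@expiD R) (expi0 R)); apply: eq_bigr => k _.
  by rewrite mxE.
under eq_bigr => k _ do rewrite sum_theta//.
case: eqVneq => [->|x0].
  rewrite (eq_bigr (fun=> N%:R)); last by move=> k _; rewrite mxE eqxx.
  by rewrite prodr_const card_ord natrX.
have [k xk] : exists k, x 0 k != 0.
  apply: contrapT => /forallNP h; case/negP: x0; apply/eqP/rowP => k.
  by rewrite mxE; have /negP := h k; rewrite negbK => /eqP.
by rewrite (bigD1 k)//= (negbTE xk) mul0r.
Qed.

Definition FT u t : C := csum (fun x => u x * expi (- dotZ x t)).

Definition supp u F := forall x, x \notin F -> u x = 0.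

Lemma FT_fin F u t : supp u F -> FT u t = \sum_(x <- F) u x * expi (- dotZ x t).
Proof. by move=> h; rewrite /FT (@csum_fin _ _ F)// => x /h ->; rewrite mul0r. Qed.

Lemma FT_shift F u y t : supp u F ->
  FT (fun x => u (x + y)) t = expi (dotZ y t) * FT u t.
Proof.
move=> h; rewrite (FT_fin t h) (@FT_fin [fset x - y | x in F]%fset).
  rewrite big_imfset /=; last by move=> a b _ _; exact: addIr.
  rewrite mulr_sumr; apply: eq_bigr => x _; rewrite subrK dotZD dotZN opprD opprK.
  by rewrite expiD; ring.
move=> x hx; apply: h; apply/negP => xF; case/negP: hx; apply/imfsetP.
by exists (x + y) => //=; rewrite addrK.
Qed.

(** No two points of [F] are aliased by the grid of size N, which is what makes inversion and
    Parseval exact for functions supported in [F]. *)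
Definition spread N F := forall x y, x \in F -> y \in F -> forall k, (`|x 0%R k - y 0%R k| < N)%N.

Lemma spread_exists F : exists N0, forall N, (N0 <= N)%N -> spread N F.
Proof.
have [M hM] : exists M, forall x : T, x \in enum_fset F -> forall k, (`|x 0%R k| <= M)%N.
  elim: (enum_fset F) => [|x r [M hM]]; first by exists 0%N.
  exists (maxn (\max_k `|x 0%R k|) M) => y; rewrite inE => /orP[/eqP ->|/hM h] k.
    by rewrite leq_max (@leq_bigmax _ (fun k => `|x 0%R k|%N) k).
  by rewrite leq_max h orbT.
exists (M + M).+1 => N NM x y xF yF k; have hx := hM x xF k; have hy := hM y yF k.
move: (x 0%R k : int) (y 0%R k : int) hx hy => a b; lia.
Qed.

Lemma FT_inv N F u x : spread N F -> supp u F -> x \in F ->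
  \sum_(J : {ffun 'I_d -> 'I_N}) FT u (TH J) * expi (dotZ x (TH J)) = (N ^ d)%:R * u x.
Proof.
move=> sp su xF; under eq_bigr => J _ do rewrite (FT_fin _ su) mulr_suml.
rewrite exchange_big /= (big_fsetD1 x)//=.
have E y : y \in F -> \sum_(J : {ffun 'I_d -> 'I_N}) u y * expi (- dotZ y (TH J)) * expi (dotZ x (TH J)) =
   u y * (if x - y == 0 then (N ^ d)%:R else 0).
  move=> yF; rewrite -grid_orth; last by move=> k; rewrite !mxE; exact: sp.
  rewrite mulr_sumr; apply: eq_bigr => J _; rewrite -mulrA -expiD; congr (_ * expi _).
  by rewrite dotZD dotZN addrC.
rewrite E// subrr eqxx big_seq big1 ?addr0; first by rewrite mulrC.
move=> y; rewrite in_fsetD1 => /andP[yx yF]; rewrite E// subr_eq0 eq_sym (negbTE yx) mulr0//.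
Qed.

Lemma parseval N F f g : spread N F -> supp f F -> supp g F ->
  \sum_(J : {ffun 'I_d -> 'I_N}) ipr (FT f (TH J)) (FT g (TH J)) = (N ^ d)%:R * ip f g.
Proof.
move=> sp sf sg.
have -> : ip f g = complex.Re (\sum_(x <- F) f x * cconj (g x)).
  rewrite Re_sum /ip (@rsum_fin _ _ F); last by move=> x /sf ->; rewrite /ipr /= !mul0r addr0.
  by apply: eq_bigr => x _; rewrite ReMconj.
rewrite -Re_natM mulr_sumr.
have -> : \sum_(x <- F) (N ^ d)%:R * (f x * cconj (g x)) =
  \sum_(x <- F) \sum_(J : {ffun 'I_d -> 'I_N}) FT f (TH J) * expi (dotZ x (TH J)) * cconj (g x) :> C.
  by apply: eq_big_seq => x xF; rewrite -mulr_suml (FT_inv sp sf xF) mulrA.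
rewrite exchange_big /= Re_sum; apply: eq_bigr => J _; rewrite -ReMconj; congr complex.Re.
rewrite (FT_fin _ sg) cconj_sum mulr_sumr; apply: eq_bigr => x _.
by rewrite cconjM -expiN opprK; ring.
Qed.
End Fourier.

(** * The momentum integral *)

Section Elementary.
Variable R : realType.
Local Notation C := R[i].

Lemma cs_real (I : Type) (r : seq I) (s t : I -> R) :
  (\sum_(i <- r) s i * t i) ^+ 2 <= (\sum_(i <- r) s i ^+ 2) * (\sum_(i <- r) t i ^+ 2).
Proof.
set X := \sum_(i <- r) s i * t i; set A := \sum_(i <- r) s i ^+ 2; set B := \sum_(i <- r) t i ^+ 2.
have A0 : 0 <= A by apply: sumr_ge0 => i _; exact: sqr_ge0.
have B0 : 0 <= B by apply: sumr_ge0 => i _; exact: sqr_ge0.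
have h l : 0 <= A + 2 * l * X + l ^+ 2 * B.
  have -> : A + 2 * l * X + l ^+ 2 * B = \sum_(i <- r) (s i + l * t i) ^+ 2.
    rewrite /A /X /B !mulr_sumr -!big_split /=; apply: eq_bigr => i _; ring.
  by apply: sumr_ge0 => i _; exact: sqr_ge0.
move: B0; rewrite le_eqVlt => /orP[/eqP e|B0].
  rewrite -e mulr0; have [->|X0] := eqVneq X 0; first by rewrite expr0n.
  (* When B = 0 the expression is affine in l; this value of l makes it equal to -1 unless X = 0. *)
  have := h (- (A + 1) / (2 * X)); rewrite -e mulr0 addr0.
  have -> : 2 * (- (A + 1) / (2 * X)) * X = - (A + 1) by field.
  lra.
have := h (- X / B).
have -> : A + 2 * (- X / B) * X + (- X / B) ^+ 2 * B = (A * B - X ^+ 2) / B.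
  by field; rewrite gt_eqF.
by rewrite pmulr_lge0 ?invr_gt0// subr_ge0.
Qed.

Lemma cs_weight (I : Type) (r : seq I) (z e : I -> C) (w : I -> R) : (forall i, 0 < w i) ->
  cabs2 (\sum_(i <- r) z i * e i) <=
   (\sum_(i <- r) w i * cabs2 (z i)) * (\sum_(i <- r) cabs2 (e i) / w i).
Proof.
move=> w0.
pose s i := Num.sqrt (w i) * cabs (z i); pose t i := cabs (e i) / Num.sqrt (w i).
have := cs_real r s t.
have -> : \sum_(i <- r) s i ^+ 2 = \sum_(i <- r) w i * cabs2 (z i).
  by apply: eq_bigr => i _; rewrite exprMn sqr_sqrtr ?ltW// cabs_sqr.
have -> : \sum_(i <- r) t i ^+ 2 = \sum_(i <- r) cabs2 (e i) / w i.
  by apply: eq_bigr => i _; rewrite expr_div_n cabs_sqr sqr_sqrtr ?ltW.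
apply: le_trans; rewrite -cabs_sqr ler_pXn2r ?nnegrE ?cabs_ge0//.
  apply: le_trans (cabs_sum _ _) _; apply: ler_sum => i _.
  have wi : Num.sqrt (w i) != 0 by rewrite sqrtr_eq0 -ltNge.
  by rewrite cabsM le_eqVlt /s /t; apply/orP; left; apply/eqP; field.
apply: sumr_ge0 => i _; rewrite /s /t !mulr_ge0 ?invr_ge0 ?sqrtr_ge0 ?cabs_ge0//.
Qed.

Lemma sin_MVT (y : R) : 0 < y ->
  exists2 c, c \in `]0, y[ & sin y - sin 0 = cos c * (y - 0).
Proof.
move=> y0; apply: MVT => //.
by apply: continuous_subspaceT => ?; exact: continuous_sin.
Qed.

Lemma norm_sin_le (x : R) : `|sin x| <= `|x|.
Proof.
have h (y : R) : 0 < y -> `|sin y| <= y.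
  move=> y0; have [c _] := sin_MVT y0.
  by rewrite sin0 !subr0 => ->; rewrite normrM (gtr0_norm y0) ler_piMl ?(ltW y0)// cos_max.
have [x0|x0|->] := ltgtP x 0; last by rewrite sin0.
  by rewrite (ltr0_norm x0) -normrN -sinN; apply: h; rewrite oppr_gt0.
by rewrite (gtr0_norm x0); exact: h.
Qed.

(** |e^(it) - 1| = 2 |sin (t / 2)|, and sin y >= b y on [0, pi/2]: below 1 by the mean value theorem
    and cos >= cos 1, above 1 since sin y >= sin 1 and y < 2. Hence the two entries of b. *)
Lemma chord_lower : exists2 c : R, 0 < c & forall t, `|t| <= pi ->
  c * t ^+ 2 <= cabs2 (expi t - 1 : C).
Proof.
pose b : R := Num.min (cos 1) (sin 1 / 2).
have s1 : 0 < sin 1 :> R by apply: sin2_gt0; rewrite ltr01 ltr1n.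
have b0 : 0 < b by rewrite lt_min cos1_gt0 divr_gt0.
have ph := @pihalf_ge1 R; have ph2 := @pihalf_lt2 R.
have h (y : R) : 0 <= y <= pi / 2 -> b * y <= sin y.
  case/andP; rewrite le_eqVlt => /orP[/eqP <-|y0] yp; first by rewrite mulr0 sin0.
  have [y1|y1] := leP y 1.
    have [c] := sin_MVT y0.
    rewrite in_itv /= => /andP[c0 cy]; rewrite sin0 !subr0 => ->.
    rewrite ler_pM2r// /b ge_min; apply/orP; left.
    by rewrite leNgt ltr_cos ?in_itv /=; [rewrite -leNgt; lra|lra..].
  apply: (@le_trans _ _ (sin 1)); last first.
    by rewrite leNgt ltr_sin ?in_itv /=; [rewrite -leNgt; lra|lra..].
  apply: (@le_trans _ _ (b * 2)); first by rewrite ler_pM2l//; lra.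
  by rewrite -ler_pdivlMr// /b ge_min lexx orbT.
exists (b ^+ 2); first by rewrite exprn_gt0.
move=> t tp; rewrite cabs2_expi1.
have : (b * (`|t| / 2)) ^+ 2 <= sin (`|t| / 2) ^+ 2.
  have hh : b * (`|t| / 2) <= sin (`|t| / 2) by apply: h; rewrite divr_ge0//=; lra.
  have p0 : 0 <= b * (`|t| / 2) by rewrite mulr_ge0 ?divr_ge0// ltW.
  by rewrite ler_pXn2r ?nnegrE//; exact: le_trans hh.
have -> : sin (`|t| / 2) ^+ 2 = sin (t / 2) ^+ 2.
  by have [t0|t0] := leP 0 t; [rewrite ger0_norm|rewrite ltr0_norm// mulNr sinN sqrrN].
have -> : (b * (`|t| / 2)) ^+ 2 = b ^+ 2 * t ^+ 2 / 4.
  by rewrite -[t ^+ 2]real_normK ?num_real//; field.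
lra.
Qed.

(** Interpolation between the trivial bound and the quadratic one: min (1, y^2) <= y^a whenever 0 <
    a <= 2. *)
Lemma chord_upper (t y a : R) : `|t| <= y -> 0 < a <= 2 ->
  cabs2 (expi t - 1 : C) <= 4 * y `^ a.
Proof.
move=> ty /andP[a0 a2]; rewrite cabs2_expi1 ler_pM2l//.
have y0 : 0 <= y := le_trans (normr_ge0 _) ty.
have [y1|y1] := leP y 1; last first.
  apply: (@le_trans _ _ 1).
    by rewrite -[_ ^+ 2]real_normK ?num_real// expr_le1// sin_max.
  by rewrite -(powRr0 y); apply: ler_powR; rewrite ltW.
move: y0; rewrite le_eqVlt => /orP[/eqP e|y0].
  by move: ty; rewrite -e normr_le0 => /eqP ->; rewrite mul0r sin0 expr0n powR_ge0.
apply: (@le_trans _ _ (y ^+ 2)).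
  rewrite -[leLHS]real_normK ?num_real// ler_pXn2r ?nnegrE ?(ltW y0)//.
  by apply: le_trans (norm_sin_le _) _; rewrite normrM [X in _ * X]ger0_norm//; have := normr_ge0 t; lra.
rewrite -powR_mulrn; last exact: ltW.
by apply: ger_powR; rewrite ?y0.
Qed.

(** A discrete form of the comparison with the integral of x^s. The factor 2 gives slack for crude
    estimates in the induction step. *)
Lemma sum_powR (s : R) (m : nat) : -1 < s < 0 ->
  \sum_(i < m) (i.+1%:R) `^ s <= 2 / (1 + s) * m%:R `^ (1 + s).
Proof.
case/andP=> s1 s0; have p0 : 0 < 1 + s by lra.
elim: m => [|m IH]; first by rewrite big_ord0 mulr_ge0 ?powR_ge0// divr_ge0// ltW.
rewrite big_ord_recr /=.
set n : R := m.+1%:R; have n0 : 0 < n by rewrite ltr0n.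
have n1 : 1 <= n by rewrite ler1n.
suff h : 2 / (1 + s) * m%:R `^ (1 + s) + n `^ s <= 2 / (1 + s) * n `^ (1 + s).
  by apply: le_trans h; rewrite lerD2r.
have en : n `^ (1 + s) = n * n `^ s by rewrite powRD ?gt_eqF// ?implybT// powRr1// ltW.
have ns := powR_gt0 s n0.
(* The step follows from (1 - 1/n)^(1 + s) <= e^(-y) <= 1 / (1 + y) <= 1 - y/2, the last bound
   because 0 < y <= 1. *)
pose y := (1 + s) / n; have y0 : 0 < y by rewrite divr_gt0.
have y1 : y <= 1 by rewrite ler_pdivrMr//; lra.
have hm : m%:R `^ (1 + s) <= n `^ (1 + s) * (1 - y / 2).
  (* The case m = 0 is treated apart, since the logarithm of 1 - 1/n requires n > 1. *)
  case: m @n IH n0 n1 en ns @y y0 y1 => [|m] n IH n0 n1 en ns y y0 y1.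
    by rewrite powR0 ?gt_eqF// mulr_ge0 ?powR_ge0//; lra.
  have q0 : 0 < 1 - n^-1.
    by rewrite subr_gt0 invf_lt1// ltr1n.
  have -> : m.+1%:R = n * (1 - n^-1).
    by rewrite mulrBr mulr1 divff ?gt_eqF// /n -[m.+2%:R]natr1 addrK.
  rewrite powRM ?(ltW n0) ?(ltW q0)// ler_pM2l ?powR_gt0//.
  have -> : (1 - n^-1) `^ (1 + s) = expR ((1 + s) * ln (1 - n^-1)) by rewrite /powR gt_eqF.
  apply: (@le_trans _ _ (expR (- y))).
    rewrite ler_expR /y -mulrN ler_pM2l//.
    by apply: le_ln1Dx; rewrite ltrN2 invf_lt1// ltr1n.
  rewrite expRN; apply: (@le_trans _ _ (1 + y)^-1).
    by rewrite lef_pV2 ?posrE ?expR_gt0 ?expR_ge1Dx//; lra.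
  rewrite -[X in X <= _]mul1r ler_pdivrMr; last lra.
  have : 0 <= y * (1 - y) by rewrite mulr_ge0//; lra.
  lra.
apply: (@le_trans _ _ (2 / (1 + s) * (n `^ (1 + s) * (1 - y / 2)) + n `^ s)).
  by rewrite lerD2r ler_pM2l// divr_gt0.
by rewrite en /y le_eqVlt; apply/orP; left; apply/eqP; field; rewrite !gt_eqF.
Qed.
End Elementary.

(** * Grid sums of singular momentum weights *)

Section GridSum.
Variable R : realType.

Lemma theta_le N j : (j < N)%N -> `|theta R N j| <= pi.
Proof.
move=> jN; have N0 : 0 < N%:R :> R by rewrite ltr0n; lia.
have -> : theta R N j = pi * ((2 * j%:R + 1 - N%:R) / N%:R).
  by rewrite /theta; field; rewrite gt_eqF.
rewrite normrM (ger0_norm (@pi_ge0 R)) ler_piMr ?pi_ge0//.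
have h : (j%:R + 1 <= N%:R :> R) by rewrite natr1 ler_nat.
have h0 : (0 <= j%:R :> R) by [].
rewrite normrM normfV (gtr0_norm N0) ler_pdivrMr// mul1r ler_norml.
by apply/andP; split; lra.
Qed.

(** An even grid is symmetric: with [theta_lo], its points are the numbers pi (2 i + 1) / (2 m) for
    i < m and their opposites. *)
Lemma theta_hi m i : (0 < m)%N -> theta R (m + m) (m + i) = pi * (2 * i%:R + 1) / (m + m)%:R.
Proof.
move=> m0; have N0 : 0 < m%:R :> R by rewrite ltr0n.
rewrite /theta !natrD; field; rewrite gt_eqF//; lra.
Qed.

Lemma theta_lo m i : (0 < m)%N -> (i < m)%N ->
  theta R (m + m) (m - i.+1) = - (pi * (2 * i%:R + 1) / (m + m)%:R).
Proof.
move=> m0 im; have N0 : 0 < m%:R :> R by rewrite ltr0n.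
rewrite /theta natrB// !natrD -[i.+1%:R]natr1; field; rewrite gt_eqF//; lra.
Qed.

Lemma theta_neq0 m j : (j < m + m)%N -> theta R (m + m) j != 0.
Proof.
move=> jm; have m0 : (0 < m)%N by lia.
have h i : 0 < pi * (2 * i%:R + 1) / (m + m)%:R :> R.
  have i0 : 0 < 2 * i%:R + 1 :> R by rewrite ltr_wpDl// mulr_ge0.
  by rewrite divr_gt0 ?mulr_gt0 ?pi_gt0 ?ltr0n//; lia.
have [jm'|mj] := ltnP j m.
  have -> : j = (m - (m - j.+1).+1)%N by lia.
  by rewrite theta_lo// ?oppr_eq0 ?gt_eqF//; lia.
by rewrite -(subnKC mj) theta_hi// gt_eqF.
Qed.

(** Uniform in m because the singularity is integrable, s > -1. The i-th positive point is at least
    (i + 1) / m, as pi / 2 >= 1, and s < 0 reverses the comparison, reducing each half to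
    [sum_powR]. *)
Lemma grid_pow (s : R) m : -1 < s < 0 -> (0 < m)%N ->
  \sum_(j < m + m) `|theta R (m + m) j| `^ s <= 2 / (1 + s) * (m + m)%:R.
Proof.
move=> hs m0; have mR : 0 < m%:R :> R by rewrite ltr0n.
have half : \sum_(i < m) (pi * (2 * i%:R + 1) / (m + m)%:R) `^ s <= 2 / (1 + s) * m%:R.
  apply: (@le_trans _ _ (\sum_(i < m) (m%:R `^ (- s) * i.+1%:R `^ s))).
    apply: ler_sum => i _.
    have x0 : 0 < i.+1%:R / m%:R :> R by rewrite divr_gt0 ?ltr0n.
    have -> : m%:R `^ (- s) * i.+1%:R `^ s = (i.+1%:R / m%:R) `^ s.
      by rewrite powRM ?invr_ge0// -powR_inv1 ?(ltW mR)// -powRrM mulN1r mulrC.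
    have xy : i.+1%:R / m%:R <= pi * (2 * i%:R + 1) / (m + m)%:R :> R.
      rewrite ler_pdivrMr// natrD.
      have -> : pi * (2 * i%:R + 1) / (m%:R + m%:R) * m%:R = pi / 2 * (2 * i%:R + 1) :> R.
        by field; rewrite !gt_eqF//; lra.
      apply: (@le_trans _ _ (1 * (2 * i%:R + 1))).
        by rewrite -[i.+1%:R]natr1; have : 0 <= i%:R :> R by []; lra.
      by rewrite ler_wpM2r ?pihalf_ge1// addr_ge0// mulr_ge0.
    have y0 := lt_le_trans x0 xy.
    rewrite -[s]opprK !(powRN _ (- s)) lef_pV2 ?posrE ?powR_gt0//.
    apply: ge0_ler_powR; rewrite ?nnegrE ?(ltW x0) ?(ltW y0)//; lra.
  rewrite -mulr_sumr; apply: (@le_trans _ _ (m%:R `^ (- s) * (2 / (1 + s) * m%:R `^ (1 + s)))).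
    by rewrite ler_wpM2l ?powR_ge0// sum_powR.
  rewrite mulrCA -powRD; last by rewrite (gt_eqF mR) implybT.
  by rewrite (_ : - s + (1 + s) = 1) ?powRr1 ?(ltW mR)//; ring.
rewrite big_split_ord /= natrD mulrDr; apply: lerD; last first.
  apply: le_trans half; apply: ler_sum => i _.
  rewrite theta_hi// ger0_norm// divr_ge0// mulr_ge0 ?pi_ge0//.
apply: le_trans half; rewrite (reindex_inj rev_ord_inj) /=; apply: ler_sum => i _.
rewrite theta_lo// normrN ger0_norm// divr_ge0// mulr_ge0 ?pi_ge0//.
Qed.

Lemma dotZ_le d (x : Zd d) (t : 'rV[R]_d) :
  `|dotZ x t| <= znorm R x * Num.sqrt (\sum_k t 0 k ^+ 2).
Proof.
have s0 (u : 'I_d -> R) : 0 <= \sum_k u k ^+ 2 by apply: sumr_ge0 => k _; exact: sqr_ge0.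
rewrite -(@ler_pXn2r _ 2)// ?nnegrE ?mulr_ge0 ?sqrtr_ge0//.
rewrite real_normK ?num_real// exprMn !sqr_sqrtr//; exact: cs_real.
Qed.

(** After [chord_upper] the singularity is r^(a - 2) = r^(g - d) with r = |t|. It is distributed
    equally over the d coordinates; since |t_k| <= r and g / d - 1 < 0, each factor is at most
    |t_k|^(g/d - 1), and the sum over the grid factorizes. *)
Lemma term_bound d (x : Zd d) (t : 'rV[R]_d) (a g : R) : (0 < d)%N ->
  0 < a <= 2 -> a = 2 - d%:R + g -> g < d%:R -> (forall k, t 0 k != 0) ->
  cabs2 (expi (dotZ x t) - 1 : R[i]) / (\sum_k t 0 k ^+ 2) <=
   4 * znorm R x `^ a * \prod_k `|t 0 k| `^ (g / d%:R - 1).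
Proof.
move=> d0 ha ea gd t0.
have tk k : 0 < t 0 k ^+ 2 by rewrite lt_def sqrf_eq0 t0 sqr_ge0.
pose k0 := Ordinal d0.
have S0 : 0 < \sum_k t 0 k ^+ 2.
  by rewrite (bigD1 k0)//= ltr_pwDl// sumr_ge0// => k _; exact: sqr_ge0.
set r := Num.sqrt (\sum_k t 0 k ^+ 2).
have r0 : 0 < r by rewrite sqrtr_gt0.
have rS : \sum_k t 0 k ^+ 2 = r ^+ 2 by rewrite sqr_sqrtr// ltW.
have dR : 0 < d%:R :> R by rewrite ltr0n.
rewrite rS ler_pdivrMr ?exprn_gt0//; apply: le_trans (chord_upper (dotZ_le x t) ha) _.
rewrite -/r powRM ?sqrtr_ge0// -!mulrA ler_pM2l// ler_wpM2l ?powR_ge0//.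
have -> : r `^ a = r `^ ((g / d%:R - 1) * d%:R) * r ^+ 2.
  rewrite -powR_mulrn ?(ltW r0)// -powRD; last by rewrite (gt_eqF r0) implybT.
  by congr powR; rewrite ea; field; rewrite gt_eqF.
rewrite ler_wpM2r ?sqr_ge0// powRrM powR_mulrn ?powR_ge0//.
rewrite -[X in _ ^+ X](card_ord d) -prodr_const; apply: ler_prod => k _.
rewrite powR_ge0 /=; have tk0 : 0 < `|t 0 k| by rewrite normr_gt0.
have tr : `|t 0 k| <= r.
  rewrite -(@ler_pXn2r _ 2)// ?nnegrE ?sqrtr_ge0// -rS real_normK ?num_real//.
  by rewrite (bigD1 k)//= lerDl sumr_ge0// => ? _; exact: sqr_ge0.
have s0 : g / d%:R - 1 <= 0 by rewrite subr_le0 ler_pdivrMr// mul1r ltW.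
rewrite -[g / _ - 1]opprK !(powRN _ (- (g / _ - 1))) lef_pV2 ?posrE ?powR_gt0//.
by apply: ge0_ler_powR; rewrite ?nnegrE ?(ltW tk0) ?(ltW r0)// oppr_ge0.
Qed.

Lemma grid_bound d (x : Zd d) (a g : R) (m : nat) : (0 < d)%N -> (0 < m)%N ->
  0 < a <= 2 -> a = 2 - d%:R + g -> 0 < g < d%:R ->
  \sum_(J : {ffun 'I_d -> 'I_(m + m)})
     cabs2 (expi (dotZ x (TH R J)) - 1 : R[i]) / (\sum_k TH R J 0 k ^+ 2) <=
   4 * znorm R x `^ a * (2 / (g / d%:R)) ^+ d * ((m + m) ^ d)%:R.
Proof.
move=> d0 m0 ha ea /andP[g0 gd]; have dR : 0 < d%:R :> R by rewrite ltr0n.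
have hs : -1 < g / d%:R - 1 < 0.
  by rewrite subr_lt0 ltr_pdivrMr// mul1r gd ltrBrDl addrN divr_gt0.
apply: (@le_trans _ _ (\sum_(J : {ffun 'I_d -> 'I_(m + m)})
  4 * znorm R x `^ a * \prod_k `|theta R (m + m) (J k)| `^ (g / d%:R - 1))).
  apply: ler_sum => J _; have := @term_bound d x (TH R J) a g d0 ha ea gd _.
  under eq_bigr do rewrite mxE; move=> h.
  apply: h => k.
  by rewrite mxE; apply: theta_neq0.
rewrite -mulr_sumr -[X in _ <= X]mulrA ler_wpM2l ?mulr_ge0 ?powR_ge0//.
rewrite -(bigA_distr_bigA (fun (k : 'I_d) (j : 'I_(m + m)) => `|theta R (m + m) j| `^ (g / d%:R - 1))).
rewrite natrX -exprMn prodr_const card_ord.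
apply: lerXn2r; rewrite ?nnegrE.
- by apply: sumr_ge0 => j _; exact: powR_ge0.
- by rewrite mulr_ge0// divr_ge0// ltW// divr_gt0.
by have := grid_pow hs m0; rewrite (_ : 1 + (g / d%:R - 1) = g / d%:R)//; ring.
Qed.
End GridSum.

Lemma leq_succDl a b : (a <= (a + b).+1)%N. Proof. lia. Qed.
Lemma leq_succDr a b : (b <= (a + b).+1)%N. Proof. lia. Qed.
Lemma leq_succDDl a b : (a <= (a + b).+1 + (a + b).+1)%N. Proof. lia. Qed.
Lemma leq_succDDr a b : (b <= (a + b).+1 + (a + b).+1)%N. Proof. lia. Qed.

(** * Kinetic energy and the Hardy-type inequality *)

Section Kinetic.
Variables (R : realType) (d : nat).
Local Notation T := (Zd d).
Local Notation C := R[i].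
Variables (eh : T -> C) (em c Cc : R).
Hypotheses (se : csumm eh) (c0 : 0 < c).
Hypothesis disp_low : forall t : 'rV[R]_d, (forall k, `|t 0 k| <= pi) ->
  c * \sum_k t 0 k ^+ 2 <= em - disp eh t.
Hypothesis disp_up : forall t : 'rV[R]_d, (forall k, `|t 0 k| <= pi) ->
  em - disp eh t <= Cc * \sum_k t 0 k ^+ 2.
Implicit Types (u : T -> C) (F S : {fset T}) (t : 'rV[R]_d).

(* Formally the average of (em - disp eh) |FT u|^2 over the torus. *)
Definition kin u := em * n2 u - ip (h0 eh u) u.

Lemma disp_trunc S t :
  `|disp eh t - complex.Re (\sum_(y <- S) eh y * expi (dotZ y t))| <= l1n (offs S eh).
Proof.
have b1 (y : T) : cabs (expi (dotZ y t) : C) <= 1 by rewrite /cabs cabs2_expi sqrtr1.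
have s1 := csumm_bmul (csumm_trunc S se) b1; have s2 := csumm_bmul (csumm_offs S se) b1.
have -> : \sum_(y <- S) eh y * expi (dotZ y t) = csum (fun y => trunc S eh y * expi (dotZ y t)).
  rewrite (@csum_fin _ _ S); first by apply: eq_big_seq => y yS; rewrite /trunc yS.
  by move=> y /negbTE yS; rewrite /trunc yS mul0r.
have -> : disp eh t = complex.Re (csum (fun y => trunc S eh y * expi (dotZ y t)) +
    csum (fun y => offs S eh y * expi (dotZ y t))).
  rewrite /disp; congr complex.Re; rewrite -[X in _ = X + _]mul1r -csum_lin//.
  congr csum; apply/funext => y; rewrite /trunc /offs; case: ifP => _; ring.
set A := csum _; set B := csum _.
have -> : complex.Re (A + B) - complex.Re A = complex.Re B.
  by case: A B => ? ? [? ?] /=; ring.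
apply: le_trans (Re_cabs _) _; apply: le_trans (cabs_csum s2) _.
apply: ler_rsum => //; last exact: csumm_offs.
by move=> y; rewrite cabsM ler_piMr ?cabs_ge0.
Qed.

Lemma FT_h0T F S u t : supp u F ->
  FT (h0T S eh u) t = (\sum_(y <- S) eh y * expi (dotZ y t)) * FT u t.
Proof.
move=> su; pose F' := (\bigcup_(y <- S) [fset (x : T) - y | x in F])%fset.
have sF' y : y \in S -> supp (fun x => u (x + y)) F'.
  move=> yS x xF'; apply: su; apply/negP => xF; case/negP: xF'.
  apply/bigfcupP; exists y; rewrite ?yS//; apply/imfsetP; exists (x + y) => //=.
  by rewrite addrK.
have sh : supp (h0T S eh u) F'.
  by move=> x xF'; rewrite /h0T big_seq big1// => y yS; rewrite (sF' y yS x xF') mulr0.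
rewrite (FT_fin t sh) /h0T; under eq_bigr do rewrite mulr_suml.
rewrite exchange_big /= mulr_suml; apply: eq_big_seq => y yS.
rewrite -mulrA -(FT_shift y t su) (FT_fin t (sF' y yS)) mulr_sumr.
by apply: eq_bigr => x _; rewrite mulrA.
Qed.

Lemma ipr_scal (a z : C) : ipr (a * z) z = complex.Re a * cabs2 z.
Proof. by case: a z => ? ? [? ?]; rewrite /ipr /cabs2 /=; ring. Qed.

Lemma supp_l2 F u : supp u F -> in_l2 u.
Proof. exact: l2_fin. Qed.

Lemma suppS F G u : (F `<=` G)%fset -> supp u F -> supp u G.
Proof. by move=> /fsubsetP FG h x xG; apply: h; apply: contra xG; exact: FG. Qed.

(** Parseval is exact for a finite-range truncation; dropping the long-range part of [eh] costs e/2
    in the operator and e/2 in the symbol, uniformly in the grid. *)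
Lemma grid_kin F u e : supp u F -> 0 < e -> exists N0, forall N, (N0 <= N)%N ->
  `|\sum_(J : {ffun 'I_d -> 'I_N}) (em - disp eh (TH R J)) * cabs2 (FT u (TH R J)) -
    (N ^ d)%:R * kin u| <= (N ^ d)%:R * (e * n2 u).
Proof.
move=> su e0; have e2 : 0 < e / 2 by rewrite divr_gt0.
have su2 := supp_l2 su.
have [S1 hS1] := h0T_approx se e2; have [S2 hS2] := l1n_offs se e2.
pose S := (S1 `|` S2)%fset.
have h1 := hS1 S (fsubsetUl _ _) u u su2 su2; have h2 := hS2 S (fsubsetUr _ _).
rewrite -expr2 nrm_sqr// in h1.
(* The grid must resolve the supports of both u and its image under the truncated hopping
   operator. *)
pose F' := (F `|` \bigcup_(y <- S) [fset (x : T) - y | x in F])%fset.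
have su' : supp u F' by apply: suppS su; exact: fsubsetUl.
have sh : supp (h0T S eh u) F'.
  move=> x xF'; rewrite /h0T big_seq big1// => y yS; rewrite su ?mulr0//.
  apply/negP => xF; case/negP: xF'; rewrite in_fsetU; apply/orP; right.
  apply/bigfcupP; exists y; rewrite ?yS//; apply/imfsetP; exists (x + y) => //=.
  by rewrite addrK.
have [N0 hN0] := spread_exists F'; exists N0 => N /hN0 sp.
have p1 := parseval sp su' su'; have p2 := parseval sp sh su'.
rewrite -/(n2 u) in p1.
pose a J := complex.Re (\sum_(y <- S) eh y * expi (dotZ y (@TH R d N J))).
have p2' : (N ^ d)%:R * ip (h0T S eh u) u = \sum_J a J * cabs2 (FT u (TH R J)).
  by rewrite -p2; apply: eq_bigr => J _; rewrite (FT_h0T _ _ su) ipr_scal.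
have p1' : (N ^ d)%:R * n2 u = \sum_J cabs2 (FT u (@TH R d N J)).
  by rewrite -p1; apply: eq_bigr => J _; rewrite iprzz.
have -> : \sum_(J : {ffun 'I_d -> 'I_N}) (em - disp eh (TH R J)) * cabs2 (FT u (TH R J)) -
    (N ^ d)%:R * kin u =
   \sum_(J : {ffun 'I_d -> 'I_N}) (a J - disp eh (TH R J)) * cabs2 (FT u (TH R J)) +
   (N ^ d)%:R * (ip (h0 eh u) u - ip (h0T S eh u) u).
  have -> : (N ^ d)%:R * kin u = em * ((N ^ d)%:R * n2 u) - (N ^ d)%:R * ip (h0 eh u) u.
    by rewrite /kin; ring.
  rewrite [in RHS]mulrBr p2' p1' mulr_sumr.
  set X := _ * ip _ _.
  rewrite opprB addrA addrAC -sumrB [RHS]addrA [RHS]addrAC -sumrB.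
  congr (_ + _); apply: eq_bigr => J _; ring.
apply: le_trans (ler_normD _ _) _.
have -> : (N ^ d)%:R * (e * n2 u) = e / 2 * ((N ^ d)%:R * n2 u) + (N ^ d)%:R * (e / 2 * n2 u).
  by field.
apply: lerD; last by rewrite normrM ger0_norm// ler_wpM2l.
apply: le_trans (ler_norm_sum _ _ _) _; rewrite p1' mulr_sumr; apply: ler_sum => J _.
rewrite normrM (ger0_norm (cabs2_ge0 _)) ler_wpM2r ?cabs2_ge0// distrC.
by apply: le_trans (disp_trunc _ _) _; exact: ltW.
Qed.

Lemma TH_le N (J : {ffun 'I_d -> 'I_N}) k : `|TH R J 0 k| <= pi.
Proof. by rewrite mxE; exact: theta_le. Qed.

Lemma sumsq_ge0 t : 0 <= \sum_k t 0 k ^+ 2.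
Proof. by apply: sumr_ge0 => k _; exact: sqr_ge0. Qed.

Lemma kin_ge0_fin F u : supp u F -> 0 <= kin u.
Proof.
move=> su; have n0 := n2_ge0 (supp_l2 su).
apply/ler_addgt0Pl => e e0; have e1 : 0 < e / (n2 u + 1) by rewrite divr_gt0// ltr_wpDl.
have [N0 /(_ N0.+1 (leqnSn _))] := grid_kin su e1.
set M : R := (_ ^ d)%:R; have M0 : 0 < M by rewrite ltr0n expn_gt0.
have G0 : 0 <= \sum_(J : {ffun 'I_d -> 'I_N0.+1}) (em - disp eh (TH R J)) * cabs2 (FT u (TH R J)).
  apply: sumr_ge0 => J _; rewrite mulr_ge0 ?cabs2_ge0//.
  by apply: le_trans (disp_low (@TH_le _ J)); rewrite mulr_ge0 ?sumsq_ge0// ltW.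
rewrite ler_norml => /andP[_ h].
have h2 : M * (- kin u) <= M * (e / (n2 u + 1) * n2 u) by lra.
rewrite ler_pM2l// in h2.
have h3 : e / (n2 u + 1) * n2 u <= e.
  by rewrite mulrAC ler_pdivrMr ?ltr_wpDl// ler_wpM2l ?(ltW e0)//; lra.
lra.
Qed.

(* Cauchy-Schwarz on the momentum grid: [u x - u 0] is the average of FT u (t) (e^{ix.t} - 1), and the
   singular weight |e^{ix.t} - 1|^2 / |t|^2 is integrable up to the factor |x|^a. *)
Lemma hardy_fin (a g : R) F u x : (0 < d)%N -> 0 < a <= 2 -> a = 2 - d%:R + g -> 0 < g < d%:R ->
  supp u F -> x \in F -> 0 \in F ->
  cabs2 (u x - u 0) <= 4 / c * (2 / (g / d%:R)) ^+ d * znorm R x `^ a * kin u.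
Proof.
move=> d0 ha ea hg su xF zF; have n0 := n2_ge0 (supp_l2 su).
set D := 4 / c * _ * _.
have dR : 0 < d%:R :> R by rewrite ltr0n.
have D0 : 0 <= D.
  have := andP hg => -[g0 _].
  by rewrite /D !mulr_ge0 ?powR_ge0 ?invr_ge0 ?(ltW c0)// exprn_ge0// divr_ge0// ltW// divr_gt0.
apply/ler_addgt0Pl => e e0.
have e1 : 0 < e / (D * n2 u + 1) by rewrite divr_gt0// ltr_wpDl// mulr_ge0.
have [N0 hN0] := grid_kin su e1; have [N1 hN1] := spread_exists F.
pose m := (N0 + N1).+1; have m0 : (0 < m)%N by [].
have sp : spread (m + m) F by apply: hN1; exact: leq_succDDr.
have := hN0 (m + m)%N (leq_succDDl _ _); set M : R := (_ ^ d)%:R.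
have M0 : 0 < M by rewrite ltr0n expn_gt0 /m addSn.
set G := \sum_J _ => hG.
(* The grid size is even, so t = 0 is not a grid point and the weight is positive. *)
pose w (J : {ffun 'I_d -> 'I_(m + m)}) := c * \sum_k TH R J 0 k ^+ 2.
have w0 J : 0 < w J.
  rewrite /w mulr_gt0// (bigD1 (Ordinal d0))//= ltr_pwDl//.
    by rewrite lt_def sqr_ge0 sqrf_eq0 mxE theta_neq0.
  by apply: sumr_ge0 => k _; exact: sqr_ge0.
have inv : M * cabs2 (u x - u 0) * M <= G * (\sum_J cabs2 (expi (dotZ x (TH R J)) - 1 : C) / w J).
  have -> : M * cabs2 (u x - u 0) * M = cabs2 (creal M * (u x - u 0)).
    by rewrite cabs2M cabs2_creal; ring.
  have -> : creal M * (u x - u 0) = \sum_J FT u (TH R J) * (expi (dotZ x (@TH R d (m + m) J)) - 1).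
    have i1 := FT_inv sp su xF; have i2 := FT_inv sp su zF.
    have -> : creal M = ((m + m) ^ d)%:R :> C by rewrite /M /creal -(rmorph_nat (real_complex R)).
    rewrite mulrBr -i1 -i2 -sumrB; apply: eq_bigr => J _.
    by rewrite dotZ0 expi0; ring.
  apply: le_trans (cs_weight _ _ _ w0) _; apply: ler_wpM2r.
    by apply: sumr_ge0 => J _; rewrite divr_ge0 ?cabs2_ge0// ltW.
  apply: ler_sum => J _; rewrite ler_wpM2r ?cabs2_ge0//; apply: disp_low; exact: TH_le.
have gb : \sum_J cabs2 (expi (dotZ x (TH R J)) - 1 : C) / w J <= D * M.
  have := grid_bound x d0 m0 ha ea hg; rewrite -/M => h.
  have -> : D * M = c^-1 * (4 * znorm R x `^ a * (2 / (g / d%:R)) ^+ d * M) by rewrite /D; ring.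
  apply: le_trans (ler_wpM2l _ h); last by rewrite invr_ge0 ltW.
  by rewrite mulr_sumr; apply: ler_sum => J _; rewrite /w invfM mulrCA mulrA.
have G0 : 0 <= G.
  apply: sumr_ge0 => J _; rewrite mulr_ge0 ?cabs2_ge0//.
  by apply: le_trans (ltW (w0 J)) (disp_low (@TH_le _ J)).
move: hG; rewrite ler_norml => /andP[_ hG].
have h4 : M * cabs2 (u x - u 0) * M <= G * D * M by rewrite -[leRHS]mulrA; apply: le_trans inv (ler_wpM2l G0 gb).
rewrite ler_pM2r// in h4.
have h5 : D * G <= D * (M * (kin u + e / (D * n2 u + 1) * n2 u)).
  by apply: ler_wpM2l => //; lra.
have h6 : M * cabs2 (u x - u 0) <= M * (D * (kin u + e / (D * n2 u + 1) * n2 u)) by lra.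
rewrite ler_pM2l// in h6; apply: le_trans h6 _.
have h7 : D * (e / (D * n2 u + 1) * n2 u) <= e.
  have -> : D * (e / (D * n2 u + 1) * n2 u) = e * (D * n2 u) / (D * n2 u + 1) by ring.
  rewrite ler_pdivrMr; last by rewrite ltr_wpDl// mulr_ge0.
  by rewrite ler_wpM2l ?(ltW e0)//; lra.
lra.
Qed.

Definition unitZ (k : 'I_d) : T := delta_mx 0 k.

Lemma dotZ_unit k t : dotZ (unitZ k) t = t 0 k.
Proof.
rewrite /dotZ (bigD1 k)//= big1 ?addr0; first by rewrite mxE !eqxx mul1r.
by move=> l lk; rewrite mxE eqxx (negbTE lk) mul0r.
Qed.

(** The symbol of the nearest-neighbour Dirichlet form is the sum of |e^(it_k) - 1|^2, which
    dominates |t|^2 on the cube by [chord_lower]. *)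
Lemma kin_dirichlet : exists2 C' : R, 0 <= C' & forall F u, supp u F ->
  kin u <= C' * \sum_k n2 (fun x => u (x + unitZ k) - u x).
Proof.
have [b b0 hb] := chord_lower R.
(* The absolute value makes the constant nonnegative whatever the sign of [Cc]. *)
exists (`|Cc| / b); first by rewrite divr_ge0// ltW.
move=> F u su; have su2 := supp_l2 su; have n0 := n2_ge0 su2.
set E := \sum_k _.
apply/ler_addgt0Pl => e e0; have e1 : 0 < e / (n2 u + 1) by rewrite divr_gt0// ltr_wpDl.
pose F' := (F `|` \bigcup_(k <- enum 'I_d) [fset (x : T) - unitZ k | x in F])%fset.
have su' : supp u F' by apply: suppS su; exact: fsubsetUl.
have sk k : supp (fun x => u (x + unitZ k)) F'.
  move=> x xF'; apply: su; apply/negP => xF; case/negP: xF'.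
  rewrite in_fsetU; apply/orP; right; apply/bigfcupP; exists k; rewrite ?mem_enum//.
  by apply/imfsetP; exists (x + unitZ k) => //=; rewrite addrK.
have sd k : supp (fun x => u (x + unitZ k) - u x) F'.
  by move=> x xF'; rewrite (sk k x xF') su'// subr0.
have [N0 hN0] := grid_kin su e1; have [N1 hN1] := spread_exists F'.
pose N := (N0 + N1).+1.
have sp : spread N F' by apply: hN1; exact: leq_succDr.
have := hN0 N (leq_succDl _ _); set M : R := (_ ^ d)%:R.
have M0 : 0 < M by rewrite ltr0n expn_gt0 /N.
set G := \sum_J _; rewrite ler_norml => /andP[hG _].
have FTd k t : FT (fun x => u (x + unitZ k) - u x) t = (expi (t 0 k) - 1) * FT u t.
  rewrite mulrBl mul1r -(dotZ_unit k t) -(FT_shift _ t su) (FT_fin t (sd k)) (FT_fin t (sk k)).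
  by rewrite (FT_fin t su') -sumrB; apply: eq_bigr => x _; rewrite mulrBl.
have EM : M * E = \sum_J (\sum_k cabs2 (expi (TH R J 0 k) - 1 : C)) * cabs2 (FT u (@TH R d N J)).
  rewrite /E mulr_sumr; under [RHS]eq_bigr do rewrite mulr_suml.
  rewrite exchange_big /=; apply: eq_bigr => k _.
  rewrite /n2 -(parseval sp (sd k) (sd k)); apply: eq_bigr => J _.
  by rewrite iprzz FTd cabs2M.
have GE : G <= `|Cc| / b * (M * E).
  rewrite EM mulr_sumr; apply: ler_sum => J _; rewrite mulrA ler_wpM2r ?cabs2_ge0//.
  apply: le_trans (disp_up (@TH_le _ J)) _.
  apply: (@le_trans _ _ (`|Cc| * \sum_k TH R J 0 k ^+ 2)).
    by rewrite ler_wpM2r ?sumsq_ge0// ler_norm.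
  rewrite -mulrA ler_wpM2l// mulrC ler_pdivlMr// mulrC mulr_sumr.
  by apply: ler_sum => k _; apply: hb; exact: TH_le.
have h2 : M * kin u <= M * (`|Cc| / b * E + e / (n2 u + 1) * n2 u) by lra.
rewrite ler_pM2l// in h2.
have h3 : e / (n2 u + 1) * n2 u <= e.
  by rewrite mulrAC ler_pdivrMr ?ltr_wpDl// ler_wpM2l ?(ltW e0)//; lra.
lra.
Qed.
End Kinetic.

(** * Passage from finite supports to square-summable functions *)

Section KineticL2.
Variables (R : realType) (d : nat).
Local Notation T := (Zd d).
Local Notation C := R[i].
Implicit Types (u f g : T -> C) (F S : {fset T}).

Lemma supp_trunc F u : supp (trunc F u) F.
Proof. by move=> x /negbTE xF; rewrite /trunc xF. Qed.

Lemma trunc_offs F u : u = fun x => trunc F u x + offs F u x.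
Proof. by apply/funext => x; rewrite /trunc /offs; case: ifP; rewrite ?addr0 ?add0r. Qed.

Lemma offs_l2 F u : in_l2 u -> in_l2 (offs F u).
Proof.
by apply: in_l2_le => x; rewrite /offs; case: ifP; rewrite // cabs2_0 cabs2_ge0.
Qed.

Lemma n2_offs u e : in_l2 u -> 0 < e -> exists F, forall G, (F `<=` G)%fset -> n2 (offs G u) < e.
Proof.
move=> su e0; have [F hF] := rsum_tail ((in_l2P u).1 su) e0; exists F => G /hF.
rewrite n2E; congr (rsum _ < _); apply/funext => x; rewrite /offs; case: ifP => _.
  by rewrite cabs2_0.
by rewrite ger0_norm ?cabs2_ge0.
Qed.

Lemma nrm_trunc F u : in_l2 u -> nrm (trunc F u) <= nrm u.
Proof.
move=> su; apply: ler_wsqrtr; rewrite !n2E; apply: ler_rsum; last exact/in_l2P.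
  by move=> x; rewrite /trunc; case: ifP; rewrite ?cabs2_0 ?cabs2_ge0.
by apply/in_l2P; apply: l2_fin (@supp_trunc F u).
Qed.

Variables (eh : T -> C) (em : R).
Hypothesis se : csumm eh.

(** Continuity of the bounded form [kin]. Forcing [G] into [F] freezes prescribed values of u; the
    Hardy bound needs those at x and at 0. *)
Lemma kin_trunc u G e : in_l2 u -> 0 < e ->
  exists F, (G `<=` F)%fset /\ `|kin eh em (trunc F u) - kin eh em u| <= e.
Proof.
move=> su e0.
pose P f x := creal em * f x - h0 eh f x.
have hh := h0_lin se.
have lP : l2lin P.
  split=> [f sf|a f g sf sg]; first by apply: l2B; [exact: l2Z|exact: hh.1].
  by apply/funext => x; rewrite /P (hh.2 a _ _ sf sg); ring.
have kP f : in_l2 f -> kin eh em f = ip (P f) f.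
  by move=> sf; rewrite /P ipBl ?ipZl//; [exact: l2Z|exact: hh.1].
pose A := `|em| + l1n eh.
have A0 : 0 <= A by rewrite addr_ge0 ?l1n_ge0.
have nP f : in_l2 f -> nrm (P f) <= A * nrm f.
  move=> sf; have [h1 h2] := h0_bounded se sf.
  apply: le_trans (nrmD (l2Z _ sf) (l2N h1)) _.
  rewrite /A mulrDl nrmM// {1}/cabs cabs2_creal sqrtr_sqr lerD2l.
  rewrite {1}/nrm n2N -/(nrm _); apply: nrm_le.
    by rewrite mulr_ge0 ?nrm_ge0 ?l1n_ge0.
  by rewrite exprMn nrm_sqr.
have e1 : 0 < e / (2 * A * nrm u + 1) by rewrite divr_gt0// ltr_wpDl// !mulr_ge0 ?nrm_ge0.
have [F0 hF0] := n2_offs su (exprn_gt0 2 e1).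
pose F := (G `|` F0)%fset; exists F; split; first exact: fsubsetUl.
have := hF0 F (fsubsetUr _ _) => nr.
have sr := offs_l2 F su; have sw := supp_l2 (@supp_trunc F u).
set r := offs F u in nr sr; set w := trunc F u in sw *.
have rr : nrm r <= e / (2 * A * nrm u + 1) by apply: nrm_le; rewrite ltW.
have wu : nrm w <= nrm u by exact: nrm_trunc.
have Pu : P u = fun x => P w x + P r x by rewrite (trunc_offs F u) (l2linD lP).
have sPu := lP.1 _ su; have sPw := lP.1 _ sw; have sPr := lP.1 _ sr.
have dif : kin eh em u - kin eh em w = ip (P u) r + ip (P r) w.
  have e1' : ip (P u) u = ip (P u) w + ip (P u) r by rewrite [X in ip _ X = _](trunc_offs F u) ipDr.
  have e2' : ip (P u) w = ip (P w) w + ip (P r) w by rewrite Pu ipDl.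
  rewrite (kP _ su) (kP _ sw) e1' e2'; ring.
rewrite distrC dif; apply: le_trans (ler_normD _ _) _.
have i1 := ip_le sPu sr; have i2 := ip_le sPr sw.
have b1 : nrm (P u) * nrm r <= A * nrm u * nrm r by rewrite ler_wpM2r ?nrm_ge0 ?nP.
have b2 : nrm (P r) * nrm w <= A * nrm r * nrm u.
  exact: (ler_pM (nrm_ge0 _) (nrm_ge0 _) (nP _ sr) wu).
have b3 : 2 * A * nrm u * nrm r <= 2 * A * nrm u * (e / (2 * A * nrm u + 1)).
  by rewrite ler_wpM2l// !mulr_ge0 ?nrm_ge0.
have b4 : 2 * A * nrm u * (e / (2 * A * nrm u + 1)) <= e.
  rewrite mulrCA ler_piMr ?(ltW e0)// ler_pdivrMr; first lra.
  by rewrite ltr_wpDl// !mulr_ge0 ?nrm_ge0.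
lra.
Qed.

Variables (c Cc : R).
Hypothesis c0 : 0 < c.
Hypothesis disp_low : forall t : 'rV[R]_d, (forall k, `|t 0 k| <= pi) ->
  c * \sum_k t 0 k ^+ 2 <= em - disp eh t.

Lemma kin_ge0 u : in_l2 u -> 0 <= kin eh em u.
Proof.
move=> su; apply/ler_addgt0Pl => e e0; have [F [_ h]] := kin_trunc fset0 su e0.
have := kin_ge0_fin se c0 disp_low (@supp_trunc F u).
by move: h; rewrite ler_norml => /andP[_ h] h2; lra.
Qed.

Lemma hardy (a g : R) u x : (0 < d)%N -> 0 < a <= 2 -> a = 2 - d%:R + g -> 0 < g < d%:R ->
  in_l2 u ->
  cabs2 (u x - u 0) <= 4 / c * (2 / (g / d%:R)) ^+ d * znorm R x `^ a * kin eh em u.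
Proof.
move=> d0 ha ea hg su; set D := 4 / c * _ * _.
have D0 : 0 <= D.
  have dR : 0 < d%:R :> R by rewrite ltr0n.
  have := andP hg => -[g0 _].
  by rewrite /D !mulr_ge0 ?powR_ge0 ?invr_ge0 ?(ltW c0)// exprn_ge0// divr_ge0// ltW// divr_gt0.
apply/ler_addgt0Pl => e e0.
have e1 : 0 < e / (D + 1) by rewrite divr_gt0// ltr_wpDl.
have [F [/fsubsetP FG h]] := kin_trunc [fset x; 0]%fset su e1.
have xF : x \in F by apply: FG; rewrite !inE eqxx.
have zF : 0 \in F by apply: FG; rewrite !inE eqxx orbT.
have := hardy_fin se c0 disp_low d0 ha ea hg (@supp_trunc F u) xF zF.
rewrite -/D /trunc xF zF -/(trunc F u) => h2; apply: le_trans h2 _.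
move: h; rewrite ler_norml => /andP[_ h].
have h3 : D * kin eh em (trunc F u) <= D * (kin eh em u + e / (D + 1)).
  by rewrite ler_wpM2l//; lra.
have h4 : D * (e / (D + 1)) <= e.
  by rewrite mulrCA ler_piMr ?(ltW e0)// ler_pdivrMr; lra.
lra.
Qed.
End KineticL2.

(** * Translation in momentum space *)

Section Gauge.
Variables (R : realType) (d : nat).
Local Notation T := (Zd d).
Local Notation C := R[i].
Variables (eh : T -> C) (p : 'rV[R]_d).
Hypothesis se : csumm eh.

(* Multiplication by e^{ix.p} conjugates the hopping operator of [eh] to that of [geh],
   whose dispersion relation is translated by [p]. *)
Definition gauge (u : T -> C) : T -> C := fun x => expi (dotZ x p) * u x.
Definition ungauge (f : T -> C) : T -> C := fun x => expi (- dotZ x p) * f x.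
Definition geh : T -> C := fun y => eh y * expi (dotZ y p).

Lemma csumm_geh : csumm geh.
Proof.
by apply: (csumm_bmul (M := 1) se) => y; rewrite /cabs cabs2_expi sqrtr1.
Qed.

Lemma cabs2_gauge u x : cabs2 (gauge u x) = cabs2 (u x).
Proof. by rewrite cabs2M cabs2_expi mul1r. Qed.
Lemma cabs2_ungauge u x : cabs2 (ungauge u x) = cabs2 (u x).
Proof. by rewrite cabs2M cabs2_expi mul1r. Qed.
Lemma gauge_l2 u : in_l2 u -> in_l2 (gauge u).
Proof. by apply: in_l2_le => x; rewrite cabs2_gauge. Qed.
Lemma ungauge_l2 u : in_l2 u -> in_l2 (ungauge u).
Proof. by apply: in_l2_le => x; rewrite cabs2_ungauge. Qed.
Lemma ungaugeK f : gauge (ungauge f) = f.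
Proof.
by apply/funext => x; rewrite /gauge /ungauge mulrA mulrC [expi (dotZ _ _) * _]mulrC expiVl mulr1.
Qed.

Lemma disp_geh t : disp geh t = disp eh (p + t).
Proof.
rewrite /disp /geh; congr (complex.Re (csum _)); apply/funext => x.
by rewrite dotZDr expiD mulrA.
Qed.

Lemma n2_gauge u : n2 (gauge u) = n2 u.
Proof. by rewrite !n2E; congr rsum; apply/funext => x; exact: cabs2_gauge. Qed.

Lemma h0_gauge u : in_l2 u -> h0 eh (gauge u) = gauge (h0 geh u).
Proof.
move=> su; apply/funext => x; rewrite /gauge /h0.
have s := csumm_h0 x csumm_geh su.
rewrite -[RHS]addr0; have z0 : csum (fun _ : T => 0 : C) = 0.
  by rewrite (@csum_fin _ _ fset0)// big_seq_fset0.
rewrite -z0 -csum_lin//; last first.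
  by apply: (@summ_fin _ _ fset0) => y _; rewrite /cabs cabs2_0 sqrtr0.
by congr csum; apply/funext => y; rewrite /geh dotZD expiD; ring.
Qed.

Lemma kin_gauge em u : in_l2 u -> kin eh em (gauge u) = kin geh em u.
Proof.
move=> su; rewrite /kin n2_gauge h0_gauge//; congr (_ - _).
rewrite /ip; congr rsum; apply/funext => x; rewrite /gauge.
have := cabs2_expi (dotZ x p); case: (expi (dotZ x p)) => a b; rewrite /cabs2 /= => e.
case: (h0 geh u x) (u x) => a1 b1 [a2 b2]; rewrite /ipr /=.
rewrite -[RHS]mul1r -e; ring.
Qed.
End Gauge.

(** * Quadratic bounds at the maximum of the dispersion relation *)

Section Calculus.
Variable R : realType.

Lemma mvt_bound (g dg : R -> R) (del B : R) :
  (forall x : R, `|x| <= del -> is_derive x (1 : R) g (dg x)) ->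
  forall s, `|s| <= del -> (forall x, `|x| <= `|s| -> `|dg x| <= B) ->
  `|g s - g 0| <= B * `|s|.
Proof.
move=> hg s sd hB.
have cont (a b : R) : (forall x, x \in `[a, b] -> `|x| <= del) -> {within `[a, b], continuous g}.
  move=> h; apply: derivable_within_continuous => x xab.
  by have [] := hg x (h x xab).
have [s0|s0|->] := ltgtP s 0; last by rewrite subrr !normr0 mulr0.
- have es : `|s| = - s by rewrite ltr0_norm.
  have hn x : s <= x -> x <= 0 -> `|x| <= `|s| by move=> sx x0; rewrite es ler0_norm//; lra.
  have [||c] := @MVT_segment _ g dg s 0 (ltW s0).
  + move=> x; rewrite in_itv /= => /andP[sx x0]; apply: hg.
    by apply: le_trans sd; apply: hn; exact: ltW.
  + by apply: cont => x; rewrite in_itv /= => /andP[sx x0]; apply: le_trans sd; exact: hn.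
  rewrite in_itv /= => /andP[sc c0] e.
  rewrite distrC e sub0r normrM normrN {2}es; rewrite {1}es; apply: ler_wpM2r; first lra.
  by apply: hB; exact: hn.
- have es : `|s| = s by rewrite gtr0_norm.
  have hn x : 0 <= x -> x <= s -> `|x| <= `|s| by move=> sx x0; rewrite es ger0_norm.
  have [||c] := @MVT_segment _ g dg 0 s (ltW s0).
  + move=> x; rewrite in_itv /= => /andP[sx x0]; apply: hg.
    by apply: le_trans sd; apply: hn; exact: ltW.
  + by apply: cont => x; rewrite in_itv /= => /andP[sx x0]; apply: le_trans sd; exact: hn.
  rewrite in_itv /= => /andP[sc c0] e.
  rewrite e subr0 normrM {2}es; rewrite {1}es; apply: ler_wpM2r; first lra.
  by apply: hB; exact: hn.
Qed.

Lemma is_derive_mulc (a y : R) : is_derive y (1 : R) (fun x : R => a * x) a.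
Proof.
have h := is_deriveZ a (is_derive_id y (1 : R)).
by rewrite [a *: 1](_ : _ = a) in h; [exact: h|rewrite /GRing.scale /= mulr1].
Qed.

(** The mean value bound is applied first to dg minus its affine approximation, then to g minus its
    quadratic one. The values at 0 are separate parameters so that, along a line, they can be
    written at q instead of q + 0 e. *)
Lemma taylor2 (g dg ddg : R -> R) (del A e g0 dg0 : R) : g 0 = g0 -> dg 0 = dg0 ->
  (forall x : R, `|x| <= del -> is_derive x (1 : R) g (dg x)) ->
  (forall x : R, `|x| <= del -> is_derive x (1 : R) dg (ddg x)) ->
  (forall x, `|x| <= del -> `|ddg x - A| <= e) ->
  forall s, `|s| <= del -> `|g s - g0 - dg0 * s - A / 2 * s ^+ 2| <= e * s ^+ 2.
Proof.
move=> <- <- hg hdg hA s sd.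
have h1 x : `|x| <= del -> `|dg x - dg 0 - A * x| <= e * `|x|.
  move=> xd; have := @mvt_bound (fun y => dg y - A * y) (fun y => ddg y - A) del e _ x xd.
  rewrite mulr0 subr0 addrAC; apply.
    move=> y yd; have := hdg y yd => hy.
    exact: (is_deriveB hy (is_derive_mulc A y)).
  by move=> y yx; apply: hA; exact: le_trans yx xd.
have := @mvt_bound (fun y => g y - dg 0 * y - A / 2 * y ^+ 2)
   (fun y => dg y - dg 0 - A * y) del (e * `|s|) _ s sd.
rewrite mulr0 expr0n mulr0 !subr0.
have -> : g s - dg 0 * s - A / 2 * s ^+ 2 - g 0 = g s - g 0 - dg 0 * s - A / 2 * s ^+ 2 by ring.
rewrite (_ : e * `|s| * `|s| = e * s ^+ 2); last by rewrite -mulrA -expr2 real_normK ?num_real.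
apply.
  move=> y yd; have hy := hg y yd.
  have h2 : is_derive y (1 : R) (fun y : R => y ^+ 2) (2 * y).
    rewrite (_ : (fun y => _) = (id : R -> R) * id); last by apply/funext => z; rewrite expr2.
    apply: (is_derive_eq (is_deriveM (is_derive_id y (1 : R)) (is_derive_id y (1 : R)))).
    by rewrite /GRing.scale /= mulr1; ring.
  have h3 := is_deriveZ (A / 2) h2.
  have h4 := is_derive_mulc (dg 0) y.
  apply: (is_derive_eq (is_deriveB (is_deriveB hy h4) h3)).
  by rewrite /GRing.scale /=; field.
move=> x xs; apply: le_trans (h1 x (le_trans xs sd)) _.
have e0 : 0 <= e.
  have d0 : `|0 : R| <= del by rewrite normr0; exact: le_trans (normr_ge0 _) sd.
  exact: le_trans (normr_ge0 _) (hA 0 d0).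
by rewrite ler_wpM2l.
Qed.

Lemma combine3 (F Fl F0 Dks Dk Dl Akk Akl All s t e : R) :
  `|F - Fl - Dks * s - Akk / 2 * s ^+ 2| <= e * s ^+ 2 ->
  `|Dks - Dk - Akl * t| <= e * `|t| ->
  `|Fl - F0 - Dl * t - All / 2 * t ^+ 2| <= e * t ^+ 2 ->
  `|F - F0 - Dk * s - Dl * t - (Akk / 2 * s ^+ 2 + Akl * (s * t) + All / 2 * t ^+ 2)|
   <= e * (s ^+ 2 + `|s| * `|t| + t ^+ 2).
Proof.
move=> A1 A2 A3.
have A2' : `|(Dks - Dk - Akl * t) * s| <= e * `|t| * `|s| by rewrite normrM ler_wpM2r.
set X1 := _ - _ - _ - _ in A1; set X2 := _ * s in A2'; set X3 := _ - _ - _ - _ in A3.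
rewrite (_ : _ - _ - _ - _ - _ = X1 + X2 + X3); last by rewrite /X1 /X2 /X3; ring.
have h1 := ler_normD (X1 + X2) X3; have h2 := ler_normD X1 X2; lra.
Qed.

Section Several.
Variable d : nat.
Implicit Types (f : 'rV[R]_d -> R) (p q e : 'rV[R]_d).

Lemma line_derive f q e (s : R) : derivable f (q + s *: e) e ->
  is_derive s (1 : R) (fun x => f (q + x *: e)) ('D_e f (q + s *: e)).
Proof.
have E : (fun h => h^-1 *: (((fun x => f (q + x *: e)) \o shift s) (h *: (1 : R)) - f (q + s *: e)))
  = (fun h => h^-1 *: ((f \o shift (q + s *: e)) (h *: e) - f (q + s *: e))).
  apply/funext => h /=; congr (_ *: (f _ - _)).
  by rewrite (mulr1 h : h *: (1 : R) = h) scalerDl addrCA.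
by move=> df; split; rewrite /derivable /derive E.
Qed.

Lemma taylor_line f q e (del A B : R) :
  (forall x, `|x| <= del -> [/\ derivable f (q + x *: e) e,
     derivable ('D_e f) (q + x *: e) e & `|'D_e ('D_e f) (q + x *: e) - A| <= B]) ->
  forall s, `|s| <= del ->
  `|f (q + s *: e) - f q - 'D_e f q * s - A / 2 * s ^+ 2| <= B * s ^+ 2.
Proof.
move=> h s sd; have q0 : q + (0 : R) *: e = q by rewrite scale0r addr0.
have e1 : f (q + (0 : R) *: e) = f q by congr f.
have e2 : 'D_e f (q + (0 : R) *: e) = 'D_e f q by congr ('D_e f _).
have T := @taylor2 (fun x => f (q + x *: e)) (fun x => 'D_e f (q + x *: e))
  (fun x => 'D_e ('D_e f) (q + x *: e)) del A B (f q) ('D_e f q) e1 e2.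
apply: (T _ _ _ s sd) => x xd; have [h1 h2 h3] := h x xd.
- exact: line_derive h1.
- exact: line_derive h2.
- exact: h3.
Qed.

Lemma lipschitz_line (g : 'rV[R]_d -> R) q e (del A B : R) :
  (forall x, `|x| <= del -> derivable g (q + x *: e) e /\ `|'D_e g (q + x *: e) - A| <= B) ->
  forall s, `|s| <= del -> `|g (q + s *: e) - g q - A * s| <= B * `|s|.
Proof.
move=> h s sd; have q0 : q + (0 : R) *: e = q by rewrite scale0r addr0.
have e1 : g (q + (0 : R) *: e) - A * 0 = g q by rewrite mulr0 subr0; congr g.
have T := @mvt_bound (fun x => g (q + x *: e) - A * x) (fun x => 'D_e g (q + x *: e) - A) del B.
have := T _ s sd; rewrite e1 (addrAC _ (- g q)); apply.
  by move=> x xd; have [h1 _] := h x xd; exact: (is_deriveB (line_derive h1) (is_derive_mulc _ x)).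
by move=> x xs; have [] := h x (le_trans xs sd).
Qed.

Lemma continuous_near_le (g : 'rV[R]_d -> R) p (e : R) : {for p, continuous g} -> 0 < e ->
  \forall q \near p, `|g q - g p| <= e.
Proof. by move=> c e0; have /cvgrPdistC_le := c; apply. Qed.

Lemma c2_local f p (e : R) : C2_near f p -> 0 < e -> exists2 del, 0 < del &
  forall q, (forall j, `|q 0 j| <= del) -> forall k l,
   [/\ derivable f (p + q) (ebase R k), derivable ('D_(ebase R k) f) (p + q) (ebase R l) &
      `|'D_(ebase R l) ('D_(ebase R k) f) (p + q) - 'D_(ebase R l) ('D_(ebase R k) f) p| <= e].
Proof.
move=> hC e0.
have hp := nbhs_singleton hC.
have hcont : \forall q \near p, forall k l,
  `|'D_(ebase R l) ('D_(ebase R k) f) q - 'D_(ebase R l) ('D_(ebase R k) f) p| <= e.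
  apply: (@filter_forall _ 'I_d (fun k q => forall l, `|'D_(ebase R l) ('D_(ebase R k) f) q -
     'D_(ebase R l) ('D_(ebase R k) f) p| <= e) (nbhs p) _) => k.
  apply: (@filter_forall _ 'I_d (fun l q => `|'D_(ebase R l) ('D_(ebase R k) f) q -
     'D_(ebase R l) ('D_(ebase R k) f) p| <= e) (nbhs p) _) => l.
  have [_ hk] := hp; have [_ [_ hl]] := hk k; have [_ c] := hl l.
  exact: (continuous_near_le c e0).
have [del /= d0 hdel] := (nbhs_ballP p _).1 (filterI hC hcont).
exists (del / 2); first by rewrite divr_gt0.
move=> q hq k l; have qb : ball p del (p + q).
  split => // i j; rewrite (ord1 i) /ball /= mxE opprD addNKr normrN.
  by apply: le_lt_trans (hq j) _; lra.
have [[_ hk] hc] := hdel _ qb; have [dk [_ hl]] := hk k; have [dl _] := hl l.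
by split => //; exact: hc.
Qed.

(** The displacement is made along l and then along k: a Taylor expansion on each segment, and a
    first-order expansion of the k-derivative to return it from p + t e_l to p. This order yields
    the mixed coefficient D_l D_k f. *)
Lemma expand f p k l (e : R) : C2_near f p -> 0 < e -> exists2 del, 0 < del &
  forall s t, `|s| <= del -> `|t| <= del ->
  `|f (p + t *: ebase R l + s *: ebase R k) - f p - 'D_(ebase R k) f p * s - 'D_(ebase R l) f p * t
    - ('D_(ebase R k) ('D_(ebase R k) f) p / 2 * s ^+ 2
     + 'D_(ebase R l) ('D_(ebase R k) f) p * (s * t)
     + 'D_(ebase R l) ('D_(ebase R l) f) p / 2 * t ^+ 2)|
   <= e * (s ^+ 2 + `|s| * `|t| + t ^+ 2).
Proof.
move=> hC e0; have [del d0 hdel] := c2_local hC e0.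
exists (del / 2); first by rewrite divr_gt0.
set ek := ebase R k; set el := ebase R l.
have ebl j (k' : 'I_d) : `|ebase R k' 0 j| <= 1.
  by rewrite mxE; case: (_ && _); rewrite ?normr1 ?normr0.
have hq s t : `|s| <= del / 2 -> `|t| <= del / 2 -> forall j, `|(t *: el + s *: ek) 0 j| <= del.
  move=> sd td j; rewrite !mxE; apply: le_trans (ler_normD _ _) _; rewrite !normrM.
  have h1 : `|t| * `|el 0 j| <= `|t| by rewrite ler_piMr// ebl.
  have h2 : `|s| * `|ek 0 j| <= `|s| by rewrite ler_piMr// ebl.
  by move: h1 h2; rewrite !mxE => h1 h2; lra.
have z0 : `|0 : R| <= del / 2 by rewrite normr0 divr_ge0// ltW.
move=> s t sd td.
have hqt x : `|x| <= del / 2 -> forall j, `|(x *: el) 0 j| <= del.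
  by move=> xd j; have := hq 0 x z0 xd j; rewrite scale0r addr0.
have A1 : `|f (p + t *: el + s *: ek) - f (p + t *: el) - 'D_ek f (p + t *: el) * s
     - 'D_ek ('D_ek f) p / 2 * s ^+ 2| <= e * s ^+ 2.
  apply: (@taylor_line f (p + t *: el) ek (del / 2) _ e _ s sd) => x xd.
  have [h1 h2 h3] := hdel _ (hq x t xd td) k k.
  rewrite (addrA p) in h1 h2 h3; split; [exact: h1|exact: h2|exact: h3].
have A2 : `|'D_ek f (p + t *: el) - 'D_ek f p - 'D_el ('D_ek f) p * t| <= e * `|t|.
  apply: (@lipschitz_line ('D_ek f) p el (del / 2) _ e _ t td) => x xd.
  have [h1 h2 h3] := hdel _ (hqt x xd) k l; split; [exact: h2|exact: h3].
have A3 : `|f (p + t *: el) - f p - 'D_el f p * t - 'D_el ('D_el f) p / 2 * t ^+ 2| <= e * t ^+ 2.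
  apply: (@taylor_line f p el (del / 2) _ e _ t td) => x xd.
  have [h1 h2 h3] := hdel _ (hqt x xd) l l; split; [exact: h1|exact: h2|exact: h3].
exact: (combine3 A1 A2 A3).
Qed.
End Several.
End Calculus.

(** * Second-order behaviour at a maximum *)

Section Quadratic.
Variable R : realType.

Lemma grad_zero (D K del : R) : 0 < del -> (forall s, `|s| <= del -> D * s <= K * s ^+ 2) -> D = 0.
Proof.
move=> d0 h; apply/eqP; apply/negP => /negP D0.
have nD : 0 < `|D| by rewrite normr_gt0.
have K0 := normr_ge0 K; have K1 := ler_norm K.
(* At s = D tau the hypothesis reads D^2 tau <= K D^2 tau^2, hence K tau >= 1, while this tau keeps
   K tau <= 1/2. *)
pose tau := Num.min (del / `|D|) (2 * (`|K| + 1))^-1.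
have t0 : 0 < tau by rewrite lt_min divr_gt0//= invr_gt0; lra.
have h1 : `|D * tau| <= del.
  rewrite normrM (gtr0_norm t0) mulrC -ler_pdivlMr//.
  by rewrite ge_min lexx.
have h2 : tau * (2 * (`|K| + 1)) <= 1.
  rewrite -ler_pdivlMr ?mul1r; [by rewrite ge_min lexx orbT|lra].
have := h _ h1; rewrite exprMn.
have D2 : 0 < D ^+ 2 by rewrite lt_def sqrf_eq0 D0 sqr_ge0.
have -> : D * (D * tau) = D ^+ 2 * tau by ring.
have -> : K * (D ^+ 2 * tau ^+ 2) = D ^+ 2 * tau * (K * tau) by ring.
have D2t : 0 < D ^+ 2 * tau by exact: mulr_gt0.
rewrite -[leLHS]mulr1 ler_pM2l// => h3.
have h4 : K * tau <= (`|K| + 1) * tau by rewrite ler_wpM2r ?(ltW t0)//; lra.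
lra.
Qed.

Lemma quad1 (F : R -> R) (F0 A D : R) :
  (forall e, 0 < e -> exists2 del, 0 < del & forall s, `|s| <= del ->
     `|F s - F0 - D * s - A / 2 * s ^+ 2| <= e * s ^+ 2) ->
  (forall s, F s <= F0) -> A != 0 ->
  exists2 del : R, 0 < del & exists2 c : R, 0 < c & exists C : R, forall s, `|s| <= del ->
    c * s ^+ 2 <= F0 - F s <= C * s ^+ 2.
Proof.
move=> h hF A0; have nA : 0 < `|A| by rewrite normr_gt0.
(* An error of |A| / 4 absorbs half of the leading coefficient |A| / 2. *)
have A4 : 0 < `|A| / 4 by lra.
have D0 : D = 0.
  have [del d0 hd] := h 1 ltr01; apply: (@grad_zero D (1 - A / 2) del d0) => s sd.
  have := hF s; have := hd s sd; rewrite ler_norml => /andP[h1 _] h2; lra.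
have A1 : A < 0.
  rewrite lt_neqAle A0 /=; have [del d0 hd] := h (`|A| / 4) A4.
  have := hd del; rewrite gtr0_norm// lexx => /(_ isT); rewrite D0 mul0r subr0 ler_norml => /andP[h1 _].
  have d2 : 0 < del ^+ 2 by rewrite exprn_gt0.
  have : (A / 2 - `|A| / 4) * del ^+ 2 <= 0 by have := hF del; lra.
  rewrite pmulr_lle0// => h2; have := ler_norm A; have [//|A2] := leP A 0.
  by rewrite (gtr0_norm A2) in h2; lra.
have [del d0 hd] := h (`|A| / 4) A4.
exists del => //; exists (`|A| / 4); first lra.
exists `|A| => s sd; have := hd s sd; rewrite D0 mul0r subr0 (ltr0_norm A1) ler_norml.
move=> /andP[h1 h2]; have s2 := sqr_ge0 s.
have s3 : 0 <= - A * s ^+ 2 by rewrite mulr_ge0//; lra.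
by apply/andP; split; lra.
Qed.

Definition quad_form (a b c s t : R) := a / 2 * s ^+ 2 + b * (s * t) + c / 2 * t ^+ 2.

Lemma quad_definite (a b c : R) : (forall s t, quad_form a b c s t <= 0) -> a * c - b * b != 0 ->
  exists2 l, 0 < l & forall s t, l * (s ^+ 2 + t ^+ 2) <= - (2 * quad_form a b c s t).
Proof.
rewrite /quad_form => Q0 det.
have a0 : a <= 0 by have := Q0 1 0; lra.
have c0 : c < 0.
  have c1 : c <= 0 by have := Q0 0 1; lra.
  rewrite lt_neqAle c1 andbT; apply/negP => /eqP e.
  have b0 : b != 0 by apply: contra det => /eqP ->; rewrite e mulr0 mul0r subr0.
  (* If c = 0 and b is nonzero, the form at this point is a/2 + |a| + 1 > 0. *)
  have := Q0 1 ((`|a| + 1) / b); rewrite e.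
  have -> : b * (1 * ((`|a| + 1) / b)) = `|a| + 1 by field.
  have := ler_norm (- a); rewrite normrN; have := normr_ge0 a; lra.
have dp : 0 < a * c - b * b.
  rewrite lt_def det /=; have := Q0 c (- b).
  have -> : a / 2 * c ^+ 2 + b * (c * - b) + c / 2 * (- b) ^+ 2 = c / 2 * (a * c - b * b) by field.
  by rewrite nmulr_rle0//; lra.
pose A := - a; pose C := - c.
have C0 : 0 < C by rewrite /C; lra.
have A0 : 0 < A.
  have : 0 < A * C by rewrite /A /C; have := sqr_ge0 b; rewrite expr2; lra.
  by rewrite pmulr_lgt0.
have AC : 0 < A + C by rewrite addr_gt0.
(* Determinant over trace, a lower bound for the smallest eigenvalue of the positive matrix with
   diagonal A, C. *)
pose l := (A * C - b * b) / (A + C).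
have l0 : 0 < l by rewrite divr_gt0// /A /C; lra.
have Al : 0 < A - l.
  have -> : A - l = (A ^+ 2 + b ^+ 2) / (A + C) by rewrite /l; field; rewrite gt_eqF.
  by rewrite divr_gt0// ltr_wpDr ?sqr_ge0// exprn_gt0.
exists l => // s t.
(* Multiplying by A - l completes the square, and the matrix shifted by l has determinant l^2. *)
rewrite -subr_ge0 -(pmulr_rge0 _ Al).
have e : l * (A + C) = A * C - b * b by rewrite /l divfK// gt_eqF.
have e2 : l ^+ 2 = (A - l) * (C - l) - b * b.
  have -> : (A - l) * (C - l) - b * b = A * C - b * b - l * (A + C) + l ^+ 2 by ring.
  by rewrite e subrr add0r.
set X := (A - l) * _.
have -> : X = ((A - l) * s - b * t) ^+ 2 + l ^+ 2 * t ^+ 2 by rewrite /X e2 /A /C; field.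
by rewrite addr_ge0 ?sqr_ge0// mulr_ge0 ?sqr_ge0.
Qed.

Lemma scale_small (s t del : R) : 0 < del -> exists2 l : R, 0 < l & `|l * s| <= del /\ `|l * t| <= del.
Proof.
move=> d0; have ns := normr_ge0 s; have nt := normr_ge0 t.
pose l := del / (`|s| + `|t| + 1); have l0 : 0 < l by rewrite divr_gt0//; lra.
have lE : l * (`|s| + `|t| + 1) = del by rewrite /l divfK// gt_eqF//; lra.
by exists l => //; split; rewrite normrM (gtr0_norm l0) -lE ler_pM2l//; lra.
Qed.

(** Homogeneity: scaling (s, t) into the small square multiplies the form and the error by the same
    l^2. *)
Lemma quad_nonpos (F : R -> R -> R) (F0 a b c : R) :
  (forall e, 0 < e -> exists2 del, 0 < del & forall s t, `|s| <= del -> `|t| <= del ->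
     `|F s t - F0 - quad_form a b c s t| <= e * (s ^+ 2 + `|s| * `|t| + t ^+ 2)) ->
  (forall s t, F s t <= F0) -> forall s t, quad_form a b c s t <= 0.
Proof.
move=> h hF s t; apply/ler_addgt0Pl => e e0; rewrite addr0.
set W := s ^+ 2 + `|s| * `|t| + t ^+ 2.
have W0 : 0 <= W by rewrite !addr_ge0 ?sqr_ge0 ?mulr_ge0.
have W1 : 0 < W + 1 by rewrite ltr_wpDl.
have [del d0 hd] := h _ (divr_gt0 e0 W1).
have [l l0 [ls lt]] := scale_small s t d0.
have nls : `|l * s| = l * `|s| by rewrite normrM (gtr0_norm l0).
have nlt : `|l * t| = l * `|t| by rewrite normrM (gtr0_norm l0).
have := hd _ _ ls lt; rewrite nls nlt ler_norml => /andP[g1 _].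
have l2 : 0 < l ^+ 2 by rewrite exprn_gt0.
have g2 := hF (l * s) (l * t).
have E1 : quad_form a b c (l * s) (l * t) = l ^+ 2 * quad_form a b c s t by rewrite /quad_form; ring.
have E2 : e / (W + 1) * ((l * s) ^+ 2 + l * `|s| * (l * `|t|) + (l * t) ^+ 2) =
   l ^+ 2 * (e / (W + 1) * W) by rewrite /W; ring.
rewrite E1 E2 in g1.
have g3 : l ^+ 2 * quad_form a b c s t <= l ^+ 2 * (e / (W + 1) * W) by clear -g1 g2; lra.
rewrite ler_pM2l// in g3; apply: le_trans g3 _.
by rewrite -mulrA ler_piMr ?(ltW e0)// mulrC ler_pdivrMr// mul1r lerDl.
Qed.

(** Equality of mixed derivatives: on the diagonal s = t the two expansions differ by (b - b') s^2,
    and each error is at most 3 (e / 6) s^2. *)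
Lemma quad_mixed_eq (F : R -> R -> R) (F0 a b b' c : R) :
  (forall e, 0 < e -> exists2 del, 0 < del & forall s t, `|s| <= del -> `|t| <= del ->
     `|F s t - F0 - quad_form a b c s t| <= e * (s ^+ 2 + `|s| * `|t| + t ^+ 2)) ->
  (forall e, 0 < e -> exists2 del, 0 < del & forall s t, `|s| <= del -> `|t| <= del ->
     `|F s t - F0 - quad_form a b' c s t| <= e * (s ^+ 2 + `|s| * `|t| + t ^+ 2)) -> b = b'.
Proof.
move=> h h'; apply/eqP; rewrite -subr_eq0 -normr_le0; apply/ler_addgt0Pl => e e0; rewrite addr0.
have e6 : 0 < e / 6 by lra.
have [d1 d10 hd1] := h _ e6; have [d2 d20 hd2] := h' _ e6.
pose s := Num.min d1 d2; have s0 : 0 < s by rewrite lt_min d10.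
have n0 : `|s| = s by rewrite gtr0_norm.
have sd1 : `|s| <= d1 by rewrite n0 ge_min lexx.
have sd2 : `|s| <= d2 by rewrite n0 ge_min lexx orbT.
have s2 : 0 < s ^+ 2 by rewrite exprn_gt0.
have h1 := hd1 s s sd1 sd1; have h2 := hd2 s s sd2 sd2; rewrite n0 -expr2 in h1 h2.
have h3 : `|(b - b') * s ^+ 2| <= e * s ^+ 2.
  have -> : (b - b') * s ^+ 2 = (F s s - F0 - quad_form a b' c s s) - (F s s - F0 - quad_form a b c s s).
    by rewrite /quad_form; ring.
  by apply: le_trans (ler_normB _ _) _; clear -h1 h2; lra.
by rewrite normrM (gtr0_norm s2) ler_pM2r in h3.
Qed.

(** b and b' are the mixed derivatives in the two orders, both present in the Hessian determinant.
    The gradient vanishes at the maximum, which makes the two expansions comparable. *)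
Lemma quad2 (F : R -> R -> R) (F0 a b b' c D0 D1 : R) :
  (forall e, 0 < e -> exists2 del, 0 < del & forall s t, `|s| <= del -> `|t| <= del ->
     `|F s t - F0 - D0 * s - D1 * t - quad_form a b c s t| <= e * (s ^+ 2 + `|s| * `|t| + t ^+ 2)) ->
  (forall e, 0 < e -> exists2 del, 0 < del & forall s t, `|s| <= del -> `|t| <= del ->
     `|F s t - F0 - D0 * s - D1 * t - quad_form a b' c s t| <= e * (s ^+ 2 + `|s| * `|t| + t ^+ 2)) ->
  (forall s t, F s t <= F0) -> a * c - b * b' != 0 ->
  exists2 del : R, 0 < del & exists2 l : R, 0 < l & exists C : R,
    forall s t, `|s| <= del -> `|t| <= del ->
    l * (s ^+ 2 + t ^+ 2) <= F0 - F s t <= C * (s ^+ 2 + t ^+ 2).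
Proof.
move=> h h' hF.
have D00 : D0 = 0.
  have [del d0 hd] := h 1 ltr01; apply: (@grad_zero D0 (1 - a / 2) del d0) => s sd.
  have := hF s 0; have := hd s 0 sd; rewrite normr0 => /(_ (ltW d0)).
  rewrite /quad_form ler_norml => /andP[h1 _] h2; lra.
have D10 : D1 = 0.
  have [del d0 hd] := h 1 ltr01; apply: (@grad_zero D1 (1 - c / 2) del d0) => s sd.
  have := hF 0 s; have := hd 0 s; rewrite normr0 => /(_ (ltW d0) sd).
  rewrite /quad_form ler_norml => /andP[h1 _] h2; lra.
have clean bb : (forall e, 0 < e -> exists2 del, 0 < del & forall s t, `|s| <= del -> `|t| <= del ->
     `|F s t - F0 - D0 * s - D1 * t - quad_form a bb c s t| <= e * (s ^+ 2 + `|s| * `|t| + t ^+ 2)) ->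
  (forall e, 0 < e -> exists2 del, 0 < del & forall s t, `|s| <= del -> `|t| <= del ->
     `|F s t - F0 - quad_form a bb c s t| <= e * (s ^+ 2 + `|s| * `|t| + t ^+ 2)).
  move=> hh e e0; have [del d0 hd] := hh e e0; exists del => // s t sd td.
  by have := hd s t sd td; rewrite D00 D10 !mul0r !(subr0 (F s t - F0)).
have k := clean b h; have k' := clean b' h'.
rewrite -(quad_mixed_eq k k') => det.
have [l l0 Ql] := quad_definite (quad_nonpos k hF) det.
(* As |s| |t| <= (s^2 + t^2) / 2, an error with constant l/6 is at most l/4 (s^2 + t^2), half of
   what definiteness provides. *)
have l6 : 0 < l / 6 by lra.
have [del d0 hd] := k _ l6.
exists del => //; exists (l / 4); first lra.
exists (`|a| + `|b| + `|c| + l) => s t sd td; have := hd s t sd td; have := Ql s t.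
have st : `|s| * `|t| <= (s ^+ 2 + t ^+ 2) / 2.
  have := sqr_ge0 (`|s| - `|t|); rewrite sqrrB !real_normK ?num_real//; clear; lra.
have lst : l / 6 * (s ^+ 2 + `|s| * `|t| + t ^+ 2) <= l / 4 * (s ^+ 2 + t ^+ 2).
  have -> : l / 4 * (s ^+ 2 + t ^+ 2) = l / 6 * (3 / 2 * (s ^+ 2 + t ^+ 2)) by field.
  by rewrite ler_pM2l//; clear -st; lra.
have s2 := sqr_ge0 s; have t2 := sqr_ge0 t.
have st0 : 0 <= s ^+ 2 + t ^+ 2 by rewrite addr_ge0.
have Qup : - quad_form a b c s t <= (`|a| + `|b| + `|c|) * (s ^+ 2 + t ^+ 2).
  apply: le_trans (ler_norm _) _; rewrite normrN /quad_form.
  apply: le_trans (ler_normD _ _) _; apply: le_trans (lerD (ler_normD _ _) (lexx _)) _.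
  have n2 : `|2 : R| = 2 by rewrite ger0_norm.
  have ea : `|a / 2 * s ^+ 2| = `|a| / 2 * s ^+ 2 by rewrite normrM (ger0_norm s2) normrM normfV n2.
  have ec : `|c / 2 * t ^+ 2| = `|c| / 2 * t ^+ 2 by rewrite normrM (ger0_norm t2) normrM normfV n2.
  have eb : `|b * (s * t)| = `|b| * (`|s| * `|t|) by rewrite normrM normrM.
  rewrite ea eb ec.
  have ha : `|a| / 2 * s ^+ 2 <= `|a| * (s ^+ 2 + t ^+ 2).
    by rewrite -mulrA ler_wpM2l//; clear -s2 t2; lra.
  have hb : `|b| * (`|s| * `|t|) <= `|b| * (s ^+ 2 + t ^+ 2).
    by rewrite ler_wpM2l//; clear -st st0; lra.
  have hc : `|c| / 2 * t ^+ 2 <= `|c| * (s ^+ 2 + t ^+ 2).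
    by rewrite -mulrA ler_wpM2l//; clear -s2 t2; lra.
  by clear -ha hb hc; lra.
have lp : 0 <= l * (s ^+ 2 + t ^+ 2) by rewrite mulr_ge0// ltW.
rewrite ler_norml => hq /andP[g1 g2].
by clear -hq g1 g2 Qup lst lp; apply/andP; split; lra.
Qed.
Lemma expand_swap (F F0 Dk Dl Akk Akl All s t e : R) :
  `|F - F0 - Dk * s - Dl * t - (Akk / 2 * s ^+ 2 + Akl * (s * t) + All / 2 * t ^+ 2)|
   <= e * (s ^+ 2 + `|s| * `|t| + t ^+ 2) ->
  `|F - F0 - Dl * t - Dk * s - quad_form All Akl Akk t s| <= e * (t ^+ 2 + `|t| * `|s| + s ^+ 2).
Proof.
have -> : F - F0 - Dl * t - Dk * s - quad_form All Akl Akk t s =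
  F - F0 - Dk * s - Dl * t - (Akk / 2 * s ^+ 2 + Akl * (s * t) + All / 2 * t ^+ 2).
  by rewrite /quad_form; ring.
by have -> : t ^+ 2 + `|t| * `|s| + s ^+ 2 = s ^+ 2 + `|s| * `|t| + t ^+ 2 by ring.
Qed.
(** [sg] will be 1 at the maximum and -1 at the minimum, so both ends share one local analysis of
    the same function. *)
Lemma expand_sign (sg F F0 D0 D1 a b c s t B : R) : `|sg| = 1 ->
  `|F - F0 - D0 * s - D1 * t - quad_form a b c s t| <= B ->
  `|sg * F - sg * F0 - sg * D0 * s - sg * D1 * t - quad_form (sg * a) (sg * b) (sg * c) s t| <= B.
Proof.
move=> hs; set X := (X in `|X| <= _ -> _) => h; set Y := (Y in `|Y| <= _).
have -> : Y = sg * X by rewrite /X /Y /quad_form; ring.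
by rewrite normrM hs mul1r.
Qed.
End Quadratic.

(** * From local to global quadratic bounds *)

Section Global.
Variables (R : realType) (d : nat).
Implicit Types (f : 'rV[R]_d -> R) (p t : 'rV[R]_d).

Lemma continuous_sumsq : continuous (fun t : 'rV[R]_d => \sum_k t 0 k ^+ 2 : R).
Proof.
have h (r : seq 'I_d) : continuous (fun t : 'rV[R]_d => \sum_(k <- r) t 0 k ^+ 2 : R).
  elim: r => [|k r IH] t.
    rewrite (_ : (fun t : 'rV[R]_d => _) = fun=> 0); first exact: cst_continuous.
    by apply/funext => u; rewrite big_nil.
  rewrite (_ : (fun t : 'rV[R]_d => _) = fun u => u 0 k * u 0 k + \sum_(j <- r) u 0 j ^+ 2).
    apply: (@continuousD R R^o 'rV[R]_d (fun u => u 0 k * u 0 k : R^o)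
      (fun u => \sum_(j <- r) u 0 j ^+ 2) t); last exact: IH.
    by apply: (@continuousM R 'rV[R]_d (fun u => u 0 k) (fun u => u 0 k) t); exact: coord_continuous.
  by apply/funext => u; rewrite big_cons expr2.
exact: h.
Qed.

(** Away from the origin the gap f p - f (p + t) is continuous and positive on a compact set, so it
    lies between positive constants there, and so does |t|^2. *)
Lemma global_bounds f p (del c C : R) : continuous f ->
  (forall t, (forall k, `|t 0 k| <= pi) -> t != 0 -> f (p + t) < f p) ->
  0 < del -> 0 < c ->
  (forall t, (forall k, `|t 0 k| <= del) ->
    c * \sum_k t 0 k ^+ 2 <= f p - f (p + t) <= C * \sum_k t 0 k ^+ 2) ->
  exists2 c' : R, 0 < c' & exists C' : R, forall t, (forall k, `|t 0 k| <= pi) ->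
    c' * \sum_k t 0 k ^+ 2 <= f p - f (p + t) <= C' * \sum_k t 0 k ^+ 2.
Proof.
move=> cf hmax del0 c0 hloc.
pose S t : R := \sum_k t 0 k ^+ 2.
have S0 t : 0 <= S t by apply: sumr_ge0 => k _; exact: sqr_ge0.
have Slow t k : `|t 0 k| ^+ 2 <= S t.
  by rewrite real_normK ?num_real// /S (bigD1 k)//= lerDl sumr_ge0// => ? _; exact: sqr_ge0.
pose A := [set t : 'rV[R]_d | forall k, `[- pi, pi]%classic (t ord0 k)] `&` [set t | del ^+ 2 <= S t].
have inA t : (forall k, `|t 0 k| <= pi) -> del ^+ 2 <= S t -> A t.
  by move=> h1 h2; split => // k; rewrite /= in_itv /= -ler_norml; exact: h1.
have cA : compact A.
  apply: compact_closedI.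
    exact: (@rV_compact R d (fun=> `[- pi, pi]%classic) (fun=> @segment_compact R _ _)).
  rewrite (_ : [set t | _] = S @^-1` [set x | del ^+ 2 <= x])//.
  by apply: closed_comp; [move=> t _; exact: continuous_sumsq|exact: closed_ge].
pose g t := f p - f (p + t).
have cg : {within A, continuous g}.
  apply: continuous_subspaceT => t.
  apply: (@continuousB R R^o 'rV[R]_d (fun=> f p) (fun u => f (p + u)) t); first exact: cst_continuous.
  apply: (@continuous_comp _ _ _ (fun u : 'rV[R]_d => p + u) f t); last exact: cf.
  apply: (@continuousD R 'rV[R]_d 'rV[R]_d (fun=> p) id t); first exact: cst_continuous.
  exact: cvg_id.
have small t : S t < del ^+ 2 -> forall k, `|t 0 k| <= del.
  move=> h k; rewrite -(@ler_pXn2r _ 2)// ?nnegrE ?(ltW del0)//.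
  exact: le_trans (Slow t k) (ltW h).
(* For a large radius the set [A] is empty, and the local bounds already cover the cube. *)
have [A0|/set0P/negP/negPn/eqP A0] := pselect (A !=set0); last first.
  exists c => //; exists C => t ht; apply: hloc; apply: small.
  by rewrite ltNge; apply/negP => /(inA t ht); rewrite A0.
have [t1 /set_mem [b1 s1] m1] := compact_EVT_min A0 cA cg.
have [t2 /set_mem [b2 s2] m2] := compact_EVT_max A0 cA cg.
have d2 : 0 < del ^+ 2 by rewrite exprn_gt0.
have g1 : 0 < g t1.
  rewrite subr_gt0; apply: hmax.
    by move=> k; have := b1 k; rewrite /= in_itv /= ler_norml.
  apply/negP => /eqP t10; move: s1; rewrite /= t10 /S big1; first by rewrite leNgt d2.
  by move=> k _; rewrite mxE expr0n.
pose M : R := d%:R * pi ^+ 2 + 1.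
have M0 : 0 < M by rewrite ltr_wpDl// mulr_ge0// sqr_ge0.
have SM t : (forall k, `|t 0 k| <= pi) -> S t <= M.
  move=> ht; apply: (@le_trans _ _ (\sum_(k < d) pi ^+ 2)).
    apply: ler_sum => k _; rewrite -[leLHS]real_normK ?num_real//.
    by rewrite ler_pXn2r ?nnegrE ?pi_ge0.
  by rewrite sumr_const card_ord -[_ *+ d]mulr_natl /M; lra.
exists (Num.min c (g t1 / M)); first by rewrite lt_min c0 divr_gt0.
exists (Num.max C (`|g t2| / del ^+ 2)) => t ht; rewrite -/(S t) -/(g t).
have [big|/small/hloc] := leP (del ^+ 2) (S t).
  have At := inA t ht big; have h1 := m1 t (mem_set At); have h2 := m2 t (mem_set At).
  apply/andP; split.
    apply: le_trans h1; apply: (@le_trans _ _ (g t1 / M * S t)).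
      by rewrite ler_wpM2r// ge_min lexx orbT.
    by rewrite mulrAC ler_pdivrMr// ler_pM2l//; exact: SM.
  apply: (@le_trans _ _ (`|g t2| / del ^+ 2 * S t)); last first.
    by rewrite ler_wpM2r// le_max lexx orbT.
  apply: le_trans h2 _; apply: le_trans (ler_norm _) _.
  by rewrite mulrAC ler_pdivlMr// ler_wpM2l.
rewrite -/(S t) -/(g t) => /andP[h1 h2]; apply/andP; split.
  by apply: le_trans h1; rewrite ler_wpM2r// ge_min lexx.
by apply: le_trans h2 _; rewrite ler_wpM2r// le_max lexx.
Qed.
End Global.

Lemma local_bounds1 (R : realType) (sg : R) (f : 'rV[R]_1 -> R) (p : 'rV[R]_1) : `|sg| = 1 ->
  C2_near f p -> nondegenerate_at f p -> (forall q, sg * f q <= sg * f p) ->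
  exists2 del : R, 0 < del & exists2 c : R, 0 < c & exists C : R,
  forall t : 'rV[R]_1, (forall k, `|t 0 k| <= del) ->
    c * \sum_k t 0 k ^+ 2 <= sg * f p - sg * f (p + t) <= C * \sum_k t 0 k ^+ 2.
Proof.
move=> hs hC; rewrite /nondegenerate_at det_mx11 mxE => nd hmax.
have sg0 : sg != 0 by rewrite -normr_eq0 hs oner_eq0.
have [||del d0 [c c0 [C hc]]] := @quad1 R (fun s => sg * f (p + s *: ebase R 0)) (sg * f p)
   (sg * 'D_(ebase R 0) ('D_(ebase R 0) f) p) (sg * 'D_(ebase R 0) f p) _ _ (mulf_neq0 sg0 nd).
- move=> e ep; have [del d0 hd] := expand 0 0 hC ep.
  exists del; first exact: d0.
  have z0 : `|0 : R| <= del by rewrite normr0 ltW.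
  move=> s sd; have := expand_sign hs (hd s 0 sd z0).
  rewrite /quad_form !mulr0 expr0n !mulr0 !addr0 subr0 normr0 mulr0 addr0.
  by rewrite (_ : p + 0 *: ebase R 0 + s *: ebase R 0 = p + s *: ebase R 0) ?scale0r ?addr0.
- by move=> s; exact: hmax.
exists del; first exact: d0.
exists c; first exact: c0.
exists C => t ht; have S1 : \sum_k t 0 k ^+ 2 = t 0 0 ^+ 2.
  by rewrite big_ord1; congr (t _ _ ^+ 2); exact: val_inj.
have E : p + t = p + t 0 0 *: ebase R 0.
  by congr (p + _); apply/rowP => k; rewrite (ord1 k) !mxE !eqxx mulr1.
have := hc _ (ht 0); rewrite -E -S1; exact.
Qed.

Lemma det2 (R : comNzRingType) (M : 'M[R]_2) : \det M = M 0 0 * M 1 1 - M 0 1 * M 1 0.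
Proof.
rewrite (expand_det_row _ ord0) !big_ord_recl big_ord0 addr0 /cofactor !det_mx11 !mxE /=.
rewrite expr0 mul1r expr1 mulN1r mulrN.
by congr (M _ _ * M _ _ - M _ _ * M _ _); apply: val_inj.
Qed.

Lemma sign_det (R : comNzRingType) (sg a b c d : R) : sg * sg = 1 -> a * d - b * c != 0 ->
  (sg * a) * (sg * d) - (sg * b) * (sg * c) != 0.
Proof.
move=> e; have -> : sg * a * (sg * d) - sg * b * (sg * c) = sg * sg * (a * d - b * c) by ring.
by rewrite e mul1r.
Qed.

Lemma rV2_decomp (R : realType) (t : 'rV[R]_2) : t = t 0 1 *: ebase R 1 + t 0 0 *: ebase R 0.
Proof.
apply/rowP => k; rewrite !mxE.
have : (k == 0) || (k == 1) by case: k => [[|[|]]].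
by case/orP => /eqP -> /=; rewrite !mulr0 !mulr1 ?addr0 ?add0r.
Qed.

Lemma local_bounds2 (R : realType) (sg : R) (f : 'rV[R]_2 -> R) (p : 'rV[R]_2) : `|sg| = 1 ->
  C2_near f p -> nondegenerate_at f p -> (forall q, sg * f q <= sg * f p) ->
  exists2 del : R, 0 < del & exists2 c : R, 0 < c & exists C : R,
  forall t : 'rV[R]_2, (forall k, `|t 0 k| <= del) ->
    c * \sum_k t 0 k ^+ 2 <= sg * f p - sg * f (p + t) <= C * \sum_k t 0 k ^+ 2.
Proof.
move=> hs hC; rewrite /nondegenerate_at det2 !mxE => nd hmax.
have sg2 : sg * sg = 1 by rewrite -expr2 -[LHS]real_normK ?num_real// hs expr1n.
have nd' : (sg * 'D_(ebase R 0) ('D_(ebase R 0) f) p) * (sg * 'D_(ebase R 1) ('D_(ebase R 1) f) p)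
  - (sg * 'D_(ebase R 1) ('D_(ebase R 0) f) p) * (sg * 'D_(ebase R 0) ('D_(ebase R 1) f) p) != 0.
  exact: sign_det sg2 nd.
have [|||del d0 [c c0 [C hc]]] := @quad2 R (fun s t => sg * f (p + t *: ebase R 1 + s *: ebase R 0))
  (sg * f p) _ _ _ _ (sg * 'D_(ebase R 0) f p) (sg * 'D_(ebase R 1) f p) _ _ _ nd'.
- move=> e ep; have [del d0 hd] := expand 0 1 hC ep.
  exists del; first exact: d0.
  move=> s t sd td; exact: expand_sign hs (hd s t sd td).
- move=> e ep; have [del d0 hd] := expand 1 0 hC ep.
  exists del; first exact: d0.
  move=> s t sd td; have h := expand_swap (hd t s td sd).
  rewrite (addrAC p) in h; exact: expand_sign hs h.
- by move=> s t; exact: hmax.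
exists del; first exact: d0.
exists c; first exact: c0.
exists C => t ht.
have S2 : \sum_k t 0 k ^+ 2 = t 0 0 ^+ 2 + t 0 1 ^+ 2.
  rewrite big_ord_recl big_ord1; congr (t _ _ ^+ 2 + t _ _ ^+ 2); exact: val_inj.
have E : p + t = p + t 0 1 *: ebase R 1 + t 0 0 *: ebase R 0 by rewrite -addrA -rV2_decomp.
have := hc _ _ (ht 0) (ht 1); rewrite -E -S2; exact.
Qed.

(** * Continuity and periodicity of the dispersion relation *)

Section Dispersion.
Variables (R : realType) (d : nat).
Local Notation T := (Zd d).
Local Notation C := R[i].
Variable eh : T -> C.
Hypothesis se : csumm eh.

Lemma dotZ_continuous (x : T) : continuous (fun t : 'rV[R]_d => dotZ x t).
Proof.
have h (r : seq 'I_d) : continuous (fun t : 'rV[R]_d => \sum_(k <- r) (x 0 k)%:~R * t 0 k : R).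
  elim: r => [|k r IH] t.
    rewrite (_ : (fun t : 'rV[R]_d => _) = fun=> 0); first exact: cst_continuous.
    by apply/funext => u; rewrite big_nil.
  rewrite (_ : (fun t : 'rV[R]_d => _) = fun u => (x 0 k)%:~R * u 0 k + \sum_(j <- r) (x 0 j)%:~R * u 0 j).
    apply: (@continuousD R R^o 'rV[R]_d (fun u => (x 0 k)%:~R * u 0 k : R^o)
      (fun u => \sum_(j <- r) (x 0 j)%:~R * u 0 j) t); last exact: IH.
    apply: (@continuousM R 'rV[R]_d (fun=> (x 0 k)%:~R) (fun u => u 0 k) t); first exact: cst_continuous.
    exact: coord_continuous.
  by apply/funext => u; rewrite big_cons.
exact: h.
Qed.

Lemma Re_sum_continuous (S : {fset T}) :
  continuous (fun t : 'rV[R]_d => complex.Re (\sum_(y <- S) eh y * expi (dotZ y t)) : R).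
Proof.
have E (t : 'rV[R]_d) : complex.Re (\sum_(y <- S) eh y * expi (dotZ y t)) =
  \sum_(y <- S) (complex.Re (eh y) * cos (dotZ y t) + - complex.Im (eh y) * sin (dotZ y t)).
  by rewrite Re_sum; apply: eq_bigr => y _; case: (eh y) => a b /=; rewrite mulNr.
rewrite (_ : (fun t => _) = fun t => \sum_(y <- S) (complex.Re (eh y) * cos (dotZ y t) +
   - complex.Im (eh y) * sin (dotZ y t))); last by apply/funext.
elim: (enum_fset S) => [|y r IH] t.
  rewrite (_ : (fun t : 'rV[R]_d => _) = fun=> 0); first exact: cst_continuous.
  by apply/funext => u; rewrite big_nil.
pose g (u : 'rV[R]_d) : R := complex.Re (eh y) * cos (dotZ y u) + - complex.Im (eh y) * sin (dotZ y u).
rewrite (_ : (fun t : 'rV[R]_d => _) = fun u => g u + \sum_(y <- r) (complex.Re (eh y) * cos (dotZ y u) +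
   - complex.Im (eh y) * sin (dotZ y u))); last by apply/funext => u; rewrite big_cons.
apply: (@continuousD R R^o 'rV[R]_d g _ t); last exact: IH.
have ct : {for t, continuous (fun u : 'rV[R]_d => cos (dotZ y u))}.
  apply: (@continuous_comp _ _ _ (fun u : 'rV[R]_d => dotZ y u) (@cos R) t).
    exact: dotZ_continuous.
  exact: continuous_cos.
have st : {for t, continuous (fun u : 'rV[R]_d => sin (dotZ y u))}.
  apply: (@continuous_comp _ _ _ (fun u : 'rV[R]_d => dotZ y u) (@sin R) t).
    exact: dotZ_continuous.
  exact: continuous_sin.
apply: (@continuousD R R^o 'rV[R]_d (fun u => complex.Re (eh y) * cos (dotZ y u) : R^o)
  (fun u => - complex.Im (eh y) * sin (dotZ y u)) t).
  by apply: (@continuousM R 'rV[R]_d (fun=> complex.Re (eh y)) _ t); first exact: cst_continuous.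
by apply: (@continuousM R 'rV[R]_d (fun=> - complex.Im (eh y)) _ t); first exact: cst_continuous.
Qed.

Lemma continuous_of_near (g : 'rV[R]_d -> R) (t : 'rV[R]_d) :
  (forall e, 0 < e -> \forall u \near t, `|g t - g u| < e) -> {for t, continuous g}.
Proof. by move=> h; apply/(@cvgrPdist_lt R R^o 'rV[R]_d (nbhs t)). Qed.

(** A uniform limit of trigonometric polynomials: the tail bound of [disp_trunc] does not depend on
    t. *)
Lemma disp_continuous : continuous (disp eh : 'rV[R]_d -> R).
Proof.
move=> t; apply: continuous_of_near => e e0.
have e3 : 0 < e / 3 by rewrite divr_gt0.
have [S /(_ S (fsubset_refl _)) hS] := l1n_offs se e3.
have := continuous_near_le (@Re_sum_continuous S t) e3.
apply: filterS => u hu.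
have h1 := disp_trunc se S t; have h2 := disp_trunc se S u.
set a := complex.Re _ in h1 hu; set b := complex.Re _ in h2 hu; rewrite distrC in hu.
have -> : disp eh t - disp eh u = (disp eh t - a) + (a - b) - (disp eh u - b) by ring.
apply: le_lt_trans (ler_normB _ _) _; apply: le_lt_trans (lerD (ler_normD _ _) (lexx _)) _.
lra.
Qed.

Definition lattice2pi (z : T) : 'rV[R]_d := \row_k (pi *+ 2 * (z 0 k)%:~R).

Lemma disp_periodic t z : disp eh (t + lattice2pi z) = disp eh t.
Proof.
rewrite /disp; congr (complex.Re (csum _)); apply/funext => x; congr (_ * _).
rewrite dotZDr expiD (_ : dotZ x (lattice2pi z) = pi *+ 2 * (\sum_k x 0 k * z 0 k)%:~R).
  by rewrite expi_2piz mulr1.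
rewrite /dotZ (big_morph _ (@intrD R) (mulr0z 1)) mulr_sumr; apply: eq_bigr => k _.
by rewrite mxE intrM mulrCA.
Qed.

Lemma torus_reduce (q : 'rV[R]_d) : exists z, torus (q + lattice2pi z).
Proof.
(* The floor is taken of (pi - q) / (2 pi), not of (q + pi) / (2 pi), because the cell is open at
   -pi and closed at pi. *)
exists (\row_k Num.floor ((pi - q 0 k) / (pi *+ 2))) => k; rewrite !mxE.
have p2 : 0 < pi *+ 2 :> R by rewrite mulrn_wgt0// pi_gt0.
have /andP := mem_rg1_floor ((pi - q 0 k) / (pi *+ 2)).
set m := Num.floor _; rewrite ler_pdivlMr// ltr_pdivrMr// => -[h1 h2].
have e2 : pi *+ 2 = pi + pi :> R by rewrite mulr2n.
by rewrite e2 in h1 h2 *; apply/andP; split; lra.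
Qed.

Variables (sg : R) (p : 'rV[R]_d).
Hypothesis hp : forall q, torus q -> q <> p -> sg * disp eh q < sg * disp eh p.

Lemma disp_max q : sg * disp eh q <= sg * disp eh p.
Proof.
have [z hz] := torus_reduce q; rewrite -(disp_periodic q z).
by have [->//|/eqP ne] := eqVneq (q + lattice2pi z) p; rewrite ltW// hp.
Qed.

(** p + t may leave the fundamental cell. It is congruent to p only for t = 0, since 2 pi |z_k| =
    |t_k| <= pi forces z = 0. *)
Lemma disp_strict (t : 'rV[R]_d) : (forall k, `|t 0 k| <= pi) -> t != 0 ->
  sg * disp eh (p + t) < sg * disp eh p.
Proof.
move=> ht t0; have [z hz] := torus_reduce (p + t); rewrite -(disp_periodic _ z).
apply: hp => // e; case/negP: t0; apply/eqP/rowP => k.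
have : t 0 k + pi *+ 2 * (z 0 k)%:~R = 0.
  have := congr1 (fun u : 'rV[R]_d => u 0 k) e; rewrite !mxE -addrA => e'.
  by apply: (@addrI _ (p 0 k)); rewrite e' addr0.
have pp := @pi_gt0 R; move/eqP; rewrite addr_eq0 => /eqP ek; have := ht k; rewrite ek normrN.
have p2 : 0 < pi *+ 2 :> R by rewrite mulrn_wgt0.
rewrite normrM (gtr0_norm p2) => h.
have : `|z 0 k| < 1.
  rewrite -(ltr_int R) intr_norm.
  rewrite -(ltr_pM2l p2) mulr1; apply: le_lt_trans h _; rewrite mulr2n; lra.
move=> z1; have -> : z 0 k = 0 by move: (z 0 k : int) z1 => y; lia.
by rewrite mulr0 oppr0 mxE.
Qed.
End Dispersion.

Lemma disp_bounds (R : realType) (d : nat) (eh : Zd d -> R[i]) (sg : R) (p : 'rV[R]_d) :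
  d = 1%N \/ d = 2%N -> csumm eh -> `|sg| = 1 ->
  (forall q, torus q -> q <> p -> sg * disp eh q < sg * disp eh p) ->
  C2_near (disp eh) p -> nondegenerate_at (disp eh) p ->
  exists2 c : R, 0 < c & exists C : R, forall t : 'rV[R]_d, (forall k, `|t 0 k| <= pi) ->
    c * \sum_k t 0 k ^+ 2 <= sg * disp eh p - sg * disp eh (p + t) <= C * \sum_k t 0 k ^+ 2.
Proof.
move=> hd se hs hp hC nd.
have cf : continuous (fun t : 'rV[R]_d => sg * disp eh t : R).
  move=> t; apply: (@continuousM R 'rV[R]_d (fun=> sg) (disp eh) t); first exact: cst_continuous.
  exact: disp_continuous.
have hmax q := disp_max hp q.
have [del d0 [c c0 [C hloc]]] : exists2 del : R, 0 < del & exists2 c : R, 0 < c & exists C : R,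
  forall t : 'rV[R]_d, (forall k, `|t 0 k| <= del) ->
    c * \sum_k t 0 k ^+ 2 <= sg * disp eh p - sg * disp eh (p + t) <= C * \sum_k t 0 k ^+ 2.
  by case: hd => e; subst d; [exact: local_bounds1|exact: local_bounds2].
exact: (global_bounds cf (disp_strict hp) d0 c0 hloc).
Qed.

(** * Logarithmic cut-off functions *)

Section Harmonic.
Variable R : realType.

Definition har (n : nat) : R := \sum_(i < n) (i.+1%:R)^-1.

Lemma harS n : har n.+1 = har n + (n.+1%:R)^-1.
Proof. by rewrite /har big_ord_recr. Qed.
Lemma har_le m n : (m <= n)%N -> har m <= har n.
Proof.
move=> /subnKC <-; elim: (n - m)%N => [|k IH]; first by rewrite addn0.
by apply: le_trans IH _; rewrite addnS harS lerDl invr_ge0.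
Qed.
Lemma har_ge0 n : 0 <= har n.
Proof. by apply: sumr_ge0 => i _; rewrite invr_ge0. Qed.

Lemma har_unbounded (B : R) : exists n, B <= har n.
Proof.
have key n : n%:R / 2 <= har (2 ^ n).
  elim: n => [|n IH]; first by rewrite mul0r har_ge0.
  (* Each term of the dyadic block is at least 1 / 2^(n + 1), so the full block contributes at least
     1/2. *)
  have h k : (k <= 2 ^ n)%N -> k%:R * (2 ^ n.+1)%:R^-1 <= har (2 ^ n + k) - har (2 ^ n).
    elim: k => [|k IHk] kn; first by rewrite mul0r addn0 subrr.
    rewrite addnS harS -[k.+1%:R]natr1 mulrDl mul1r; have := IHk (ltnW kn).
    move=> IHk'; rewrite addrAC; apply: lerD => //.
    by rewrite lef_pV2 ?posrE ?ltr0n ?expn_gt0// ler_nat expnS; lia.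
  have := h _ (leqnn _); rewrite addnn -mul2n -expnS expnS natrM invfM mulrCA divff; last first.
    by rewrite pnatr_eq0 expn_eq0.
  rewrite mulr1 -[n.+1%:R]natr1; lra.
exists (2 ^ (Num.truncn (2 * `|B|)).+1)%N; apply: le_trans (key _).
have := @truncnS_gt R (2 * `|B|); have := ler_norm B; lra.
Qed.

Lemma lerB_tele (A X Y Z : R) : Z <= X - Y -> A - X + Z <= A - Y.
Proof. lra. Qed.

(** The a + 1 terms with b <= a are equal and sum to 1 / (a + 1); the remaining ones are dominated
    by a telescoping series of the same total. *)
Lemma max_row_sum (a n : nat) :
  \sum_(b < n) ((1 + maxn a b)%:R ^+ 2)^-1 <= 2 / a.+1%:R :> R.
Proof.
have a0 : 0 < a.+1%:R :> R by rewrite ltr0n.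
have lo k : (k <= a.+1)%N -> \sum_(b < k) ((1 + maxn a b)%:R ^+ 2)^-1 = k%:R / a.+1%:R ^+ 2 :> R.
  elim: k => [|k IH] ka; first by rewrite big_ord0 mul0r.
  rewrite big_ord_recr /= IH; last exact: ltnW.
  by rewrite (maxn_idPl _)// add1n -[k.+1%:R]natr1 mulrDl mul1r.
have hi k : \sum_(b < a.+1 + k) ((1 + maxn a b)%:R ^+ 2)^-1 <= 2 / a.+1%:R - (a.+1 + k)%:R^-1 :> R.
  elim: k => [|k IH].
    rewrite addn0 lo// le_eqVlt; apply/orP; left; apply/eqP; field; lra.
  rewrite addnS big_ord_recr /=; apply: le_trans (lerD IH (lexx _)) _.
  rewrite (maxn_idPr _); last by rewrite addSn; lia.
  set m := (a.+1 + k)%N; have m0 : 0 < m%:R :> R by rewrite ltr0n /m addSn.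
  rewrite add1n -[m.+1%:R]natr1.
  have : ((m%:R + 1) ^+ 2)^-1 <= m%:R^-1 - (m%:R + 1)^-1 :> R.
    have -> : m%:R^-1 - (m%:R + 1)^-1 = (m%:R * (m%:R + 1))^-1 :> R by field; lra.
    rewrite lef_pV2 ?posrE ?exprn_gt0 ?mulr_gt0 ?addr_gt0//.
    by rewrite expr2 ler_pM2r ?addr_gt0// lerDl.
  exact: lerB_tele.
have [na|an] := leqP n a.+1.
  rewrite lo// expr2 invfM mulrA ler_pM2r ?invr_gt0//.
  have : n%:R <= a.+1%:R :> R by rewrite ler_nat.
  by rewrite ler_pdivrMr//; lra.
rewrite -(subnKC (ltnW an)); apply: le_trans (hi _) _.
by rewrite lerBlDr lerDl invr_ge0.
Qed.
End Harmonic.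

Section Cutoff.
Variables (R : realType) (d : nat).
Local Notation T := (Zd d).

Definition rad (x : T) : nat := (\max_(k < d) `|x 0%R k|)%N.

Lemma rad_unit (x : T) k : (rad (x + unitZ k)%R <= (rad x).+1)%N /\ (rad x <= (rad (x + unitZ k)%R).+1)%N.
Proof.
have u l : ((unitZ k : T) 0%R l = 0%R) \/ ((unitZ k : T) 0%R l = 1%R).
  by rewrite mxE; case: (_ && _); [right|left].
split; apply/bigmax_leqP => l _.
  have := @leq_bigmax _ (fun k => `|x 0%R k|%N) l; rewrite -/(rad x) mxE.
  by case: (u l) => ->; move: (x 0%R l : int) (rad x) => a b; lia.
have := @leq_bigmax _ (fun l => `|(x + unitZ k)%R 0%R l|%N) l; rewrite -/(rad _) mxE.
by case: (u l) => ->; move: (x 0%R l : int) (rad _) => a b; lia.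
Qed.

(** The enumeration [e] may repeat points, as it does for 0, which has two signs in [sgn_nat]; an
    upper bound tolerates overcounting. *)
Lemma rsum_cover (I : finType) (e : I -> T) (g : T -> R) : (forall x, 0 <= g x) ->
  (forall x, g x != 0 -> exists i, x = e i) -> summ g /\ rsum g <= \sum_i g (e i).
Proof.
move=> g0 he; pose S := [fset e i | i in I]%fset.
have gS x : x \notin S -> g x = 0.
  move=> xS; apply/eqP; apply: contraNT xS => /he[i ->]; apply/imfsetP.
  by exists i.
split; first exact: summ_fin gS.
rewrite (rsum_fin gS) /psum.
apply: (@le_trans _ _ (\sum_(x <- S) \sum_i (if e i == x then g x else 0))).
  rewrite big_seq [leRHS]big_seq; apply: ler_sum => x; rewrite /S => /imfsetP[i _ ->].
  by rewrite (bigD1 i)//= eqxx lerDl sumr_ge0// => j _; case: ifP.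
rewrite exchange_big /=; apply: ler_sum => i _.
have iS : e i \in S by apply/imfsetP; exists i.
rewrite (big_fsetD1 (e i))//= eqxx big_seq big1 ?addr0// => x.
by rewrite in_fsetD1 eq_sym => /andP[/negbTE ->].
Qed.
End Cutoff.

Definition sgn_nat (N : nat) (q : bool * 'I_N) : int := if q.1 then q.2%:Z else - q.2%:Z.

Lemma sgn_natP (N : nat) (z : int) : (`|z| < N)%N -> exists q : bool * 'I_N, z = sgn_nat q.
Proof.
move=> zN; exists (0 <= z, Ordinal zN); rewrite /sgn_nat /=; case: ifP; lia.
Qed.
Lemma absz_sgn_nat (N : nat) (q : bool * 'I_N) : `|sgn_nat q|%N = q.2.
Proof. by rewrite /sgn_nat; case: ifP => _; lia. Qed.

Lemma sum_bool_pair (R : realType) N (f : nat -> R) :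
  \sum_(q : bool * 'I_N) f q.2 = 2 * \sum_(a < N) f a.
Proof.
rewrite -(pair_big xpredT xpredT (fun (b : bool) (a : 'I_N) => f a)) /= big_bool.
by rewrite mulr_natl mulr2n.
Qed.

(** A sphere of radius r has on the order of r^(d - 1) points, so for d <= 2 the weight (1 + r)^(-2)
    sums to at most a harmonic sum. The constant 8 is four sign choices times the 2 of
    [max_row_sum]. *)
Lemma rad_sum (R : realType) (d N : nat) (g : Zd d -> R) (B : R) : d = 1%N \/ d = 2%N -> 0 <= B ->
  (forall x, 0 <= g x <= B * ((1 + rad x)%:R ^+ 2)^-1) ->
  (forall x, (N < rad x)%N -> g x = 0) -> summ g /\ rsum g <= 8 * B * har R N.+1.
Proof.
move=> hd B0 hg hN.
have g0 x : 0 <= g x by case/andP: (hg x).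
have g1 x : g x <= B * ((1 + rad x)%:R ^+ 2)^-1 by case/andP: (hg x).
have gN x : g x != 0 -> forall k, (`|x 0%R k| < N.+1)%N.
  move=> gx k; rewrite ltnS; apply: (@leq_trans (rad x)); last first.
    by rewrite leqNgt; apply: contra gx => /hN ->.
  exact: (@leq_bigmax _ (fun k => `|x 0%R k|%N) k).
case: hd => e; subst d.
  pose e (q : bool * 'I_N.+1) : Zd 1 := \row_k sgn_nat q.
  have re q : rad (e q) = q.2 by rewrite /rad big_ord1 mxE absz_sgn_nat.
  have [|s h] := @rsum_cover R 1 _ e g g0.
    move=> x /gN h; have [q hq] := sgn_natP (h 0); exists q.
    by apply/rowP => k; rewrite (ord1 k) mxE.
  split => //; apply: le_trans h _.
  apply: (@le_trans _ _ (\sum_(q : bool * 'I_N.+1) B * ((1 + q.2)%:R ^+ 2)^-1)).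
    by apply: ler_sum => q _; rewrite -(re q).
  rewrite (sum_bool_pair N.+1 (fun a => B * ((1 + a)%:R ^+ 2)^-1)) -mulr_sumr mulrCA.
  rewrite -mulrA (mulrCA 8) ler_wpM2l//.
  have : \sum_(a < N.+1) ((1 + a)%:R ^+ 2)^-1 <= har R N.+1.
    apply: ler_sum => a _; rewrite add1n lef_pV2 ?posrE ?exprn_gt0 ?ltr0n//.
    by rewrite expr2 ler_peMr// ler1n.
  have := har_ge0 R N.+1; lra.
pose e (q : (bool * 'I_N.+1) * (bool * 'I_N.+1)) : Zd 2 :=
  \row_k (if k == 0 then sgn_nat q.1 else sgn_nat q.2).
have re q : rad (e q) = maxn q.1.2 q.2.2.
  rewrite /rad big_ord_recl big_ord1 !mxE /= !absz_sgn_nat //.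
have [|s h] := @rsum_cover R 2 _ e g g0.
  move=> x /gN h; have [q hq] := sgn_natP (h 0); have [q' hq'] := sgn_natP (h 1).
  exists (q, q'); apply/rowP => k; rewrite mxE /=.
  case: eqP => [->//|/eqP k0]; rewrite -hq'; congr (x _ _).
  by move: k0; case: k => [[|[|]]]//= p _; exact: val_inj.
split => //; apply: le_trans h _.
apply: (@le_trans _ _ (\sum_(q : (bool * 'I_N.+1) * (bool * 'I_N.+1))
   B * ((1 + maxn q.1.2 q.2.2)%:R ^+ 2)^-1)).
  by apply: ler_sum => q _; rewrite -(re q).
rewrite -mulr_sumr -mulrA mulrCA ler_wpM2l//.
rewrite -(pair_big xpredT xpredT (fun (q q' : bool * 'I_N.+1) =>
   ((1 + maxn q.2 q'.2)%:R ^+ 2)^-1 : R)) /=.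
under eq_bigr => q _ do
  rewrite (sum_bool_pair N.+1 (fun b => ((1 + maxn q.2 b)%:R ^+ 2)^-1 : R)).
rewrite (sum_bool_pair N.+1 (fun a => 2 * \sum_(b < N.+1) ((1 + maxn a b)%:R ^+ 2)^-1 : R)).
rewrite -mulr_sumr mulrA.
have : \sum_(a < N.+1) \sum_(b < N.+1) ((1 + maxn a b)%:R ^+ 2)^-1 <= 2 * har R N.+1.
  by rewrite /har mulr_sumr; apply: ler_sum => a _; exact: max_row_sum.
lra.
Qed.

Section TestFunction.
Variables (R : realType) (d : nat).
Hypothesis hd : d = 1%N \/ d = 2%N.
Local Notation T := (Zd d).

Definition clip (x : R) : R := Num.max 0 (Num.min 1 x).

Lemma clip01 x : 0 <= clip x <= 1.
Proof. by rewrite /clip le_max lexx /= ge_max ler01 ge_min lexx. Qed.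
Lemma clip_lip x y : `|clip x - clip y| <= `|x - y|.
Proof.
have h (a b : R) : a <= b -> 0 <= clip b - clip a <= b - a.
  move=> ab; rewrite /clip; case: (ltP 1 a) => ha; case: (ltP 1 b) => hb;
   rewrite ?(max_r ler01); try (by apply/andP; split; lra);
   case: (leP 0 a) => a0; case: (leP 0 b) => b0; try (apply/andP; split; lra);
   case: (leP 0 1); move=> ?; apply/andP; split; lra.
have [xy|yx] := leP x y.
  have /andP[h1 h2] := h _ _ xy.
  by rewrite distrC (distrC x) (ger0_norm h1) ger0_norm ?subr_ge0.
have /andP[h1 h2] := h _ _ (ltW yx).
by rewrite (ger0_norm h1) ger0_norm ?subr_ge0// ltW.
Qed.

(* A logarithmic cut-off: the Dirichlet energy of a profile that is affine in the harmonic sum of the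
   radius is of the order of 1 / log N, in dimension at most two. *)
Lemma test_function (G : {fset T}) (e : R) : 0 < e -> exists (F : {fset T}) (phi : T -> R),
  [/\ (forall x, x \notin F -> phi x = 0), (forall x, 0 <= phi x <= 1),
      (forall x, x \in G -> phi x = 1) &
      \sum_(k < d) n2 (fun x : T => creal (phi (x + unitZ k)) - creal (phi x)) <= e].
Proof.
move=> e0.
have [M hM] : exists M, forall x : T, x \in enum_fset G -> (rad x <= M)%N.
  elim: (enum_fset G) => [|x r [M hM]]; first by exists 0%N.
  exists (maxn (rad x) M) => y; rewrite inE => /orP[/eqP ->|/hM h].
    exact: leq_maxl.
  exact: leq_trans h (leq_maxr _ _).
pose hm := har R M.
have hm0 : 0 <= hm by exact: har_ge0.
(* 32 is the 8 of [rad_sum] times the 4 of the gradient bound. The energy will be at most K / L,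
   because har (N + 1) <= L (hm + 2), and N is chosen to make L >= K / e. *)
pose K : R := d%:R * 32 * (hm + 2).
have K0 : 0 <= K by rewrite !mulr_ge0// addr_ge0.
have [N hN] := har_unbounded (hm + 1 + K / e).
pose L := har R N - hm.
have Ke0 : 0 <= K / e by rewrite divr_ge0// ltW.
have L1 : 1 <= L by rewrite /L; clear -hN Ke0; lra.
have LK : K / e <= L by rewrite /L; clear -hN; lra.
have L0 : 0 < L := lt_le_trans ltr01 L1.
pose psi j := clip (1 - (har R j - hm) / L).
have psi0 j : (N <= j)%N -> psi j = 0.
  move=> /(har_le R) h; have h1 : 1 <= (har R j - hm) / L by rewrite ler_pdivlMr// mul1r /L lerD2r.
  rewrite /psi /clip; apply/max_idPl; rewrite ge_min; apply/orP; right; rewrite subr_le0//.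
have psi1 j : (j <= M)%N -> psi j = 1.
  move=> /(har_le R) h; have h1 : (har R j - hm) / L <= 0.
    by rewrite pmulr_lle0 ?invr_gt0// subr_le0.
  rewrite /psi /clip min_l ?max_r// lerBrDr; lra.
have psi_step j : `|psi j.+1 - psi j| <= (L * j.+1%:R)^-1.
  apply: le_trans (clip_lip _ _) _; rewrite harS invfM.
  have -> : 1 - (har R j + j.+1%:R^-1 - hm) / L - (1 - (har R j - hm) / L) = - (L^-1 * j.+1%:R^-1) by ring.
  by rewrite normrN ger0_norm// mulr_ge0// invr_ge0// ltW.
pose phi (x : T) := psi (rad x).
pose g k (x : T) : R := cabs2 (creal (phi (x + unitZ k)) - creal (phi x) : R[i]).
have gE k x : g k x = (phi (x + unitZ k) - phi x) ^+ 2.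
  by rewrite /g /cabs2 /creal /= subr0 expr0n addr0.
have gb k x : 0 <= g k x <= 4 / L ^+ 2 * ((1 + rad x)%:R ^+ 2)^-1.
  rewrite {1}/g cabs2_ge0 gE /phi.
  (* The factor 2 pays for a neighbour closer to the origin: the step is then bounded with [rad x]
     in place of [1 + rad x], and [1 + rad x <= 2 * rad x]. *)
  have -> : 4 / L ^+ 2 * ((1 + rad x)%:R ^+ 2)^-1 = (2 * (L * (1 + rad x)%:R)^-1) ^+ 2.
    have : (1 + rad x)%:R != 0 :> R by rewrite pnatr_eq0.
    move: ((1 + rad x)%:R : R) => m m0; field; rewrite m0 gt_eqF//.
  have q0 : 0 <= (L * (1 + rad x)%:R)^-1 by rewrite invr_ge0 mulr_ge0// ltW.
  rewrite -(real_normK (num_real (_ - _))) ler_pXn2r ?nnegrE ?mulr_ge0//.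
  have [r1 r2] := rad_unit x k.
  have [lt|] := ltnP (rad x) (rad (x + unitZ k)%R).
    have -> : rad (x + unitZ k) = (rad x).+1 by apply/eqP; rewrite eqn_leq r1.
    apply: le_trans (psi_step _) _; rewrite -add1n; clear -q0; lra.
  rewrite leq_eqVlt => /orP[/eqP ->|lt]; first by rewrite subrr normr0 mulr_ge0.
  have -> : rad x = (rad (x + unitZ k)%R).+1 by apply/eqP; rewrite eqn_leq r2.
  rewrite distrC; apply: le_trans (psi_step _) _; set j := rad _.
  rewrite !invfM mulrCA ler_pM2l ?invr_gt0// -ler_pdivrMl// -invfM lef_pV2 ?posrE ?mulr_gt0 ?ltr0n//.
  by rewrite -natrM ler_nat; lia.
have gN k x : (N < rad x)%N -> g k x = 0.
  move=> Nr; have [r1 r2] := rad_unit x k.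
  rewrite gE /phi !psi0 ?subrr ?expr0n//; first exact: ltnW.
  by rewrite -ltnS; exact: leq_trans Nr r2.
have B0 : 0 <= 4 / L ^+ 2 by rewrite divr_ge0 ?sqr_ge0.
have [F hF] : exists F : {fset T}, forall x, x \notin F -> phi x = 0.
  pose e1 (J : {ffun 'I_d -> bool * 'I_N.+1}) : T := \row_k sgn_nat (J k).
  exists [fset e1 J | J in {ffun 'I_d -> bool * 'I_N.+1}]%fset => x xF.
  rewrite /phi psi0// leqNgt; apply/negP => lt; case/negP: xF; apply/imfsetP.
  have h k : exists q : bool * 'I_N.+1, x 0 k = sgn_nat q.
    apply: sgn_natP; rewrite ltnS; apply: leq_trans (ltnW lt).
    exact: (@leq_bigmax _ (fun k => `|x 0%R k|%N) k).
  have [q hq] := choice h; exists [ffun k => q k] => //=.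
  by apply/rowP => k; rewrite mxE ffunE -hq.
exists F, phi; split => //.
- by move=> x; exact: clip01.
- by move=> x xG; apply: psi1; exact: hM.
apply: (@le_trans _ _ (\sum_(k < d) 8 * (4 / L ^+ 2) * har R N.+1)).
  by apply: ler_sum => k _; rewrite n2E; case: (rad_sum hd B0 (gb k) (gN k)).
rewrite sumr_const card_ord -[_ *+ d]mulr_natl.
apply: (@le_trans _ _ (K / L)); last by rewrite ler_pdivrMr// mulrC -ler_pdivrMr.
have hb : har R N.+1 <= L * (hm + 2).
  have h1 : har R N.+1 <= L + hm + 1.
    rewrite harS /L subrK lerD2l invf_le1 ?ltr0n// ler1n//.
  have : 0 <= (L - 1) * (hm + 1) by rewrite mulr_ge0 ?subr_ge0// addr_ge0.
  by clear -h1; lra.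
have -> : K / L = d%:R * (8 * (4 / L ^+ 2) * (L * (hm + 2))) by rewrite /K; field; rewrite gt_eqF.
by rewrite ler_wpM2l// ler_wpM2l// mulr_ge0.
Qed.
End TestFunction.

(** * Eigenvalues above the band *)

Section Top.
Variables (R : realType) (d : nat) (eh : Zd d -> R[i]) (v : Zd d -> R) (p : 'rV[R]_d) (em c Cc a g : R).
Local Notation T := (Zd d).
Local Notation C := R[i].
Hypotheses (hd : d = 1%N \/ d = 2%N) (se : csumm eh)
  (sym : forall x : T, cconj (eh (- x)) = eh x) (sv : summ v)
  (sw : summ (fun x => znorm R x `^ a * `|v x|))
  (ha : 0 < a <= 2) (ea : a = 2 - d%:R + g) (hg : 0 < g < d%:R) (c0 : 0 < c).
Hypothesis disp_low : forall t : 'rV[R]_d, (forall k, `|t 0 k| <= pi) ->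
  c * \sum_k t 0 k ^+ 2 <= em - disp eh (p + t).
Hypothesis disp_up : forall t : 'rV[R]_d, (forall k, `|t 0 k| <= pi) ->
  em - disp eh (p + t) <= Cc * \sum_k t 0 k ^+ 2.
Implicit Types (f u : T -> C) (F : {fset T}).

Lemma d_gt0 : (0 < d)%N. Proof. by case: hd => ->. Qed.

Lemma geh_low (t : 'rV[R]_d) : (forall k, `|t 0 k| <= pi) ->
  c * \sum_k t 0 k ^+ 2 <= em - disp (geh eh p) t.
Proof. by rewrite disp_geh; exact: disp_low. Qed.
Lemma geh_up (t : 'rV[R]_d) : (forall k, `|t 0 k| <= pi) ->
  em - disp (geh eh p) t <= Cc * \sum_k t 0 k ^+ 2.
Proof. by rewrite disp_geh; exact: disp_up. Qed.

Lemma kinE f : in_l2 f -> kin eh em f = kin (geh eh p) em (ungauge p f).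
Proof.
move=> sf; rewrite -(kin_gauge p se em (ungauge_l2 p sf)) ungaugeK//.
Qed.

Lemma top_kin_ge0 f : in_l2 f -> 0 <= kin eh em f.
Proof.
move=> sf; rewrite kinE//; apply: (kin_ge0 (csumm_geh p se) c0 geh_low).
exact: ungauge_l2.
Qed.

Lemma top_hardy : exists2 D : R, 0 <= D & forall f x, in_l2 f ->
  cabs2 (ungauge p f x - ungauge p f 0) <= D * znorm R x `^ a * kin eh em f.
Proof.
have := andP hg => -[g0 _]; have dR : 0 < d%:R :> R by rewrite ltr0n d_gt0.
exists (4 / c * (2 / (g / d%:R)) ^+ d).
  by rewrite !mulr_ge0 ?invr_ge0 ?(ltW c0)// exprn_ge0// divr_ge0// ltW// divr_gt0.
move=> f x sf; rewrite kinE//.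
exact: (hardy (csumm_geh p se) c0 geh_low x d_gt0 ha ea hg (ungauge_l2 p sf)).
Qed.

Lemma top_form mu f : in_l2 f ->
  ip (hmu eh v mu f) f = em * n2 f - kin eh em f + mu * rsum (fun x => v x * cabs2 (f x)).
Proof. by move=> sf; rewrite hmu_form// /kin; ring. Qed.

Lemma rsum_tail_le (w : T -> R) e : summ w -> 0 < e -> exists F : {fset T},
  forall x, x \notin F -> `|w x| <= e.
Proof.
move=> sw' e0; have [F /(_ F (fsubset_refl _)) hF] := rsum_tail sw' e0; exists F => x xF.
apply: ltW; apply: le_lt_trans hF.
have h0 y : 0 <= (if y \in F then 0 else `|w y|) by case: ifP.
have sg : summ (fun y => if y \in F then 0 else `|w y|).
  by apply: summ_le (summ_abs sw') => y; case: ifP; rewrite ?normr0 ?normr_id.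
have := @psum_le_rsum _ _ _ [fset x]%fset h0 sg.
by rewrite /psum big_seq_fset1 (negbTE xF).
Qed.

(** Summability makes v small off a finite set; removing the values of v on that set leaves a form
    above em by at most e, as [kin] is nonnegative. *)
Lemma top_finpert mu e : 0 < e -> finpert (hmu eh v mu) (em + e).
Proof.
move=> e0; have e1 : 0 < e / (`|mu| + 1) by rewrite divr_gt0// ltr_wpDl.
have [F hF] := rsum_tail_le sv e1.
exists F, (fun x => if x \in F then creal (mu * v x) else 0); split; first by move=> x /negbTE ->.
move=> f sf.
pose w x := if x \in F then 0 else v x.
have sw' : summ w by apply: summ_le (summ_abs sv) => x; rewrite /w; case: ifP; rewrite ?normr0.
have -> : (fun x => hmu eh v mu f x - (if x \in F then creal (mu * v x) else 0) * f x) = hmu eh w mu f.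
  apply/funext => x; rewrite /hmu /w; case: ifP => _; last ring.
  by rewrite mulr0; have -> : creal 0 = 0 :> C by []; ring.
rewrite hmu_form//; have K0 := top_kin_ge0 sf; rewrite /kin in K0.
have s1 := summ_vf sw' 1 sf; have s1' : summ (fun x => w x * cabs2 (f x)).
  by apply: summ_le (summ_abs s1) => x; rewrite mul1r.
have : `|rsum (fun x => w x * cabs2 (f x))| <= rsum (fun x => e / (`|mu| + 1) * cabs2 (f x)).
  apply: norm_rsum_le; last by apply: summZ; exact/in_l2P.
  move=> x; rewrite normrM (ger0_norm (cabs2_ge0 _)) ler_wpM2r ?cabs2_ge0//.
  by rewrite /w; case: ifPn => [_|/hF//]; rewrite normr0 ltW.
rewrite rsumZ; last exact/in_l2P.
rewrite -n2E => h.
have h2 : mu * rsum (fun x => w x * cabs2 (f x)) <= `|mu| * (e / (`|mu| + 1) * n2 f).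
  by apply: le_trans (ler_norm _) _; rewrite normrM ler_wpM2l.
have h3 : `|mu| * (e / (`|mu| + 1) * n2 f) <= e * n2 f.
  rewrite mulrA ler_wpM2r ?n2_ge0// mulrCA ler_piMr ?(ltW e0)// ler_pdivrMr ?mul1r ?lerDl//.
lra.
Qed.

Lemma summ_vcabs f : in_l2 f -> summ (fun x => v x * cabs2 (f x)).
Proof. by move=> sf; have := summ_vf sv 1 sf; under eq_fun do rewrite mul1r. Qed.

(** For small mu the kinetic energy absorbs the potential. [F] is the origin alone for uniqueness
    and empty for absence; B + 1 keeps the threshold finite when B = 0. *)
Lemma weak_form F (B : R) : 0 <= B ->
  (forall f, in_l2 f -> (forall x, x \in F -> f x = 0) ->
     rsum (fun x => v x * cabs2 (f x)) <= B * kin eh em f) ->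
  forall mu, 0 < mu < (B + 1)^-1 ->
  forall f, in_l2 f -> (forall x, x \in F -> f x = 0) -> ip (hmu eh v mu f) f <= em * n2 f.
Proof.
move=> B0 h mu /andP[mu0 mu1] f sf fF; rewrite top_form//.
have h1 : mu * rsum (fun x => v x * cabs2 (f x)) <= mu * (B * kin eh em f).
  by rewrite ler_pM2l// h.
have B1 : 0 < B + 1 by rewrite ltr_wpDl.
have h2 : mu * (B * kin eh em f) <= kin eh em f.
  rewrite mulrA ler_piMl ?top_kin_ge0//; apply: le_trans (_ : mu * (B + 1) <= 1).
    by rewrite ler_pM2l// lerDl.
  by rewrite -ler_pdivlMr// mul1r ltW.
lra.
Qed.

Lemma top_unique : exists2 mu0 : R, 0 < mu0 & forall mu, 0 < mu < mu0 ->
  forall E E', rdisc (hmu eh v mu) E -> em < E -> rdisc (hmu eh v mu) E' -> em < E' -> E = E'.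
Proof.
have [D D0 hD] := top_hardy.
pose W := rsum (fun x => znorm R x `^ a * `|v x|).
have W0 : 0 <= W by apply: rsum_ge0 => // x; rewrite mulr_ge0 ?powR_ge0.
have B0 : 0 <= D * W by rewrite mulr_ge0.
exists (D * W + 1)^-1; first by rewrite invr_gt0 ltr_wpDl.
move=> mu hmu0 E E' rE emE rE' emE'.
apply/eqP; apply: contraT => EE'.
have : (size [:: E; E'] <= size (enum_fset [fset (0%R : T)]%fset))%N.
  apply: (@eigv_count _ _ _ (hmu_lin se sv mu) (hmu_sym se sv sym mu) [fset (0 : T)]%fset em).
  - by rewrite /= inE EE'.
  - apply: (weak_form B0) => // f sf f0.
    have u0 : ungauge p f 0 = 0 by rewrite /ungauge f0 ?mulr0// inE.
    have s2 := summZ (D * kin eh em f) sw.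
    rewrite mulrAC -rsumZ//; apply: (ler_rsum _ (summ_vcabs sf) s2) => x.
    have := hD f x sf; rewrite u0 subr0 cabs2_ungauge => h.
    apply: (@le_trans _ _ (`|v x| * cabs2 (f x))); first by rewrite ler_wpM2r ?cabs2_ge0// ler_norm.
    rewrite [leRHS](_ : _ = `|v x| * (D * znorm R x `^ a * kin eh em f)); last by ring.
    by rewrite ler_wpM2l.
  - move=> y; rewrite !inE => /orP[/eqP ->|/eqP ->]; split => //; exact: rdisc_eigv.
by rewrite cardfs1.
Qed.

Lemma top_none : rsum v < 0 -> exists2 mu0 : R, 0 < mu0 & forall mu, 0 < mu < mu0 ->
  forall E, rdisc (hmu eh v mu) E -> ~ em < E.
Proof.
move=> v0; have [D D0 hD] := top_hardy.
pose W := rsum (fun x => znorm R x `^ a * `|v x|).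
have W0 : 0 <= W by apply: rsum_ge0 => // x; rewrite mulr_ge0 ?powR_ge0.
pose V := rsum (fun x => `|v x|); have sa := summ_abs sv.
have V0 : 0 <= V by apply: rsum_ge0.
(* The weight of the cross term, chosen so that rsum v + eta V = rsum v / (V + 1) remains
   negative. *)
pose eta := - rsum v / (V + 1); have V1 : 0 < V + 1 by rewrite ltr_wpDl.
have eta0 : 0 < eta by rewrite divr_gt0// oppr_gt0.
pose B := (1 + eta^-1) * D * W.
have B0 : 0 <= B by rewrite !mulr_ge0// addr_ge0// invr_ge0 ltW.
exists (B + 1)^-1; first by rewrite invr_gt0 ltr_wpDl.
move=> mu hmu0 E /rdisc_eigv [f1 [sf1 Hf1 f10]] emE.
have : ip (hmu eh v mu f1) f1 <= em * n2 f1.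
  apply: (@weak_form fset0 B) => // f sf _.
  set K := kin eh em f; pose u0 := ungauge p f 0.
  (* With u = u0 + w, the constant part contributes |u0|^2 rsum v < 0 unless u0 = 0. The cross term
     is split by a weighted Young inequality, and |w|^2 is controlled by the Hardy bound. *)
  have pt x : v x * cabs2 (f x) <= cabs2 u0 * v x +
    (eta * cabs2 u0 * `|v x| + (1 + eta^-1) * D * K * (znorm R x `^ a * `|v x|)).
    rewrite -(cabs2_ungauge p f x); set w := ungauge p f x - u0.
    have -> : ungauge p f x = u0 + w by rewrite /w addrC subrK.
    have hw : cabs2 w <= D * znorm R x `^ a * K by exact: hD.
    have h1 : `|2 * ipr u0 w| <= eta * cabs2 u0 + eta^-1 * cabs2 w.
      have e2 : (Num.sqrt eta) ^+ 2 = eta by rewrite sqr_sqrtr// ltW.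
      have s0 : Num.sqrt eta != 0 by rewrite sqrtr_eq0 -ltNge.
      have := ipr_le (creal (Num.sqrt eta) * u0) (creal (Num.sqrt eta)^-1 * w).
      have q1 := cabs2_ge0 (creal (Num.sqrt eta) * u0 + creal (Num.sqrt eta)^-1 * w).
      have q2 := cabs2_ge0 (creal (Num.sqrt eta) * u0 + - (creal (Num.sqrt eta)^-1 * w)).
      have eN (z y : C) : ipr z (- y) = - ipr z y by case: y => ? ?; rewrite /ipr /=; ring.
      rewrite cabs2D in q1; rewrite cabs2D cabs2N eN in q2.
      have ei : ipr (creal (Num.sqrt eta) * u0) (creal (Num.sqrt eta)^-1 * w) = ipr u0 w.
        by rewrite iprZl iprC iprZl mulrA divff// mul1r iprC.
      have ec1 : cabs2 (creal (Num.sqrt eta) * u0) = eta * cabs2 u0 by rewrite cabs2M cabs2_creal e2.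
      have ec2 : cabs2 (creal (Num.sqrt eta)^-1 * w) = eta^-1 * cabs2 w.
        by rewrite cabs2M cabs2_creal exprVn e2.
      rewrite ei ec1 ec2 in q1 q2 *; move=> _; rewrite ler_norml.
      by apply/andP; split; lra.
    rewrite cabs2D.
    have h2 : v x * (2 * ipr u0 w) <= `|v x| * (eta * cabs2 u0 + eta^-1 * cabs2 w).
      by apply: le_trans (ler_norm _) _; rewrite normrM ler_wpM2l.
    have h3 : v x * cabs2 w <= `|v x| * cabs2 w by rewrite ler_wpM2r ?cabs2_ge0// ler_norm.
    have h4 : `|v x| * ((1 + eta^-1) * cabs2 w) <= `|v x| * ((1 + eta^-1) * (D * znorm R x `^ a * K)).
      by rewrite ler_wpM2l// ler_wpM2l// addr_ge0// invr_ge0 ltW.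
    have -> : (1 + eta^-1) * D * K * (znorm R x `^ a * `|v x|) =
      `|v x| * ((1 + eta^-1) * (D * znorm R x `^ a * K)) by ring.
    lra.
  have s1 := summZ (cabs2 u0) sv; have s2 := summZ (eta * cabs2 u0) sa.
  have s3 := summZ ((1 + eta^-1) * D * K) sw.
  have := ler_rsum pt (summ_vcabs sf) (summD s1 (summD s2 s3)).
  rewrite (rsumD s1 (summD s2 s3)) (rsumD s2 s3) !rsumZ// -/V -/W => h.
  have : cabs2 u0 * rsum v + eta * cabs2 u0 * V <= 0.
    have -> : cabs2 u0 * rsum v + eta * cabs2 u0 * V = cabs2 u0 * (rsum v + eta * V) by ring.
    rewrite mulr_ge0_le0 ?cabs2_ge0// /eta.
    have -> : rsum v + - rsum v / (V + 1) * V = rsum v / (V + 1) by field; rewrite gt_eqF.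
    by rewrite mulr_le0_ge0 ?ltW// invr_gt0.
  have -> : B * K = (1 + eta^-1) * D * K * W by rewrite /B; ring.
  lra.
rewrite Hf1 ip_creal// => h; have n0 : 0 < n2 f1.
  by rewrite lt_def n2_ge0// andbT; apply/negP => /eqP e; apply: f10; apply: n2_eq0; rewrite // e.
by rewrite ler_pM2r// leNgt emE in h.
Qed.

(** The trial function is a cut-off plus s times the delta at x0. The cut-off costs arbitrarily
    little and nearly attains rsum v >= 0; the spike gains to first order in s and costs only to
    second order. *)
Lemma top_existence mu x0 : 0 < mu -> v x0 != 0 -> 0 <= rsum v ->
  exists E, rdisc (hmu eh v mu) E /\ em < E.
Proof.
move=> mu0 vx0 v0.
suff [f sf hf] : exists2 f, in_l2 f & kin eh em f < mu * rsum (fun x => v x * cabs2 (f x)).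
  apply: (@top_exists _ _ _ (hmu_lin se sv mu) (hmu_bounded se sv mu) (hmu_sym se sv sym mu) em f) => //.
    exact: top_finpert.
  by rewrite top_form//; lra.
have [C1 C10 hC] := kin_dirichlet (csumm_geh p se) geh_up.
have nv : 0 < `|v x0| by rewrite normr_gt0.
(* A tau^2 bounds the kinetic cost of the spike: per direction, 4 tau^2 for its gradient and 2 for
   separating it from the cut-off. tau makes this at most half of the gain mu tau |v x0|. *)
pose A := 8 * d%:R * C1; have A0 : 0 <= A by rewrite !mulr_ge0.
pose tau := Num.min 1 (mu * `|v x0| / (2 * A + 1)).
have t0 : 0 < tau.
  by rewrite lt_min ltr01 divr_gt0 ?mulr_gt0// ltr_wpDl// mulr_ge0.
have t1 : tau <= 1 by rewrite ge_min lexx.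
have tA : A * tau ^+ 2 <= mu * `|v x0| * tau / 2.
  have : tau * (2 * A + 1) <= mu * `|v x0|.
    by rewrite -ler_pdivlMr; [rewrite ge_min lexx orbT|rewrite ltr_wpDl// mulr_ge0].
  move=> h; have h2 : tau * (tau * (2 * A + 1)) <= tau * (mu * `|v x0|) by rewrite ler_pM2l.
  have := sqr_ge0 tau; rewrite expr2 in h2 *; lra.
(* eta bounds both the loss of potential and the Dirichlet energy of the cut-off; together they use
   less than a quarter of the gain. *)
pose eta := mu * tau * `|v x0| / (4 * (mu + 2 * C1 + 1)).
have q0 : 0 < mu + 2 * C1 + 1 by rewrite ltr_wpDl// addr_ge0 ?mulr_ge0// ltW.
have eta0 : 0 < eta by rewrite divr_gt0 ?mulr_gt0.
have [G hG] := rsum_tail sv eta0.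
have [F [phi [phiF phi01 phiG phiE]]] := test_function hd (x0 |` G)%fset eta0.
set En := \sum_k _ in phiE.
(* The sign aligns the spike with v, so that v x0 * s = tau |v x0| > 0. *)
pose s := tau * Num.sg (v x0).
have s2 : s ^+ 2 = tau ^+ 2 by rewrite exprMn sqr_sg vx0 mulr1.
pose w1 (x : T) : C := creal (phi x); pose w2 (x : T) : C := creal s * delta R x0 x.
pose u x := w1 x + w2 x.
have sw1 : in_l2 w1 by apply: (@l2_fin _ _ F) => x /phiF; rewrite /w1 => ->.
have sw2 : in_l2 w2 by apply: l2Z; exact: delta_l2.
have su : in_l2 u by exact: l2D.
have suF : supp u (x0 |` F)%fset.
  move=> x; rewrite !inE negb_or => /andP[xx0 /phiF e]; rewrite /u /w1 /w2 e /delta (negbTE xx0).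
  by rewrite mulr0 addr0.
exists (gauge p u); first exact: gauge_l2.
rewrite (kin_gauge p se em su).
have k1 : kin (geh eh p) em u <= C1 * (2 * En + 2 * (d%:R * (4 * tau ^+ 2))).
  apply: le_trans (hC _ _ suF) _; apply: ler_wpM2l => //.
  have -> : 2 * En + 2 * (d%:R * (4 * tau ^+ 2)) = \sum_(k < d)
    (2 * n2 (fun x : T => creal (phi (x + unitZ k)) - creal (phi x)) + 2 * (4 * tau ^+ 2)).
    by rewrite big_split /= -mulr_sumr sumr_const card_ord -/En -[in RHS]mulr_natl; ring.
  apply: ler_sum => k _.
  have sd1 := l2B (l2_shift (unitZ k) sw1) sw1; have sd2 := l2B (l2_shift (unitZ k) sw2) sw2.
  rewrite (_ : (fun x => u (x + unitZ k) - u x) =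
    fun x => (w1 (x + unitZ k) - w1 x) + (w2 (x + unitZ k) - w2 x)); last first.
    by apply/funext => x; rewrite /u; ring.
  apply: le_trans (n2D_le sd1 sd2) _; rewrite lerD2l ler_pM2l//.
  have := n2D_le (l2_shift (unitZ k) sw2) (l2N sw2); rewrite n2N n2_shift//.
  have -> : n2 w2 = tau ^+ 2.
    rewrite /w2 n2M; last exact: delta_l2.
    rewrite cabs2_creal s2 n2E (@rsum_fin _ _ [fset x0]%fset).
      by rewrite /psum big_seq_fset1 /delta eqxx /cabs2 /= expr1n expr0n addr0 mulr1.
    by move=> x; rewrite inE /delta => /negbTE ->; rewrite cabs2_0.
  lra.
have cu x : cabs2 (u x) = phi x ^+ 2 + (if x == x0 then 2 * phi x0 * s + s ^+ 2 else 0).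
  rewrite /u /w1 /w2 /delta; case: eqP => [->|_].
    rewrite mulr1 /cabs2 /creal /= addr0 expr0n addr0; ring.
  by rewrite mulr0 addr0 cabs2_creal addr0.
have phx0 : phi x0 = 1 by apply: phiG; rewrite !inE eqxx.
have vs : v x0 * s = tau * `|v x0| by rewrite /s mulrCA normrEsg; ring.
(* The site x0 contributes v x0 (2 s + s^2) >= 2 tau |v x0| - tau^2 |v x0|, at least tau |v x0|
   because tau <= 1. *)
have hpot : rsum (fun x => v x * cabs2 (gauge p u x)) >= - eta + tau * `|v x0|.
  have -> : (fun x => v x * cabs2 (gauge p u x)) = fun x => v x * phi x ^+ 2 +
     (if x == x0 then v x0 * (2 * s + s ^+ 2) else 0).
    apply/funext => x; rewrite cabs2_gauge cu phx0 mulr1.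
    by case: eqP => [->|_]; rewrite mulrDr ?mulr0.
  have sp1 : summ (fun x => v x * phi x ^+ 2).
    apply: summ_le (summ_abs sv) => x; rewrite normrM ler_piMr// ger0_norm ?sqr_ge0//.
    by rewrite expr_le1//; case/andP: (phi01 x).
  have z0 (y : R) : forall x : T, x \notin [fset x0]%fset -> (if x == x0 then y else 0) = 0.
    by move=> x; rewrite inE => /negbTE ->.
  have sp2 := summ_fin (z0 (v x0 * (2 * s + s ^+ 2))).
  rewrite rsumD// (rsum_fin (z0 _)) /psum big_seq_fset1 eqxx.
  have hS : rsum v - rsum (fun x => v x * phi x ^+ 2) <= eta.
    rewrite -rsumN// -rsumD//; last exact: summN.
    apply: le_trans (ltW (hG (x0 |` G)%fset (fsubsetU1 _ _))).
    apply: ler_rsum; [|by apply: summD => //; exact: summN|].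
      move=> x; case: ifPn => [/phiG ->|_]; first by rewrite expr1n mulr1 subrr.
      have [p1 p2] := andP (phi01 x).
      have -> : v x + - (v x * phi x ^+ 2) = v x * (1 - phi x ^+ 2) by ring.
      apply: le_trans (ler_norm _) _; rewrite normrM ler_piMr//.
      have q1 : phi x ^+ 2 <= 1 by rewrite expr_le1.
      by rewrite ger0_norm ?subr_ge0// gerBl sqr_ge0.
    by apply: summ_le (summ_abs sv) => x; case: ifP; rewrite ?normr0 ?normr_id.
  have hs : tau * `|v x0| <= v x0 * (2 * s + s ^+ 2).
    rewrite mulrDr mulrCA vs s2.
    have h1 : - (v x0 * tau ^+ 2) <= `|v x0| * tau.
      apply: le_trans (ler_norm _) _; rewrite normrN normrM ler_wpM2l//.
      by rewrite ger0_norm ?sqr_ge0// expr2 ler_piMr// ltW.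
    lra.
  lra.
have hp2 : mu * (- eta + tau * `|v x0|) <= mu * rsum (fun x => v x * cabs2 (gauge p u x)).
  by rewrite ler_pM2l.
apply: le_lt_trans k1 (lt_le_trans _ hp2).
have hE : C1 * (2 * En) <= C1 * (2 * eta) by rewrite ler_wpM2l// ler_pM2l.
have eE : (mu + 2 * C1 + 1) * eta = mu * tau * `|v x0| / 4 by rewrite /eta; field; rewrite gt_eqF.
have mt : 0 < mu * tau * `|v x0| by rewrite !mulr_gt0.
have tA' : C1 * (2 * (d%:R * (4 * tau ^+ 2))) <= mu * `|v x0| * tau / 2 by rewrite /A in tA; lra.
lra.
Qed.
End Top.

(** * Reflection of the spectrum *)

Section Neg.
Variables (R : realType) (d : nat).
Local Notation T := (Zd d).
Local Notation C := R[i].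
Local Notation opr := ((T -> C) -> T -> C).
Implicit Types (H K : opr) (z : C) (f : T -> C).

Lemma spectrumN H K z : (forall f, in_l2 f -> K f = fun x => - H f x) ->
  spectrum K z -> spectrum H (- z).
Proof.
move=> HK sK [S [S1 [[M SM] [S2 S3]]]]; apply: sK.
(* K - z is minus H + z, so its inverse is that of H + z applied to - g. *)
exists (fun g => S (fun x => - g x)); split; first by move=> g /l2N; exact: S1.
split; [exists M => g sg|split => [f sf|g sg]].
- apply: le_trans (SM _ (l2N sg)) _; rewrite !l2norm2E// ?n2N//; exact: l2N.
- rewrite -[RHS](S2 _ sf); congr S; apply/funext => x; rewrite HK//; ring.
- have sS := S1 _ (l2N sg); have E := S3 _ (l2N sg); apply/funext => x.
  have := congr1 (fun u => u x) E; rewrite HK//= => e; rewrite -[RHS]opprK -e; ring.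
Qed.

Lemma eigenspaceN H K z : (forall f, in_l2 f -> K f = fun x => - H f x) ->
  forall f, Defs.eigenspace K z f -> Defs.eigenspace H (- z) f.
Proof.
move=> HK f [sf Kf]; split => //; apply/funext => x.
by have := congr1 (fun u => u x) Kf; rewrite HK//= => e; rewrite mulNr -e opprK.
Qed.

Lemma rdiscN H K E : (forall f, in_l2 f -> K f = fun x => - H f x) ->
  rdisc K E -> rdisc H (- E).
Proof.
move=> HK; have KH f : in_l2 f -> H f = fun x => - K f x.
  by move=> sf; apply/funext => x; rewrite HK// opprK.
have cN : creal (- E) = - creal E :> C by rewrite /creal; congr Complex; rewrite oppr0.
rewrite /rdisc cN => -[s1 [[e [e0 he]] [[f [ef f0]] [n [b hb]]]]]; split; [|split; [|split]].
- exact: spectrumN s1.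
- exists e; split => // z sz zE; have := he (- z) (spectrumN KH sz).
  have -> : cabs (- z - creal E) = cabs (z - - creal E).
    by rewrite /cabs -cabs2N; congr (Num.sqrt (cabs2 _)); ring.
  by apply => e'; apply: zE; rewrite -e' opprK.
- by exists f; split => //; exact: eigenspaceN ef.
- exists n, b => g eg; apply: hb; rewrite -[creal E]opprK; exact: eigenspaceN eg.
Qed.

Lemma csummN (eh : T -> C) : csumm eh -> csumm (fun x => - eh x).
Proof. by apply: summ_le => x; rewrite /cabs cabs2N ger0_norm ?sqrtr_ge0. Qed.

Lemma h0N (eh : T -> C) f x : csumm eh -> in_l2 f -> h0 (fun y => - eh y) f x = - h0 eh f x.
Proof.
move=> se sf; have s := csumm_h0 x se sf.
have c0 : csumm (fun _ : T => 0 : C) by apply: (@summ_le _ _ _ (fun _ : T => 0) _ (@summ0 _ _)) => y; rewrite /cabs cabs2_0 sqrtr0 normr0.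
have := csum_lin (- 1) s c0; rewrite /h0.
have -> : csum (fun _ : T => 0 : C) = 0 by rewrite (@csum_fin _ _ fset0)// big_seq_fset0.
by rewrite addr0 mulN1r => <-; congr csum; apply/funext => y; rewrite addr0 mulN1r mulNr.
Qed.

Lemma hmuN (eh : T -> C) (v : T -> R) mu f : csumm eh -> in_l2 f ->
  hmu (fun x => - eh x) (fun x => - v x) mu f = fun x => - hmu eh v mu f x.
Proof.
move=> se sf; apply/funext => x; rewrite /hmu h0N// mulrN.
have -> : creal (- (mu * v x)) = - creal (mu * v x) :> C by rewrite /creal; congr Complex; rewrite oppr0.
by rewrite mulNr opprD.
Qed.

(* Exchanges the two ends of the spectrum, so that only the top has to be studied. *)
Lemma rdisc_hmuN (eh : T -> C) (v : T -> R) mu E : csumm eh ->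
  rdisc (hmu (fun x => - eh x) (fun x => - v x) mu) (- E) <-> rdisc (hmu eh v mu) E.
Proof.
move=> se; split=> h; last first.
  by apply: rdiscN h => f sf; rewrite hmuN//; apply/funext => x; rewrite opprK.
by rewrite -[E]opprK; apply: rdiscN h => f sf; rewrite hmuN.
Qed.

Lemma dispN (eh : T -> C) q : csumm eh -> disp (fun x => - eh x) q = - disp eh q.
Proof.
move=> se; rewrite /disp /= -rsumN; last first.
  apply: csumm_Re; apply: summ_le se => x; rewrite cabsM.
  by rewrite /cabs /cabs2 /expi /= cos2Dsin2 sqrtr1 mulr1 ger0_norm ?sqrtr_ge0.
by congr rsum; apply/funext => x /=; case: (eh x) => ? ? /=; ring.
Qed.
End Neg.

(** * The moment condition and the two ends of the spectrum *)

Section Final.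
Variables (R : realType) (d : nat).
Local Notation T := (Zd d).

Lemma znorm_ge1 (x : T) : x != 0 -> 1 <= znorm R x.
Proof.
move=> x0; have [k xk] : exists k, x 0 k != 0.
  apply/existsP; rewrite -negb_forall; apply: contra x0 => /forallP h.
  by apply/eqP/rowP => k; rewrite mxE; exact/eqP.
rewrite /znorm -[leLHS]sqrtr1 ler_wsqrtr// (bigD1 k)//=.
rewrite ler_wpDr ?sumr_ge0// => [i _|]; first exact: sqr_ge0.
rewrite -rmorphXn /= ler1z -[1]/(1%:Z) -gtz0_ge1.
by rewrite exprn_even_gt0.
Qed.

(** Off the origin |x|^a >= 1, so the moment dominates |v|; the weight may vanish at 0, where v 0 is
    added by hand. *)
Lemma weighted_summ (v : T -> R) a : 0 <= a ->
  (weighted_sum v a < +oo)%E ->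
  summ v /\ summ (fun x => znorm R x `^ a * `|v x|).
Proof.
move=> a0 h; have sw : summ (fun x : T => znorm R x `^ a * `|v x|).
  apply/summP; move: h; rewrite /weighted_sum; congr (_ < _)%E.
  by apply: eq_esum => x _; rewrite normrM normr_id (ger0_norm (powR_ge0 _ _)).
split=> //; pose w (x : T) : R := if x == 0 then `|v x| else 0.
have s2 : summ w by apply: (@summ_fin _ _ [fset (0%R : T)]%fset) => x; rewrite inE /w => /negbTE ->.
apply: summ_le (summD sw s2) => x; rewrite /w; case: eqVneq => [->|x0].
  by rewrite lerDr mulr_ge0 ?powR_ge0.
rewrite addr0 ler_peMl//; have := znorm_ge1 x0 => h1.
by have := @ge0_ler_powR R a a0 1 (znorm R x); rewrite powR1; apply; rewrite ?nnegrE// (le_trans _ h1).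
Qed.

Lemma weighted_neq0 (v : T -> R) a : (0%:E < weighted_sum v a)%E -> exists x, v x != 0.
Proof.
move=> h; apply/not_existsP => h0; move: h; rewrite /weighted_sum esum1 ?ltxx// => x _.
by have /negP := h0 x; rewrite negbK => /eqP ->; rewrite normr0 mulr0.
Qed.
End Final.

Section OneSide.
Variables (R : realType) (d : nat).
Local Notation T := (Zd d).

Lemma one_sided (eh : T -> R[i]) (v : T -> R) p gamma : d = 1%N \/ d = 2%N -> in_l1 eh ->
  (forall x : T, cconj (eh (- x)) = eh x) ->
  (exists2 c : R, 0 < c & exists C, forall t : 'rV[R]_d, (forall k, `|t 0 k| <= pi) ->
     c * \sum_k t 0 k ^+ 2 <= disp eh p - disp eh (p + t) <= C * \sum_k t 0 k ^+ 2) ->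
  0 < gamma < 1 -> (0%:E < weighted_sum v (2 - d%:R + gamma) < +oo)%E ->
  (forall mu, 0 < mu -> 0 <= rsum v -> exists E, rdisc (hmu eh v mu) E /\ disp eh p < E) /\
  exists2 mu0, 0 < mu0 & forall mu, 0 < mu < mu0 ->
    (forall E E', rdisc (hmu eh v mu) E -> disp eh p < E ->
       rdisc (hmu eh v mu) E' -> disp eh p < E' -> E = E') /\
    (rsum v < 0 -> forall E, rdisc (hmu eh v mu) E -> ~ disp eh p < E).
Proof.
move=> hd /in_l1P se sym [c c0 [Cc hc]] /andP[g0 g1] /andP[/weighted_neq0 [x0 vx0] hv].
have hdR : d%:R = 1 :> R \/ d%:R = 2 :> R by case: hd => ->; [left|right].
(* For d = 1 the upper bound uses gamma < 1; for d = 2 the exponent is gamma itself, positive by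
   hypothesis. *)
have ha : 0 < 2 - d%:R + gamma <= 2 by apply/andP; case: hdR => ->; split; lra.
have hg : 0 < gamma < d%:R by apply/andP; case: hdR => ->; split; lra.
have [sv sw] := weighted_summ (ltW (proj1 (andP ha))) hv.
have lo (t : 'rV[R]_d) : (forall k, `|t 0 k| <= pi) -> c * \sum_k t 0 k ^+ 2 <= disp eh p - disp eh (p + t).
  by move=> /hc /andP[].
have up (t : 'rV[R]_d) : (forall k, `|t 0 k| <= pi) -> disp eh p - disp eh (p + t) <= Cc * \sum_k t 0 k ^+ 2.
  by move=> /hc /andP[].
split; first by move=> mu mu0; exact: (top_existence hd se sym sv c0 lo up mu0 vx0).
have [m1 m10 h1] := top_unique hd se sym sv sw ha erefl hg c0 lo.
have [v0|v0] := ltP (rsum v) 0; last first.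
  by exists m1 => // mu hm; split => [|//]; exact: h1.
have [m2 m20 h2] := top_none hd se sv sw ha erefl hg c0 lo v0.
exists (Num.min m1 m2); first by rewrite lt_min m10.
move=> mu /andP[mu0]; rewrite lt_min => /andP[l1 l2]; split=> [|_].
  by apply: h1; rewrite mu0.
by apply: h2; rewrite mu0.
Qed.
End OneSide.

Theorem theorem1p2 (R : realType) (d : nat) (hd : d = 1%N \/ d = 2%N)
  (eh : Zd d -> R[i]) (v : Zd d -> R)
  (eh_l1 : in_l1 eh)
  (eh_sym : forall x : Zd d, cconj (eh (- x)) = eh x)
  (p0 p1 : 'rV[R]_d)
  (Hmin : unique_min_pt (disp eh) p0) (Hmax : unique_max_pt (disp eh) p1)
  (C2min : C2_near (disp eh) p0) (C2max : C2_near (disp eh) p1)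
  (ndmin : nondegenerate_at (disp eh) p0)
  (ndmax : nondegenerate_at (disp eh) p1)
  (gamma : R) (hgamma : 0 < gamma < 1)
  (hv : (0%:E < weighted_sum v (2 - d%:R + gamma) < +oo)%E) :
  let emin := disp eh p0 in
  let emax := disp eh p1 in
  (forall mu : R, 0 < mu ->
     (0 <= rsum v -> exists E, rdisc (hmu eh v mu) E /\ emax < E) /\
     (rsum v <= 0 -> exists e, rdisc (hmu eh v mu) e /\ e < emin)) /\
  (exists mu0 : R, 0 < mu0 /\
     forall mu : R, 0 < mu < mu0 ->
       (0 < rsum v ->
          (exists E, forall E', (rdisc (hmu eh v mu) E' /\ emax < E') <-> E' = E) /\
          (forall e, rdisc (hmu eh v mu) e -> ~ e < emin)) /\
       (rsum v < 0 ->
          (exists e, forall e', (rdisc (hmu eh v mu) e' /\ e' < emin) <-> e' = e) /\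
          (forall E, rdisc (hmu eh v mu) E -> ~ emax < E)) /\
       (rsum v = 0 ->
          (exists E, forall E', (rdisc (hmu eh v mu) E' /\ emax < E') <-> E' = E) /\
          (exists e, forall e', (rdisc (hmu eh v mu) e' /\ e' < emin) <-> e' = e))).
Proof.
move=> emin emax; have se := (in_l1P eh).1 eh_l1.
have sv : summ v.
  case/andP: hv => _; case/weighted_summ => //.
  by case/andP: hgamma => /ltW g0 _; rewrite addr_ge0// subr_ge0; case: hd => ->; rewrite ?ler1n ?lexx.
have [] := @one_sided R d eh v p1 gamma hd eh_l1 eh_sym _ hgamma hv.
  have m q : torus q -> q <> p1 -> 1 * disp eh q < 1 * disp eh p1.
    by rewrite !mul1r; exact: Hmax.2.
  have [c c0 [C hC]] := disp_bounds hd se (normr1 R) m C2max ndmax.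
  by exists c => //; exists C => t /hC; rewrite !mul1r.
rewrite -/emax => ex1 [m1 m10 h1].
pose eN x := - eh x; pose vN x := - v x.
have sN : in_l1 eN by apply/in_l1P; exact: csummN.
have symN (x : Zd d) : cconj (eN (- x)) = eN x.
  by rewrite /eN -(eh_sym x); case: (eh (- x)).
have hvN : (0%:E < weighted_sum vN (2 - d%:R + gamma) < +oo)%E.
  by rewrite (_ : weighted_sum vN _ = weighted_sum v (2 - d%:R + gamma))//;
    apply: eq_esum => x _; rewrite /vN normrN.
have [] := @one_sided R d eN vN p0 gamma hd sN symN _ hgamma hvN.
  (* The quadratic bounds are derived for [disp eh] with sign -1 and only then rewritten for the
     negated symbol, so regularity and non-degeneracy are used as given. *)
  have m q : torus q -> q <> p0 -> (- 1) * disp eh q < (- 1) * disp eh p0.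
    by rewrite !mulN1r ltrN2; exact: Hmin.2.
  have [c c0 [C hC]] := disp_bounds hd se (normrN1 R) m C2min ndmin.
  by exists c => //; exists C => t /hC; rewrite !mulN1r !dispN.
rewrite dispN// -/emin rsumN// => ex2 [m2 m20 h2].
have lN E : (- emin < - E) = (E < emin) by rewrite ltrN2.
have bot_ex mu : 0 < mu -> rsum v <= 0 -> exists e, rdisc (hmu eh v mu) e /\ e < emin.
  move=> mu0 v0; have [|E [rE lE]] := ex2 mu mu0; first by rewrite oppr_ge0.
  exists (- E); split; last by rewrite -lN opprK.
  by apply: (rdisc_hmuN v mu (- E) se).1; rewrite opprK.
have bot_un mu : 0 < mu < m2 -> forall e e', rdisc (hmu eh v mu) e -> e < emin ->
  rdisc (hmu eh v mu) e' -> e' < emin -> e = e'.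
  move=> /h2 [h _] e e' /(rdisc_hmuN v mu e se).2 r1 l1 /(rdisc_hmuN v mu e' se).2 r2 l2.
  by apply: oppr_inj; apply: (h _ _ r1 _ r2); rewrite lN.
have bot_no mu : 0 < mu < m2 -> 0 < rsum v -> forall e, rdisc (hmu eh v mu) e -> ~ e < emin.
  move=> /h2 [_ h] v0 e /(rdisc_hmuN v mu e se).2 r1; rewrite -lN; apply: h r1.
  by rewrite oppr_lt0.
split; first by move=> mu mu0; split; [exact: ex1|exact: bot_ex].
exists (Num.min m1 m2); split; first by rewrite lt_min m10.
move=> mu /andP[mu0]; rewrite lt_min => /andP[l1 l2].
have mm1 : 0 < mu < m1 by rewrite mu0.
have mm2 : 0 < mu < m2 by rewrite mu0.
have top : 0 <= rsum v ->
  exists E, forall E', (rdisc (hmu eh v mu) E' /\ emax < E') <-> E' = E.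
  move=> v0; have [E [rE lE]] := ex1 mu mu0 v0; exists E => E'; split=> [[rE' lE']|->//].
  exact: (h1 mu mm1).1.
have bot : rsum v <= 0 ->
  exists e, forall e', (rdisc (hmu eh v mu) e' /\ e' < emin) <-> e' = e.
  move=> v0; have [e [re le]] := bot_ex mu mu0 v0; exists e => e'; split=> [[re' le']|->//].
  exact: (bot_un mu mm2).
split; [|split] => v0.
- by split; [exact/top/ltW|exact: bot_no].
- by split; [exact/bot/ltW|exact: (h1 mu mm1).2].
- by split; [apply: top|apply: bot]; rewrite v0.
Qed.
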